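(* Let $V=\mathrm{Sym}(3,\mathbb{C})$ be the space of complex symmetric $3\times 3$ matrices, with $G=\mathrm{SL}(3,\mathbb{C})$ acting by $g\cdot x=gxg^t$. Let $p\geq 2$ and let $A(p)=\mathbb{C}[pV]^G$. Then $A(p)$ possesses a homogeneous system of parameters consisting of $6p-8$ elements of degree $3$, each of which is a linear combination of the polynomials $(x_1,\dots,x_p)\mapsto f(x_i,x_j,x_k)$, $1\leq i,j,k\leq p$.
   Context: $pV=V\oplus\cdots\oplus V$ ($p$ summands) with the diagonal action of $G$, and $\mathbb{C}[pV]^G$ is the algebra of $G$-invariant polynomial functions on $pV$, graded by degree. A homogeneous system of parameters of $A(p)$ is a family of algebraically independent homogeneous elements of positive degree such that $A(p)$ is a finitely generated module over the subalgebra they generate. $f$ denotes the symmetric trilinear form on $V$ obtained by full polarization of $\det$, normalized by $f(x,x,x)=6\det x$; equivalently $f(x,y,z)$ is the coefficient of $abc$ in $\det(ax+by+cz)$. *)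

(* Defs.v *)
From HB Require Import structures.
From mathcomp Require Import all_boot all_order all_algebra.
From mathcomp Require Import complex mpoly.
From mathcomp Require Import reals.

Set Implicit Arguments.
Unset Strict Implicit.
Unset Printing Implicit Defensive.

Import GRing.Theory.
Local Open Scope ring_scope.

Section PolynomialFunctions.
Variables (K : fieldType) (W : vectType K).

(* F is given by the polynomial Q in the linear coordinates attached to a basis
   of W. The notions [polyfun] and [homogfun] below do not depend on the basis. *)
Definition polyfun_of (Q : {mpoly K[\dim {:W}]}) (F : W -> K) : Prop :=
  forall v : W, F v = Q.@[fun i => coord (vbasis {:W}) i v].

Definition polyfun (F : W -> K) : Prop := exists Q, polyfun_of Q F.

Definition homogfun (d : nat) (F : W -> K) : Prop :=
  exists2 Q, Q \is d.-homog & polyfun_of Q F.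

Definition alg_indep (n : nat) (theta : 'I_n -> W -> K) : Prop :=
  forall Q : {mpoly K[n]}, (forall v, Q.@[fun i => theta i v] = 0) -> Q = 0.

(* The elements of the subalgebra generated by the [theta i] are the functions
   [fun v => Q.@[fun i => theta i v]]. *)
Definition module_finite_over (A : (W -> K) -> Prop)
    (n : nat) (theta : 'I_n -> W -> K) : Prop :=
  exists (m : nat) (h : 'I_m -> W -> K),
    (forall j, A (h j)) /\
    (forall F, A F -> exists Q : 'I_m -> {mpoly K[n]},
       forall v, F v = \sum_(j < m) (Q j).@[fun i => theta i v] * h j v).

Definition is_hsop (A : (W -> K) -> Prop)
    (n : nat) (theta : 'I_n -> W -> K) : Prop :=
  [/\ forall i, A (theta i),
      forall i, exists2 d : nat, (0 < d)%N & homogfun d (theta i),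
      alg_indep theta
    & module_finite_over A theta].

End PolynomialFunctions.

Section SymmetricMatrices.
Variable K : fieldType.

Definition symspace : {vspace 'M[K]_3} := fixedSpace (linfun (@trmx K 3 3)).

Lemma symspaceP (x : 'M[K]_3) : reflect (x^T = x) (x \in symspace).
Proof. by apply: (iffP fixedSpaceP); rewrite lfunE. Qed.

Definition Sym3 : vectType K := subvs_of symspace.

(* [vsproj] only retypes [g x g^t], which is symmetric: see [sym_actE]. *)
Definition sym_act (g : 'M[K]_3) (x : Sym3) : Sym3 :=
  vsproj symspace (g *m vsval x *m g^T).

Lemma sym_actE (g : 'M[K]_3) (x : Sym3) :
  vsval (sym_act g x) = g *m vsval x *m g^T.
Proof.
rewrite vsprojK //; apply/symspaceP.
by rewrite !trmx_mul trmxK mulmxA (symspaceP _ (subvsP x)).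
Qed.

Definition pV (p : nat) : vectType K := {ffun 'I_p -> Sym3}.

Definition pV_act (p : nat) (g : 'M[K]_3) (x : pV p) : pV p :=
  [ffun i => sym_act g (x i)].

Definition SL3_invariant (p : nat) (F : pV p -> K) : Prop :=
  forall g : 'M[K]_3, \det g = 1 -> forall x, F (pV_act g x) = F x.

Definition invariant_algebra (p : nat) (F : pV p -> K) : Prop :=
  polyfun F /\ SL3_invariant F.

(* det (a x + b y + c z) as a polynomial in the indeterminates a, b, c. *)
Definition det_pencil (x y z : 'M[K]_3) : {mpoly K[3]} :=
  \det ('X_0 *: map_mx (@mpolyC 3 K) x + 'X_1 *: map_mx (@mpolyC 3 K) y
        + 'X_2 *: map_mx (@mpolyC 3 K) z).

(* The coefficient of abc. *)
Definition polar_det (x y z : Sym3) : K :=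
  (det_pencil (vsval x) (vsval y) (vsval z))@_(U_(0) + U_(1) + U_(2)).

End SymmetricMatrices.

(* Main.v *)
Require Import Defs.
From HB Require Import structures.
From mathcomp Require Import all_boot all_order all_algebra.
From mathcomp Require Import complex mpoly.
From mathcomp Require Import reals boolp.
From mathcomp Require Import ring zify.

Set Implicit Arguments.
Unset Strict Implicit.
Unset Printing Implicit Defensive.

Import Order.TTheory GRing.Theory Num.Theory.
Local Open Scope ring_scope.

(** Let W = pV, N = 6p - 8, and write f_ijk for the invariant
    x |-> f(x_i, x_j, x_k).

    The f_ijk cut out the nullcone.  If they all vanish at x, every matrix in
    the span of the x_i is singular.  A linear space of singular conics either
    has a common vertex or a common line ([singular_space_form]); in both cases
    a one-parameter subgroup of SL(3) contracts x to 0, so every homogeneous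
    invariant of positive degree vanishes at x ([nullcone_cut_out]).

    Invariants that cut out the nullcone make A(p) a finite module over the
    algebra they generate ([finite_over_nullcone_parameters]).  This is
    Hilbert's argument: by the basis theorem and a Reynolds operator, A(p) is
    generated by finitely many homogeneous invariants; by the Nullstellensatz
    some power of each of them lies in the ideal of the parameters; by the
    Reynolds operator again, this holds with invariant coefficients, and one
    concludes by induction on the degree.  The Reynolds operator expands
    F(g x) as a polynomial in the entries of g and pairs it with a power of
    det g; the pairing is the apolar one, for which right multiplication by k
    and by its transpose are adjoint ([apol_adjoint]), so that the result is
    invariant under SL(3).

    The transcendence degree of A(p) is N.  It is at most N: a generic pair
    (x_1, x_2) can be brought to (t I, diagonal) by SL(3), so an invariant is
    determined by its restriction to a linear subspace of dimension N
    ([invariants_dependent]).  It is at least N: on that subspace one can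
    prescribe the values of N of the f_ijk, generically, by solving a cubic for
    x_2 and then, for each further x_j, a linear system and another cubic
    ([basic_polar_independent]).  Both bounds, and their transfer along finite
    extensions, rest on one count of monomials ([counting_dependence]).

    Finally the number of parameters is lowered one at a time
    ([cuts_nullcone_drop]).  Let y_1, ..., y_m be linear combinations of the
    f_ijk that cut out the nullcone and satisfy P(y) = 0 with P nonzero, and let
    P(a) be nonzero.  The linear forms that vanish on the line through a give
    m - 1 new combinations.  At a common zero x of these, y(x) is a multiple of
    a, and it is 0: otherwise a rescaling of x would have y = a, since the y_i
    are homogeneous of degree 3, contradicting P(y) = 0.  Starting from all the
    f_ijk one reaches m = N.  The N combinations obtained are algebraically
    independent: otherwise one more step would give N - 1 invariants over which
    A(p) is finite, against the lower bound. *)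

(** * Polynomials in n+1 variables as polynomials in the last one *)

Section Muni.
Variables (K : comRingType) (n : nat).
Local Notation widen := (widen_ord (leqnSn n)).

Definition mjoin (m : 'X_{1..n}) (k : nat) : 'X_{1..n.+1} :=
  [multinom of rcons m k].

Lemma mjoin_widen m k (i : 'I_n) : mjoin m k (widen i) = m i.
Proof.
by rewrite multinomE (tnth_nth 0%N) /= nth_rcons size_tuple ltn_ord -mnm_nth.
Qed.

Lemma mjoin_max m k : mjoin m k ord_max = k.
Proof.
by rewrite multinomE (tnth_nth 0%N) /= nth_rcons size_tuple ltnn !eqxx.
Qed.

Lemma ord_maxVwiden (i : 'I_n.+1) : i = ord_max \/ exists j, i = widen j.
Proof.
case: (ltnP i n) => [lt_in|le_ni]; [right|left].
  by exists (Ordinal lt_in); apply: val_inj.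
by apply/val_inj/eqP; rewrite eqn_leq -ltnS ltn_ord.
Qed.

Lemma mjoin_split (m : 'X_{1..n.+1}) :
  m = mjoin [multinom m (widen i) | i < n] (m ord_max).
Proof.
apply/mnmP => i; have [->|[j ->]] := ord_maxVwiden i.
  by rewrite mjoin_max.
by rewrite mjoin_widen mnmE.
Qed.

Lemma mjoin_inj m m' k k' : mjoin m k = mjoin m' k' -> m = m' /\ k = k'.
Proof.
move=> eq; split; last by rewrite -(mjoin_max m k) eq mjoin_max.
by apply/mnmP => i; rewrite -(mjoin_widen m k) eq mjoin_widen.
Qed.

Lemma muni_mjoin m k : muni ('X_[mjoin m k] : {mpoly K[n.+1]}) = 'X_[m] *: 'X^k.
Proof.
rewrite muniE msuppX big_seq1 mcoeffX eqxx scale1r mjoin_max; congr ('X_[_] *: _).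
by apply/mnmP => i; rewrite mnmE mjoin_widen.
Qed.

Lemma mcoeff_muni (p : {mpoly K[n.+1]}) k (m : 'X_{1..n}) :
  (muni p)`_k@_m = p@_(mjoin m k).
Proof.
rewrite {1}[p]mpolyE raddf_sum coef_sum raddf_sum /=.
rewrite [p in RHS]mpolyE [RHS]raddf_sum /=; apply: eq_bigr => m' _.
rewrite muniZ coefZ mcoeffCM mcoeffZ mcoeffX [m']mjoin_split muni_mjoin coefZ coefXn.
congr (_ * _); case: eqP => [<-|ne]; last first.
  rewrite mulr0 mcoeff0; case: eqP => // /mjoin_inj [_ eqk]; case: ne; congruence.
rewrite mulr1 mcoeffX; congr (nat_of_bool _)%:R; apply/eqP/eqP => [->//|].
by move=> /mjoin_inj [].
Qed.

Lemma muni_inj : injective (@muni n K).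
Proof.
move=> p q eq_pq; apply/mpolyP => m.
by rewrite [m]mjoin_split -!mcoeff_muni eq_pq.
Qed.

Lemma muni_surj (q : {poly {mpoly K[n]}}) : exists p, muni p = q.
Proof.
elim/poly_ind: q => [|q c [p <-]]; first by exists 0; rewrite muni0.
exists (p * 'X_[mjoin 0%MM 1] + \sum_(m <- msupp c) c@_m *: 'X_[mjoin m 0]).
rewrite muniD muniM muni_mjoin mpolyX0 scale1r expr1; congr (_ + _).
rewrite [c in RHS]mpolyE raddf_sum [RHS]raddf_sum; apply: eq_bigr => m _ /=.
by rewrite muniZ muni_mjoin expr0 -!mul_polyC mulr1 -polyCM mul_mpolyC.
Qed.

Lemma muni_eval (p : {mpoly K[n.+1]}) (v : 'I_n.+1 -> K) :
  (map_poly (meval (v \o widen)) (muni p)).[v ord_max] = p.@[v].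
Proof.
pose f : {rmorphism {mpoly K[n]} -> K} := meval (v \o widen).
rewrite -[meval _]/(f : _ -> _).
have fC c : f c%:MP = c by rewrite /f /= mevalC.
have fX m : f 'X_[m] = \prod_(i < n) v (widen i) ^+ m i by rewrite /f /= mevalX.
move: f fC fX => f fC fX.
elim/mpolyind: p => [|c m p _ _ IH].
  by rewrite muni0 rmorph0 horner0 meval0.
rewrite mevalD.
rewrite -IH.
rewrite muniD.
rewrite (rmorphD (map_poly f)).
rewrite hornerD; congr (_ + _).
rewrite mevalZ muniZ [m]mjoin_split muni_mjoin.
rewrite scalerA -mul_polyC.
rewrite (rmorphM (map_poly f)).
rewrite /= map_polyC /=.
rewrite map_polyXn !hornerE rmorphM fC fX mevalX big_ord_recr /=.
by rewrite mjoin_max -mulrA; congr (_ * (_ * _)); apply: eq_bigr => i _; rewrite mjoin_widen.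
Qed.
End Muni.

Lemma poly_eq0_eval (K : numDomainType) (q : {poly K}) :
  (forall c, q.[c] = 0) -> q = 0.
Proof.
move=> q0; apply/eqP; apply: contraT => nz.
have := @max_poly_roots K q [seq i%:R | i <- iota 0 (size q)] nz.
rewrite size_map size_iota ltnn => -> //; first by apply/allP => c _; apply/rootP.
rewrite map_inj_uniq ?iota_uniq // => a b /eqP.
by rewrite eqr_nat => /eqP.
Qed.

Definition rcons_pt (K : Type) n (v : 'I_n -> K) (a : K) (j : 'I_n.+1) : K :=
  if unlift ord_max j is Some j' then v j' else a.

Lemma rcons_pt_max (K : Type) n (v : 'I_n -> K) a : rcons_pt v a ord_max = a.
Proof. by rewrite /rcons_pt unlift_none. Qed.

Lemma rcons_pt_widen (K : Type) n (v : 'I_n -> K) a j :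
  rcons_pt v a (widen_ord (leqnSn n) j) = v j.
Proof.
rewrite /rcons_pt (_ : widen_ord _ j = lift ord_max j) ?liftK //.
by apply: val_inj; rewrite /= /bump leqNgt ltn_ord.
Qed.

(** Induction on the number of variables: once the other variables are given
    values, a polynomial in the last one has infinitely many zeros. *)
Lemma mpoly_eq0_eval (K : numDomainType) n (p : {mpoly K[n]}) :
  (forall v, p.@[v] = 0) -> p = 0.
Proof.
elim: n p => [|n IHn] p p0.
  by rewrite [p]nvar0_mpolyC; have := p0 (fun _ => 0); rewrite {1}[p]nvar0_mpolyC mevalC => ->.
apply: muni_inj; rewrite muni0; apply/polyP => k; rewrite coef0.
apply: IHn => v.
suff /polyP/(_ k) : map_poly (meval v) (muni p) = 0 by rewrite coef_map coef0.
apply: poly_eq0_eval => c; rewrite -[RHS](p0 (rcons_pt v c)) -muni_eval rcons_pt_max.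
by congr (_.[_]); apply: eq_map_poly => r; apply: meval_eq => j; rewrite /= rcons_pt_widen.
Qed.

Lemma mpoly_neq0_eval (K : numDomainType) n (p : {mpoly K[n]}) :
  p != 0 -> exists v, p.@[v] != 0.
Proof.
move=> nz; apply: contrapT => none; case/eqP: nz; apply: mpoly_eq0_eval => v.
by apply/eqP; apply/negP => /negP nz; apply: none; exists v.
Qed.

(** * Hilbert's Nullstellensatz *)

Definition is_ideal (R : comRingType) (I : R -> Prop) : Prop :=
  [/\ I 0, forall p q, I p -> I q -> I (p + q) & forall p q, I q -> I (p * q)].

Lemma ideal_sum (R : comRingType) (I : R -> Prop) (T : Type) (r : seq T)
    (P : pred T) (F : T -> R) :
  is_ideal I -> (forall i, P i -> I (F i)) -> I (\sum_(i <- r | P i) F i).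
Proof. by case=> I0 ID _ IF; apply: big_ind. Qed.

Lemma ideal_sub (R : comRingType) (I : R -> Prop) p q :
  is_ideal I -> I p -> I q -> I (p - q).
Proof. by case=> I0 ID IM Ip Iq; apply: ID => //; rewrite -mulN1r; apply: IM. Qed.

(** An element of least degree divides the others and is not constant, so any
    of its roots is a common root. *)
Lemma poly_ideal_root (K : closedFieldType) (I : {poly K} -> Prop) :
  is_ideal I -> ~ I 1 -> (exists2 g, I g & g != 0) ->
  exists t, forall q, I q -> q.[t] = 0.
Proof.
move=> idI I1 exg; have [I0 ID IM] := idI.
have exn : exists n, `[< exists2 g, I g & g != 0 /\ size g = n >].
  by have [g Ig nzg] := exg; exists (size g); apply/asboolP; exists g.
case: (ex_minnP exn) => n /asboolP [g Ig [nzg szg]] minn.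
have divg q : I q -> g %| q.
  move=> Iq; rewrite /dvdp; apply: contraT => nzr.
  have Ir : I (q %% g).
    have -> : q %% g = q - (q %/ g) * g by rewrite {2}[q](divp_eq q g) addrAC subrr add0r.
    by apply: ideal_sub => //; apply: IM.
  have /minn : `[< exists2 g0 : {poly K}, I g0 & g0 != 0 /\ size g0 = size (q %% g) >].
    by apply/asboolP; exists (q %% g).
  by rewrite -szg leqNgt ltn_modp nzg.
have szg1 : size g != 1.
  apply/eqP => /eqP /size_poly1P [c nzc gE]; apply: I1.
  have -> : 1 = c^-1%:P * g by rewrite gE -polyCM mulVf.
  exact: IM.
have /closed_rootP [t /rootP gt0] := szg1.
by exists t => q /divg /dvdpP [u ->]; rewrite hornerM gt0 mulr0.
Qed.

(** A Nakayama argument. Since f is monic, the quotient of the polynomial ring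
    by J is spanned over S by the first powers of the variable, and since h =
    1 modulo the kernel of ev, the matrix relations that these powers satisfy
    modulo J specialize to the identity matrix under ev. The determinant of
    the relations kills the quotient, so it lies in J, and it specializes to
    1. *)
Lemma monic_ideal_eval (S K : comRingType) (ev : {rmorphism S -> K})
    (J : {poly S} -> Prop) (f h : {poly S}) :
  is_ideal J -> J f -> f \is monic -> (1 < size f)%N ->
  J h -> map_poly ev h = 1 -> exists2 s, J s%:P & ev s = 1.
Proof.
move=> idJ Jf monf szf Jh evh; have [J0 JD JM] := idJ.
set d := (size f).-1.
have szfE : size f = d.+1 by rewrite /d prednK // ltnW.
(* Modulo J, the power 'X^i is congruent to - r i, and ev kills r i. *)
pose r (i : nat) := Pdiv.Ring.rmodp ('X^i * (h - 1)) f.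
have rE i : 'X^i * (h - 1) = Pdiv.Ring.rdivp ('X^i * (h - 1)) f * f + r i.
  exact: Pdiv.RingMonic.rdivp_eq.
have szr i : (size (r i) <= d)%N.
  by rewrite -ltnS -szfE Pdiv.Ring.ltn_rmodpN0 // monic_neq0.
have evr i : map_poly ev (r i) = 0.
  have /(congr1 (map_poly ev)) := rE i.
  rewrite (rmorphM (map_poly ev)) (rmorphB (map_poly ev)) (rmorph1 (map_poly ev)) /= evh subrr mulr0.
  rewrite (rmorphD (map_poly ev)) (rmorphM (map_poly ev)) /=.
  move=> /esym /eqP; rewrite addr_eq0 => /eqP eqr.
  set q := map_poly ev (Pdiv.Ring.rdivp _ _) in eqr.
  have monevf : map_poly ev f \is monic by apply: monic_map.
  apply/eqP; apply: contraT => nzr.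
  have nzq : q != 0 by apply: contraNneq nzr => q0; rewrite -oppr_eq0 -eqr q0 mul0r.
  have szevf : size (map_poly ev f) = d.+1.
    by rewrite size_map_poly_id0 ?szfE // (monicP monf) rmorph1 oner_neq0.
  have := leq_trans (size_poly _ _ : (size (map_poly ev (r i)) <= _)%N) (szr i).
  rewrite -size_polyN -eqr size_Mmonic // szevf addnS /=.
  by rewrite -[X in (_ <= X)%N]add0n leq_add2r leqNgt size_poly_gt0 nzq.
pose M : 'M[S]_d := \matrix_(i, j) ((i == j)%:R + (r i)`_j).
pose P : 'M[{poly S}]_d := map_mx polyC M.
pose Y : 'cV[{poly S}]_d := \col_j 'X^j.
have JMY i : J ((P *m Y) i 0).
  rewrite mxE (eq_bigr (fun j : 'I_d => (i == j)%:R * 'X^j + (r i)`_j *: 'X^j)); last first.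
    move=> j _; rewrite !mxE polyCD polyC_natr mulrDl; congr (_ + _).
    by rewrite mul_polyC.
  rewrite big_split /= (bigD1 i) //= eqxx mul1r big1 ?addr0; last first.
    by move=> j nij; rewrite eq_sym (negPf nij) mul0r.
  have -> : \sum_(j < d) (r i)`_j *: 'X^j = r i.
    apply/polyP => k; rewrite coef_sum.
    case: (ltnP k d) => [lt_kd|le_dk].
      rewrite (bigD1 (Ordinal lt_kd)) //= coefZ coefXn eqxx mulr1 big1 ?addr0 //.
      move=> j nj; rewrite coefZ coefXn; case: eqP => [kj|]; last by rewrite mulr0.
      by case/eqP: nj; apply: val_inj.
    rewrite big1 ?nth_default ?(leq_trans (szr i)) // => j _.
    rewrite coefZ coefXn gtn_eqF ?mulr0 //; exact: leq_trans (ltn_ord j) le_dk.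
  have -> : 'X^i + r i = 'X^i * h - Pdiv.Ring.rdivp ('X^i * (h - 1)) f * f.
    apply/eqP; rewrite eq_sym subr_eq -addrA [r i + _]addrC -rE; apply/eqP; ring.
  by apply: ideal_sub => //; apply: JM.
have lt0d : (0 < d)%N by rewrite -ltnS -szfE.
exists (\det M).
  have : J ((\adj P *m (P *m Y)) (Ordinal lt0d) 0).
    by rewrite mxE; apply: ideal_sum => // j _; apply: JM.
  rewrite mulmxA mul_adj_mx mul_scalar_mx !mxE expr0 mulr1.
  by rewrite /P det_map_mx.
rewrite -det_map_mx (_ : map_mx ev M = 1%:M) ?det1 //.
apply/matrixP => i j; rewrite !mxE rmorphD /= rmorph_nat.
by have /polyP/(_ j) := evr i; rewrite coef_map coef0 => ->; rewrite addr0.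
Qed.

Section LinearChange.
Variables (K : numClosedFieldType) (n : nat) (b : 'I_n -> K).
Local Notation S := {mpoly K[n]}.
Local Notation widen := (widen_ord (leqnSn n)).

Definition shear_var (i : 'I_n.+1) : {poly S} :=
  if unlift ord_max i is Some j then ('X_j)%:P + (b j)%:MP *: 'X else 'X.

(** The substitution that maps each variable X_j to X_j + b_j Y, where Y is
    the last variable, read as a polynomial in Y. *)
Definition shear : {mpoly K[n.+1]} -> {poly S} :=
  mmap (polyC \o @mpolyC n K) shear_var.

Lemma shear_is_rmorphism : exists f : {rmorphism {mpoly K[n.+1]} -> {poly S}}, f =1 shear.
Proof. by exists (mmap (polyC \o @mpolyC n K) shear_var). Qed.

Lemma unlift_widen (j : 'I_n) : unlift ord_max (widen j) = Some j.
Proof.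
rewrite (_ : widen_ord _ j = lift ord_max j) ?liftK //.
by apply: val_inj; rewrite /= /bump leqNgt ltn_ord.
Qed.

Lemma shear_eval p (v : 'I_n -> K) t :
  (map_poly (meval v) (shear p)).[t] =
  p.@[rcons_pt (fun j => v j + b j * t) t].
Proof.
have [s sE] := shear_is_rmorphism.
have sC c : s c%:MP = (c%:MP)%:P by rewrite sE /shear mmapC.
have sX i : s 'X_i = shear_var i by rewrite sE /shear mmapX mmap1U.
rewrite -sE.
pose f : {rmorphism {mpoly K[n]} -> K} := meval v.
rewrite -[meval _]/(f : _ -> _).
have fC c : f c%:MP = c by rewrite /f /= mevalC.
have fX i : f 'X_i = v i by rewrite /f /= mevalXU.
move: f fC fX s {sE} sC sX => f fC fX s sC sX.
have XE i : (map_poly f (shear_var i)).[t] = rcons_pt (fun j => v j + b j * t) t i.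
  rewrite /rcons_pt /shear_var; case: unlift => [j|]; last by rewrite map_polyX hornerX.
  rewrite (rmorphD (map_poly f)) /= map_polyC /= fX hornerD hornerC -mul_polyC.
  by rewrite (rmorphM (map_poly f)) /= map_polyC /= fC map_polyX hornerM hornerC hornerX.
elim/mpolyind: p => [|c m p _ _ IH].
  by rewrite rmorph0 (rmorph0 (map_poly f)) horner0 meval0.
rewrite mevalD -IH (rmorphD s) (rmorphD (map_poly f)) hornerD; congr (_ + _).
rewrite -mul_mpolyC (rmorphM s) (rmorphM (map_poly f)) sC /= map_polyC /= fC.
rewrite hornerM hornerC mevalM mevalC mevalX; congr (_ * _).
rewrite mpolyXE_id (rmorph_prod s) (rmorph_prod (map_poly f)) horner_prod.
apply: eq_bigr => i _.
by rewrite (rmorphXn s) (rmorphXn (map_poly f)) /= horner_exp sX XE.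
Qed.

Lemma shear_surj q : exists p, shear p = q.
Proof.
have [s sE] := shear_is_rmorphism.
have sC c : s c%:MP = (c%:MP)%:P by rewrite sE /shear mmapC.
have sX i : s 'X_i = shear_var i by rewrite sE /shear mmapX mmap1U.
suff [p <-] : exists p, s p = q by exists p.
have sXm : s 'X_ord_max = 'X by rewrite sX /shear_var unlift_none.
have Xj j : exists p, s p = ('X_j)%:P.
  exists ('X_(widen j) - (b j)%:MP * 'X_ord_max).
  by rewrite rmorphB rmorphM sC !sX /shear_var unlift_widen unlift_none mul_polyC addrK.
have polC (c : S) : exists p, s p = c%:P.
  elim/mpolyind: c => [|c m p _ _ [u su]]; first by exists 0; rewrite rmorph0.
  have [w sw] : exists w, s w = ('X_[m])%:P.
    rewrite mpolyXE_id rmorph_prod /=.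
    elim: (index_enum _) => [|i r [w sw]]; first by exists 1; rewrite big_nil rmorph1.
    have [x sx] := Xj i.
    by exists (x ^+ m i * w); rewrite big_cons rmorphM rmorphXn sx sw rmorphXn.
  exists (c%:MP * w + u).
  by rewrite rmorphD rmorphM sC sw su polyCD -polyCM mul_mpolyC.
elim/poly_ind: q => [|q c [p <-]]; first by exists 0; rewrite rmorph0.
have [u su] := polC c.
by exists (p * 'X_ord_max + u); rewrite rmorphD rmorphM sXm su.
Qed.

(** Enough of injectivity for a proper ideal to stay proper. *)
Lemma shear_inj1 p : shear p = 1 -> p = 1.
Proof.
move=> p1; apply/eqP; rewrite -subr_eq0; apply/eqP; apply: mpoly_eq0_eval => v.
have -> : v = rcons_pt (fun j => (v (widen j) - b j * v ord_max) + b j * v ord_max) (v ord_max).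
  apply: funext => i; have [->|[j ->]] := ord_maxVwiden i.
    by rewrite rcons_pt_max.
  by rewrite rcons_pt_widen subrK.
rewrite mevalB -shear_eval p1 meval1 (rmorph1 (map_poly (meval (fun j : 'I_n => _)))).
by rewrite hornerC subrr.
Qed.

(** The degree of q is at most k and c is the coefficient in degree k; c may
    be 0, which makes the notion additive. *)
Definition topcoef (q : {poly S}) k (c : K) := (size q <= k.+1)%N /\ q`_k = c%:MP.

Lemma topcoefM q q' k k' c c' :
  topcoef q k c -> topcoef q' k' c' -> topcoef (q * q') (k + k') (c * c').
Proof.
move=> [sz ck] [sz' ck']; split.
  apply: leq_trans (size_mul_leq _ _) _.
  by rewrite -ltnS -subn1; lia.
rewrite coefM (bigD1 (inord k)) //= inordK ?ltnS ?leq_addr // addKn ck ck' mpolyCM.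
rewrite big1 ?addr0 // => i nik.
have neqik : (i : nat) != k.
  by apply: contra nik => /eqP ik; apply/eqP/val_inj; rewrite /= inordK ?ltnS ?leq_addr.
case: (ltnP k i) => ik; first by rewrite nth_default ?mul0r // (leq_trans sz).
have ltik : (i < k)%N by rewrite ltn_neqAle neqik.
rewrite [q'`__]nth_default ?mulr0 //; apply: leq_trans sz' _; lia.
Qed.

Lemma topcoef_prod (T : Type) (r : seq T) (F : T -> {poly S}) k c :
  (forall i, topcoef (F i) (k i) (c i)) ->
  topcoef (\prod_(i <- r) F i) (\sum_(i <- r) k i)%N (\prod_(i <- r) c i).
Proof.
move=> H; elim: r => [|i r IH]; last by rewrite !big_cons; apply: topcoefM.
by rewrite !big_nil; split; rewrite ?size_poly1 // coefC.
Qed.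

Lemma topcoefX q k c e : topcoef q k c -> topcoef (q ^+ e) (k * e) (c ^+ e).
Proof.
move=> H; elim: e => [|e IH]; last by rewrite !exprS mulnS; apply: topcoefM.
by rewrite !expr0 muln0; split; rewrite ?size_poly1 // coefC.
Qed.

(** A monomial X^m Y^e becomes prod_j (X_j + b_j Y)^(m_j) Y^e, whose
    coefficient in the total degree is the value of the monomial at (b, 1). *)
Lemma shear_topcoef d p : (msize p <= d.+1)%N ->
  topcoef (shear p) d (pihomog mdeg d p).@[rcons_pt b 1].
Proof.
have [s sE] := shear_is_rmorphism.
have sC c : s c%:MP = (c%:MP)%:P by rewrite sE /shear mmapC.
have sX i : s 'X_i = shear_var i by rewrite sE /shear mmapX mmap1U.
rewrite -sE => szp.
have tX i : topcoef (s 'X_i) 1 (rcons_pt b 1 i).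
  rewrite sX /shear_var /rcons_pt; case: unlift => [j|]; last first.
    by split; rewrite ?size_polyX // coefX.
  split; last by rewrite coefD coefC coefZ coefX mulr1 add0r.
  apply: leq_trans (size_polyD _ _) _; rewrite geq_max size_polyC.
  by rewrite (leq_trans (size_scale_leq _ _)) ?size_polyX // andbT; case: eqP.
have tXm m : topcoef (s 'X_[m]) (mdeg m) ('X_[m]).@[rcons_pt b 1].
  rewrite mpolyXE_id rmorph_prod /= mdegE rmorph_prod /=.
  apply: topcoef_prod => i; rewrite rmorphXn rmorphXn /= mevalXU -[m i in X in topcoef _ X]mul1n.
  exact: topcoefX.
have tD q q' c c' : topcoef q d c -> topcoef q' d c' -> topcoef (q + q') d (c + c').
  move=> [sz ck] [sz' ck']; split; last by rewrite coefD ck ck' mpolyCD.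
  by rewrite (leq_trans (size_polyD _ _)) // geq_max sz sz'.
have H r : (forall m, m \in r -> (mdeg m <= d)%N) ->
    topcoef (s (\sum_(m <- r) p@_m *: 'X_[m])) d
      (\sum_(m <- r | mdeg m == d) p@_m *: 'X_[m]).@[rcons_pt b 1].
  elim: r => [|m r IH] ler.
    by rewrite !big_nil rmorph0 meval0; split; rewrite ?size_poly0 // coef0 mpolyC0.
  have {}IH : topcoef (s (\sum_(m <- r) p@_m *: 'X_[m])) d
      (\sum_(m <- r | mdeg m == d) p@_m *: 'X_[m]).@[rcons_pt b 1].
    by apply: IH => m' m'r; apply: ler; rewrite inE m'r orbT.
  have lem : (mdeg m <= d)%N by apply: ler; rewrite inE eqxx.
  have [szm cm] := tXm m.
  have sZ : s (p@_m *: 'X_[m]) = (p@_m)%:MP *: s 'X_[m].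
    by rewrite -mul_mpolyC rmorphM sC mul_polyC.
  have szZ : (size (s (p@_m *: 'X_[m])) <= (mdeg m).+1)%N.
    by rewrite sZ (leq_trans (size_scale_leq _ _)).
  rewrite !big_cons rmorphD; case: eqP => [eqm|neqm].
    rewrite mevalD; apply: tD => //; rewrite -[X in topcoef _ X]eqm; split => //.
    by rewrite sZ coefZ cm mevalZ mpolyCM.
  rewrite -[X in topcoef _ _ X]add0r; apply: tD => //; split.
    exact: leq_trans szZ _.
  rewrite mpolyC0 nth_default // (leq_trans szZ) // ltn_neqAle lem andbT; exact/eqP.
rewrite {1}[p]mpolyE pihomogE; apply: H => m /msize_mdeg_lt mp.
by rewrite -ltnS (leq_trans mp).
Qed.
End LinearChange.

Lemma dhomog_eval_scale (K : comRingType) n d (p : {mpoly K[n]}) (c : K) v :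
  p \is d.-homog -> p.@[fun i => c * v i] = c ^+ d * p.@[v].
Proof.
move=> hp; rewrite !mevalE mulr_sumr; apply: eq_big_seq => m /(dhomog_mf hp) /= dm.
rewrite mulrCA; congr (_ * _); rewrite -dm mdegE -prodrXr -big_split /=.
by apply: eq_bigr => i _; rewrite exprMn.
Qed.

(** The leading coefficient is the value at (b, 1) of the homogeneous part of
    top degree. A point where that part and the last variable are both nonzero
    can be rescaled to last coordinate 1. *)
Lemma shear_monic (K : numClosedFieldType) n (p : {mpoly K[n.+1]}) : p != 0 ->
  exists b c, [/\ c != 0 & c%:MP *: shear b p \is monic].
Proof.
move=> nzp; pose d := mdeg (mlead p).
have szp : msize p = d.+1 by rewrite mlead_deg.
pose g := pihomog mdeg d p.
have nzg : g != 0.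
  apply/eqP => /mpolyP/(_ (mlead p)); rewrite mcoeff0 /g pihomogE raddf_sum /=.
  rewrite big_mkcond (bigD1_seq (mlead p)) ?mlead_supp ?msupp_uniq //= eqxx.
  rewrite mcoeffZ mcoeffX eqxx mulr1 big1 ?addr0 => [/eqP|m nm].
    by rewrite mleadc_eq0 (negPf nzp).
  by case: ifP => // _; rewrite mcoeffZ mcoeffX (negPf nm) mulr0.
have [v] : exists v, (g * 'X_ord_max).@[v] != 0.
  apply: mpoly_neq0_eval; rewrite mulf_neq0 //; apply/eqP => /mpolyP/(_ U_(ord_max)%MM).
  by rewrite mcoeffX eqxx mcoeff0 => /eqP; rewrite oner_eq0.
rewrite mevalM mevalXU mulf_eq0 negb_or => /andP [nzgv nzv].
pose b := fun j => v (widen_ord (leqnSn n) j) / v ord_max.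
have bE : v =1 (fun i => v ord_max * rcons_pt b 1 i).
  move=> i; have [->|[j ->]] := ord_maxVwiden i.
    by rewrite rcons_pt_max mulr1.
  by rewrite rcons_pt_widen /b mulrCA mulfV ?mulr1.
have nzgb : g.@[rcons_pt b 1] != 0.
  apply: contraNneq nzgv => gb0.
  by rewrite (meval_eq _ bE) (dhomog_eval_scale _ _ (pihomogP _ _ _)) gb0 mulr0.
have [] := @shear_topcoef K n b d p; first by rewrite szp.
rewrite -/g => szs cs.
exists b, (g.@[rcons_pt b 1])^-1; split; first by rewrite invr_eq0.
have szs' : size (shear b p) = d.+1.
  apply/eqP; rewrite eqn_leq szs /= ltnNge; apply/negP => le.
  move: cs; rewrite nth_default // => /esym /eqP.
  by rewrite mpolyC_eq0 (negPf nzgb).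
apply/eqP; rewrite lead_coefZ lead_coefE szs' /= cs -mpolyCM mulVf //.
Qed.

(** Induction on n. After a shear the ideal contains a polynomial f that is
    monic in the last variable. The elements free of the last variable form a
    proper ideal, with a zero a by induction. Setting the first variables to a
    maps the ideal to an ideal of K[Y]; if that contained 1,
    [monic_ideal_eval] would give an element of the ideal free of Y with value
    1 at a. So it has a root. *)
Theorem weak_nullstellensatz (K : numClosedFieldType) n (I : {mpoly K[n]} -> Prop) :
  is_ideal I -> ~ I 1 -> exists v, forall p, I p -> p.@[v] = 0.
Proof.
elim: n I => [|n IHn] I idI I1; have [I0 ID IM] := idI.
  exists (fun _ => 0) => p Ip; rewrite [p]nvar0_mpolyC mevalC.
  apply/eqP; apply/negP => /negP nz; apply: I1.
  have -> : 1 = (p@_0%MM)^-1%:MP * p by rewrite {2}[p]nvar0_mpolyC -mpolyCM mulVf.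
  exact: IM.
have [[f If nzf]|allz] := EM (exists2 f, I f & f != 0); last first.
  exists (fun _ => 0) => p Ip; have -> : p = 0; last by rewrite meval0.
  by apply/eqP; apply/negP => /negP nz; apply: allz; exists p.
have [b [c [nzc mon]]] := shear_monic nzf.
have [s sE] := shear_is_rmorphism b.
pose J q := exists2 p, I p & shear b p = q.
have idJ : is_ideal J.
  split.
  - by exists 0; rewrite // -sE rmorph0.
  - move=> _ _ [p Ip <-] [q Iq <-]; exists (p + q); first exact: ID.
    by rewrite -!sE rmorphD.
  - move=> q _ [p Ip <-]; have [u <-] := shear_surj b q.
    by exists (u * p); [exact: IM | rewrite -!sE rmorphM].
have J1 : ~ J 1 by move=> [p Ip /shear_inj1 p1]; apply: I1; rewrite -p1.
have [J0 JD JM] := idJ.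
have Jf : J (c%:MP *: shear b f) by rewrite -mul_polyC; apply: JM; exists f.
have szf : (1 < size (c%:MP *: shear b f))%N.
  rewrite ltnNge; apply/negP => sz1; apply: J1.
  by rewrite -(_ : c%:MP *: shear b f = 1) //; move: mon; rewrite (size1_polyC sz1) => /monicP; rewrite lead_coefC => ->.
have [a aP] : exists a, forall p, J p%:P -> p.@[a] = 0.
  apply: (IHn (fun p => J p%:P)); last by rewrite polyC1.
  split.
  - by rewrite polyC0.
  - by move=> p q Jp Jq; rewrite polyCD; apply: JD.
  - by move=> p q Jq; rewrite polyCM; apply: JM.
pose ev : {rmorphism {mpoly K[n]} -> K} := meval a.
pose EJ q := exists2 h, J h & map_poly ev h = q.
have [t tP] : exists t, forall q, EJ q -> q.[t] = 0.
  apply: poly_ideal_root.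
  - split.
    + by exists 0; rewrite ?(rmorph0 (map_poly ev)).
    + move=> _ _ [p Jp <-] [q Jq <-]; exists (p + q); first exact: JD.
      by rewrite (rmorphD (map_poly ev)).
    + move=> q _ [p Jp <-]; exists (map_poly (@mpolyC n K) q * p); first exact: JM.
      rewrite (rmorphM (map_poly ev)) /= -map_poly_comp; congr (_ * _).
      by apply: map_poly_id => x _ /=; rewrite mevalC.
  - move=> [h Jh evh]; have [u Ju evu] := monic_ideal_eval idJ Jf mon szf Jh evh.
    by have := aP _ Ju; rewrite -/(ev u) evu => /eqP; rewrite oner_eq0.
  - exists (map_poly ev (c%:MP *: shear b f)); first by exists (c%:MP *: shear b f).
    exact/monic_neq0/monic_map.
exists (rcons_pt (fun j => a j + b j * t) t) => p Ip.
rewrite -(shear_eval b p a t).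
apply: tP.
exists (shear b p).
  by exists p.
exact: erefl.
Qed.

(** Rabinowitsch: with an extra variable Y, the ideal generated by I and 1 - F
    Y has no zero, so 1 = q + (1 - F Y) g with the coefficients of q in I.
    Comparing coefficients, g_0 = 1 and g_(j+1) = F g_j modulo I, hence g_j =
    F^j, and g_j = 0 for large j. *)
Theorem nullstellensatz (K : numClosedFieldType) n (I : {mpoly K[n]} -> Prop) F :
  is_ideal I -> (forall v, (forall p, I p -> p.@[v] = 0) -> F.@[v] = 0) ->
  exists N, I (F ^+ N).
Proof.
move=> idI IF; have [I0 ID IM] := idI.
pose CI (q : {poly {mpoly K[n]}}) := forall k, I q`_k.
pose I2 (p : {mpoly K[n.+1]}) := exists q g : {poly {mpoly K[n]}}, CI q /\ muni p = q + (1 - F *: 'X) * g.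
have idI2 : is_ideal I2.
  split.
  - by exists 0, 0; split=> [k|]; rewrite ?coef0 // mulr0 addr0 muni0.
  - move=> p p' [q [g [Cq e]]] [q' [g' [Cq' e']]]; exists (q + q'), (g + g').
    by split=> [k|]; [rewrite coefD; apply: ID | rewrite muniD e e'; ring].
  - move=> p p' [q [g [Cq e]]]; exists (muni p * q), (muni p * g).
    split=> [k|]; last by rewrite muniM e; ring.
    by rewrite coefM; apply: ideal_sum => // i _; apply: IM.
have [I21|nI21] := EM (I2 1); last first.
  have [v vP] := weak_nullstellensatz idI2 nI21.
  have Fv : F.@[v \o widen_ord (leqnSn n)] = 0.
    apply: IF => p Ip; have [u uE] := muni_surj p%:P.
    have <- : u.@[v] = p.@[v \o widen_ord (leqnSn n)].
      by rewrite -muni_eval uE map_polyC hornerC.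
    apply: vP; exists p%:P, 0; rewrite mulr0 addr0; split=> // k.
    by rewrite coefC; case: eqP.
  have [u uE] := muni_surj (1 - F *: 'X).
  have : u.@[v] = 0.
    by apply: vP; exists 0, 1; rewrite mulr1 add0r; split=> // k; rewrite coef0.
  rewrite -muni_eval uE.
  pose ev : {rmorphism {mpoly K[n]} -> K} := meval (v \o widen_ord (leqnSn n)).
  rewrite -[meval _]/(ev : _ -> _) (rmorphB (map_poly ev)) (rmorph1 (map_poly ev)).
  rewrite -mul_polyC (rmorphM (map_poly ev)) /= map_polyC /= Fv mul0r subr0.
  by rewrite hornerC => /eqP; rewrite oner_eq0.
have [q [g [Cq]]] := I21; rewrite muni1 => e.
have Ig j : I (F ^+ j - g`_j).
  elim: j => [|j IHj].
    have /polyP/(_ 0%N) := e; rewrite coefD mulrBl mul1r coefB -scalerAl coefZ coefXM /=.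
    rewrite mulr0 subr0 coef1 expr0 => e0.
    by rewrite (e0 : 1 = _) addrK.
  have /polyP/(_ j.+1) := e; rewrite coefD mulrBl mul1r coefB -scalerAl coefZ coefXM /=.
  rewrite coef1 /= => /esym eqj.
  have -> : F ^+ j.+1 - g`_j.+1 = F * (F ^+ j - g`_j) + q`_j.+1.
    by move/eqP: eqj; rewrite addr_eq0 opprB exprS => /eqP ->; ring.
  by apply: ID => //; apply: IM.
by exists (size g); have := Ig (size g); rewrite nth_default // subr0.
Qed.

(** * Hilbert's basis theorem *)

(** Induction on n. The monomials of the first n variables that occur have a
    finite basis; let A bound the exponents of the last variable in chosen
    lifts of that basis. Monomials with last exponent at least A are above a
    lift, and each last exponent below A is settled by induction. *)
Lemma dickson n (L : 'X_{1..n} -> Prop) :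
  exists s : seq 'X_{1..n}, (forall m, m \in s -> L m) /\
    forall m, L m -> exists2 m', m' \in s & (m' <= m)%MM.
Proof.
elim: n L => [|n IHn] L.
  have [[m Lm]|noL] := EM (exists m, L m); last by exists [::]; split=> // m Lm; case: noL; exists m.
  exists [:: m]; split=> [m'|m' _]; first by rewrite inE => /eqP ->.
  by exists m; rewrite ?inE //; apply/mnm_lepP => -[].
have [s' [s'L Ls']] := IHn (fun m => exists k, L (mjoin m k)).
have [kf kfP] : exists kf, forall m, m \in s' -> L (mjoin m (kf m)).
  have /choice [kf kfP] : forall m, exists k, m \in s' -> L (mjoin m k).
    move=> m; case: (boolP (m \in s')) => [/s'L [k Lk]|_]; first by exists k.
    by exists 0%N.
  by exists kf.
have /choice [sl slP] := fun a => IHn (fun m => L (mjoin m a)).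
pose A := (\max_(m <- s') kf m)%N.
exists ([seq mjoin m (kf m) | m <- s'] ++ flatten [seq [seq mjoin m a | m <- sl a] | a <- iota 0 A]).
split=> [m|m Lm].
  rewrite mem_cat => /orP [/mapP [m' m's' ->]|/flattenP [l /mapP [a _ ->] /mapP [m' m'l ->]]].
    exact: kfP.
  by have [slL _] := slP a; apply: slL.
have lej (m1 m2 : 'X_{1..n}) k1 k2 : (m1 <= m2)%MM -> (k1 <= k2)%N -> (mjoin m1 k1 <= mjoin m2 k2)%MM.
  move=> /mnm_lepP lem lek; apply/mnm_lepP => i; have [->|[j ->]] := ord_maxVwiden i.
    by rewrite !mjoin_max.
  by rewrite !mjoin_widen.
have [mu [k mE]] : exists mu k, m = mjoin mu k by do 2!eexists; apply: mjoin_split.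
subst m.
case: (ltnP k A) => [ltkA|leAk].
  have [_ /(_ _ Lm) [m' m's le']] := slP k.
  exists (mjoin m' k); last exact: lej.
  rewrite mem_cat; apply/orP; right; apply/flattenP.
  exists [seq mjoin m0 k | m0 <- sl k]; last exact: map_f.
  by apply/mapP; exists k; rewrite // mem_iota.
have [m' m's le'] := Ls' mu (ex_intro _ k Lm).
exists (mjoin m' (kf m')).
  by rewrite mem_cat (map_f (fun m => mjoin m (kf m))).
apply: lej => //; apply: leq_trans leAk.
by rewrite /A; apply: (@leq_bigmax_seq _ s' xpredT kf m').
Qed.

Section Generated.
Variable (R : comRingType).

Inductive gen_ideal (P : R -> Prop) : R -> Prop :=
  | gen_zero : gen_ideal P 0
  | gen_in p : P p -> gen_ideal P p
  | gen_add p q : gen_ideal P p -> gen_ideal P q -> gen_ideal P (p + q)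
  | gen_mul p q : gen_ideal P q -> gen_ideal P (p * q).

Lemma gen_is_ideal P : is_ideal (gen_ideal P).
Proof. by split; [exact: gen_zero | exact: gen_add | exact: gen_mul]. Qed.

Lemma gen_sub (I P : R -> Prop) p :
  is_ideal I -> (forall f, P f -> I f) -> gen_ideal P p -> I p.
Proof.
case=> I0 ID IM PI; elim=> {p} [//|p Pp|p q _ Ip _ Iq|p q _ Iq].
- exact: PI.
- exact: ID.
- exact: IM.
Qed.

Lemma gen_finite (P : R -> Prop) p : gen_ideal P p ->
  exists s : seq R, (forall f, f \in s -> P f) /\ gen_ideal (fun f => f \in s) p.
Proof.
elim=> {p} [|p Pp|p q _ [s1 [sP1 g1]] _ [s2 [sP2 g2]]|p q _ [s [sP g]]].
- by exists [::]; split=> //; exact: gen_zero.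
- exists [:: p]; split=> [g|]; first by rewrite inE => /eqP ->.
  by apply: gen_in; rewrite inE.
- exists (s1 ++ s2); split.
    by move=> f; rewrite mem_cat => /orP [/sP1|/sP2].
  by apply: gen_add; [move: g1|move: g2]; apply: gen_sub (gen_is_ideal _) _ => f fs;
    apply: gen_in; rewrite mem_cat fs ?orbT.
- by exists s; split=> //; apply: gen_mul.
Qed.

Lemma gen_comb r (F : 'I_r -> R) p : gen_ideal (fun f => exists i, f = F i) p ->
  exists h : 'I_r -> R, p = \sum_i h i * F i.
Proof.
apply: (@gen_sub (fun p => exists h : 'I_r -> R, p = \sum_i h i * F i)) => [|f [i ->]]; last first.
  exists (fun j => (j == i)%:R); rewrite (bigD1 i) //= eqxx mul1r big1 ?addr0 //.
  by move=> j /negPf ->; rewrite mul0r.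
split.
- by exists (fun=> 0); rewrite big1 // => i _; rewrite mul0r.
- move=> _ _ [h ->] [h' ->]; exists (fun i => h i + h' i).
  by rewrite -big_split; apply: eq_bigr => i _; rewrite mulrDl.
- move=> q _ [h ->]; exists (fun i => q * h i).
  by rewrite mulr_sumr; apply: eq_bigr => i _; rewrite mulrA.
Qed.
End Generated.

(** By [dickson] finitely many elements of the ideal generated by P have
    leading monomials that divide all the others. Division by these
    terminates, so they generate, and each involves finitely many elements of
    P. *)
Theorem hilbert_basis (K : fieldType) n (P : {mpoly K[n]} -> Prop) :
  exists r (F : 'I_r -> {mpoly K[n]}), (forall i, P (F i)) /\
    forall p, P p -> exists h : 'I_r -> {mpoly K[n]}, p = \sum_i h i * F i.
Proof.
pose G := gen_ideal P; have idG := gen_is_ideal P; have [G0 GD GM] := idG.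
have [ms [msL Lms]] := dickson (fun m => exists f, [/\ G f, f != 0 & mlead f = m]).
have [ff ffP] : exists ff : 'X_{1..n} -> {mpoly K[n]}, forall m, m \in ms -> 
    [/\ G (ff m), ff m != 0 & mlead (ff m) = m].
  have /choice [ff ffP] : forall m, exists f : {mpoly K[n]}, m \in ms -> [/\ G f, f != 0 & mlead f = m].
    move=> m; case: (boolP (m \in ms)) => [/msL [f Hf]|_]; first by exists f.
    by exists 0.
  by exists ff.
have [s [sP sG]] : exists s : seq {mpoly K[n]}, (forall f, f \in s -> P f) /\
    forall m, m \in ms -> gen_ideal (fun f => f \in s) (ff m).
  move: ffP; elim: ms {msL Lms} => [|m ms IH] ffP; first by exists [::].
  have [|s [sP sG]] := IH; first by move=> m' m'ms; apply: ffP; rewrite inE m'ms orbT.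
  have [/gen_finite [s1 [s1P s1G]] _ _] := ffP m (mem_head _ _).
  exists (s1 ++ s); split=> [f|m'].
    by rewrite mem_cat => /orP [/s1P|/sP].
  rewrite inE => /orP [/eqP ->|/sG {}sG].
    by apply: gen_sub (gen_is_ideal _) _ s1G => f fs; apply: gen_in; rewrite mem_cat fs.
  by apply: gen_sub (gen_is_ideal _) _ sG => f fs; apply: gen_in; rewrite mem_cat fs orbT.
have [H0 HD HM] := gen_is_ideal (fun f => f \in s).
have GH p : G p -> gen_ideal (fun f => f \in s) p.
  have [m] : exists m, mlead p = m by exists (mlead p).
  elim/(well_founded_ind (@ltom_wf n)): m p => m IH p mE Gp.
  case: (eqVneq p 0) => [-> //|nzp].
  have [m' m'ms lem] := Lms m (ex_intro _ p (And3 Gp nzp mE)).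
  have [Gg nzg mg] := ffP _ m'ms; set g := ff m' in Gg nzg mg.
  pose u := (mleadc p / mleadc g)%:MP * 'X_[m - m'].
  have nzu : u != 0.
    rewrite /u mul_mpolyC mscalerI negb_or mulf_neq0 ?invr_eq0 ?mleadc_eq0 //=.
    by apply/eqP => /mpolyP/(_ (m - m')%MM); rewrite mcoeffX mcoeff0 eqxx => /eqP; rewrite oner_eq0.
  have mu : mlead u = (m - m')%MM.
    by rewrite /u mul_mpolyC mleadZ ?mleadXm // mulf_neq0 ?invr_eq0 ?mleadc_eq0.
  have mug : mlead (u * g) = m by rewrite mleadM // mu mg submK.
  have cug : (u * g)@_m = p@_m.
    rewrite -mug mleadM // mleadcM mu mg submK // /u mcoeffCM mcoeffX eqxx mulr1 -mE.
    by rewrite -mg mulfVK // mleadc_eq0.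
  rewrite -[p](subrK (u * g)); apply: HD; last by apply: HM; apply: sG.
  case: (eqVneq (p - u * g) 0) => [->//|nzd].
  have Gd : G (p - u * g) by apply: ideal_sub => //; apply: GM.
  suff ltm : (mlead (p - u * g) < m)%O by exact: (IH _ ltm _ erefl Gd).
  rewrite lt_neqAle; apply/andP; split.
    have := mlead_supp nzd; apply: contraL => /eqP ->.
    by rewrite mcoeff_msupp negbK mcoeffB cug subrr.
  by apply: le_trans (mleadB_le _ _) _; rewrite mE mug joinxx.
exists (size s), (fun i => s`_i); split=> [i|p Pp]; first by apply: sP; apply: mem_nth.
apply: gen_comb; have := GH _ (gen_in Pp); apply: gen_sub (gen_is_ideal _) _ => f fs.
apply: gen_in; have fi : (index f s < size s)%N by rewrite index_mem.
by exists (Ordinal fi); rewrite /= nth_index.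
Qed.

(** * Algebraic dependence by counting monomials *)

Section Counting.
Variables (K : fieldType).

(** The monomials with all exponents below N, which are easier to count than
    those of bounded degree. *)
Definition box_mnm m N (a : {ffun 'I_m -> 'I_N}) : 'X_{1..m} := [multinom a i : nat | i < m].

Lemma box_mnm_inj m N : injective (@box_mnm m N).
Proof.
by move=> a b /mnmP e; apply/ffunP => i; apply: val_inj; have := e i; rewrite !mnmE.
Qed.

Lemma box_expand d D (q : {mpoly K[d]}) : (msize q <= D)%N ->
  q = \sum_(b : {ffun 'I_d -> 'I_D}) q@_(box_mnm b) *: 'X_[box_mnm b].
Proof.
move=> szq; apply/mpolyP => m; rewrite raddf_sum /=.
have [mD|nD] := EM (forall i, (m i < D)%N).
  pose b := [ffun i => Ordinal (mD i)].
  have bE : box_mnm b = m by apply/mnmP => i; rewrite mnmE ffunE.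
  rewrite (bigD1 b) //= mcoeffZ mcoeffX bE eqxx mulr1 big1 ?addr0 // => b' nb.
  rewrite mcoeffZ mcoeffX -bE; case: eqP => [/box_mnm_inj /eqP|]; last by rewrite mulr0.
  by rewrite (negPf nb).
have [i leDi] : exists i, (D <= m i)%N.
  apply: contrapT => none; apply: nD => i; rewrite ltnNge; apply/negP => le.
  by apply: none; exists i.
rewrite big1 => [|b _]; last first.
  rewrite mcoeffZ mcoeffX; case: eqP => [e|]; last by rewrite mulr0.
  by move: leDi; rewrite -e mnmE leqNgt ltn_ord.
apply: memN_msupp_eq0; apply: msize_mdeg_ge; apply: leq_trans szq _.
by rewrite mdegE (bigD1 i) //= (leq_trans leDi) // leq_addr.
Qed.

(** If the h_k span a module over K[theta] that contains 1 and is stable under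
    the z_i, then a monomial in z of degree t is a combination of the h_k with
    coefficients of degree O(t) in theta. There are N^m monomials in z with
    exponents below N, and the combinations live in a space of dimension
    O(N^d); for d < m and N large some nonzero combination of the monomials
    vanishes. *)
Theorem counting_dependence (X : Type) d m r (theta : 'I_d -> X -> K)
    (h : 'I_r -> X -> K) (z : 'I_m -> X -> K) : (d < m)%N ->
  (exists c : 'I_r -> {mpoly K[d]},
     forall x, 1 = \sum_k (c k).@[theta^~ x] * h k x) ->
  (forall i j, exists Q : 'I_r -> {mpoly K[d]},
     forall x, z i x * h j x = \sum_k (Q k).@[theta^~ x] * h k x) ->
  exists2 P : {mpoly K[m]}, P != 0 & forall x, P.@[z^~ x] = 0.
Proof.
move=> ltdm [c cP] zQ.
have /choice [Q QP] : forall ij : 'I_m * 'I_r, exists Q : 'I_r -> {mpoly K[d]},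
     forall x, z ij.1 x * h ij.2 x = \sum_k (Q k).@[theta^~ x] * h k x.
  by move=> [i j]; apply: zQ.
pose E := (\sum_k msize (c k) + \sum_ij \sum_k msize (Q ij k))%N.
have cE k : (msize (c k) <= E.+1)%N.
  by rewrite leqW // /E (bigD1 k) //= -!addnA leq_addr.
have QE ij k : (msize (Q ij k) <= E.+1)%N.
  have le1 : (msize (Q ij k) <= \sum_k' msize (Q ij k'))%N.
    by rewrite (bigD1 k) //= leq_addr.
  have le2 : (\sum_k' msize (Q ij k') <= \sum_ij' \sum_k' msize (Q ij' k'))%N.
    by rewrite (bigD1 ij) //= leq_addr.
  by rewrite leqW // /E (leq_trans le1) // (leq_trans le2) // leq_addl.
pose B t (f : X -> K) := exists2 q : 'I_r -> {mpoly K[d]},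
  forall k, (msize (q k) <= (E * t.+1).+1)%N & forall x, f x = \sum_k (q k).@[theta^~ x] * h k x.
have B1 : B 0%N (fun=> 1) by exists c => // k; rewrite muln1.
have BM i t f : B t f -> B t.+1 (fun x => z i x * f x).
  move=> [q szq qf]; exists (fun k => \sum_j q j * Q (i, j) k) => [k|x].
    apply: leq_trans (msize_sum _ _ _) _; apply/bigmax_leqP => j _.
    case: (eqVneq (q j) 0) => [->|nzq]; first by rewrite mul0r msize0.
    case: (eqVneq (Q (i, j) k) 0) => [->|nzQ]; first by rewrite mulr0 msize0.
    rewrite msizeM //; have := szq j; have := QE (i, j) k.
    rewrite [(E * t.+2)%N]mulnS.
    by move: (mmeasure _ (Q _ _)) (mmeasure _ (q j)) (E * t.+1)%N (E) => a b e1 e; lia.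
  rewrite qf mulr_sumr.
  transitivity (\sum_j (q j).@[theta^~ x] * \sum_k (Q (i, j) k).@[theta^~ x] * h k x).
    by apply: eq_bigr => j _; rewrite -(QP (i, j)) /= mulrCA.
  transitivity (\sum_j \sum_k (q j).@[theta^~ x] * ((Q (i, j) k).@[theta^~ x] * h k x)).
    by apply: eq_bigr => j _; rewrite mulr_sumr.
  rewrite exchange_big; apply: eq_bigr => k _ /=.
  rewrite raddf_sum mulr_suml; apply: eq_bigr => j _.
  by rewrite /= mevalM mulrA.
have Bmon (al : 'X_{1..m}) : B (mdeg al) (fun x => \prod_i z i x ^+ al i).
  suff H (s : seq 'I_m) : B (\sum_(i <- s) al i)%N (fun x => \prod_(i <- s) z i x ^+ al i).
    by rewrite mdegE; apply: H.
  elim: s => [|i s IH].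
    by rewrite big_nil; case: B1 => q szq qf; exists q => // x; rewrite big_nil.
  rewrite big_cons.
  have : B (al i + \sum_(j <- s) al j)%N (fun x => z i x ^+ al i * \prod_(j <- s) z j x ^+ al j).
    elim: (al i) => [|e IHe].
      by case: IH => q szq qf; exists q => // x; rewrite mul1r.
    by have [q szq qf] := BM i _ _ IHe; exists q => // x; rewrite exprS -mulrA qf.
  by case=> q szq qf; exists q => // x; rewrite big_cons.
(* A monomial with exponents below N has degree at most m N, so its coefficients
   have size at most D = C N; the choice of N gives r D^d < N^m. *)
pose C := (E * m.+1 + 1)%N.
pose N := (r * C ^ d).+1.
pose D := (C * N)%N.
have Bbox (a : {ffun 'I_m -> 'I_N}) : exists q : 'I_r -> {mpoly K[d]},
    (forall k, (msize (q k) <= D)%N) /\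
    forall x, \prod_i z i x ^+ box_mnm a i = \sum_k (q k).@[theta^~ x] * h k x.
  have [q szq qf] := Bmon (box_mnm a); exists q; split=> // k.
  apply: leq_trans (szq k) _.
  have : (mdeg (box_mnm a) <= m * N)%N.
    rewrite mdegE -[X in (_ <= X * _)%N](card_ord m) -sum_nat_const.
    by apply: leq_sum => i _; rewrite mnmE ltnW.
  rewrite /D /C mulnDl mul1n -mulnA => lem.
  apply: (@leq_trans (E * (m * N).+1).+1); first by rewrite ltnS leq_mul2l ltnS lem orbT.
  have : ((m * N).+1 <= m.+1 * N)%N by rewrite mulSn -addn1 addnC leq_add2r.
  move=> le2; rewrite -addn1; apply: leq_add => //.
  by rewrite leq_mul2l le2 orbT.
have /choice [q qP] := Bbox.
pose I : finType := {ffun 'I_m -> 'I_N}.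
pose J : finType := ('I_r * {ffun 'I_d -> 'I_D})%type.
pose A : 'M[K]_(#|I|, #|J|) :=
  \matrix_(a, kb) (q (enum_val a) (enum_val kb).1)@_(box_mnm (enum_val kb).2).
have ltJI : (#|J| < #|I|)%N.
  rewrite /I /J card_prod !card_ffun !card_ord.
  apply: (@leq_trans (N ^ d.+1)); last by rewrite leq_pexp2l.
  rewrite expnS /D expnMn mulnA ltn_mul2r expn_gt0 /= /N ltnS.
  by rewrite leqnn.
have [v nzv vA] : exists2 v : 'rV[K]_#|I|, v != 0 & v *m A = 0.
  have nzk : kermx A != 0.
    rewrite -mxrank_eq0 mxrank_ker subn_eq0 -ltnNge.
    exact: leq_ltn_trans (rank_leq_col A) ltJI.
  exists (nz_row (kermx A)).
    by rewrite nz_row_eq0.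
  by apply/sub_kermxP/nz_row_sub.
exists (\sum_(a : I) v 0 (enum_rank a) *: 'X_[box_mnm a]).
  have [j nzj] : exists j, v 0 j != 0.
    apply: contrapT => none; case/eqP: nzv; apply/rowP => j; rewrite mxE.
    by apply/eqP; apply/negP => /negP nz; apply: none; exists j.
  apply: contraNneq nzj => /mpolyP/(_ (box_mnm (enum_val j))).
  rewrite raddf_sum mcoeff0 (bigD1 (enum_val j)) //= mcoeffZ mcoeffX eqxx mulr1 enum_valK.
  rewrite big1 ?addr0 => [->//|a na]; rewrite mcoeffZ mcoeffX.
  by case: eqP => [/box_mnm_inj /eqP|]; rewrite ?(negPf na) // mulr0.
move=> x; rewrite raddf_sum /=.
transitivity (\sum_(a : I) \sum_(kb : J) v 0 (enum_rank a) * (q a kb.1)@_(box_mnm kb.2)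
     * ((\prod_i theta i x ^+ box_mnm kb.2 i) * h kb.1 x)).
  apply: eq_bigr => a _; have [szq qf] := qP a.
  rewrite mevalZ mevalX qf mulr_sumr /J.
  rewrite -(pair_bigA _ (fun k b => v 0 (enum_rank a) * (q a k)@_(box_mnm b)
     * ((\prod_i theta i x ^+ box_mnm b i) * h k x))) /=.
  apply: eq_bigr => k _; rewrite {1}(box_expand (szq k)) raddf_sum /= mulr_suml mulr_sumr.
  by apply: eq_bigr => b _; rewrite mevalZ mevalX -!mulrA.
rewrite exchange_big big1 //= => kb _; rewrite -mulr_suml.
suff -> : \sum_(a : I) v 0 (enum_rank a) * (q a kb.1)@_(box_mnm kb.2) = 0 by rewrite mul0r.
have /rowP/(_ (enum_rank kb)) := vA; rewrite !mxE => vA0.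
rewrite -[RHS]vA0 [RHS](reindex (@enum_rank I)); last by apply: onW_bij; apply: enum_rank_bij.
by apply: eq_bigr => a _; rewrite mxE !enum_rankK.
Qed.
End Counting.

(** * Polynomial functions on a vector space *)

Section PolyFun.
Variables (K : fieldType) (W : vectType K).
Implicit Types (F G : W -> K).
Local Notation cv v := (fun i => coord (vbasis {:W}) i v).

Lemma polyfun_ext F G : F =1 G -> polyfun F -> polyfun G.
Proof. by move=> e [Q QF]; exists Q => v; rewrite -e QF. Qed.

Lemma homogfun_ext d F G : F =1 G -> homogfun d F -> homogfun d G.
Proof. by move=> e [Q Qd QF]; exists Q => // v; rewrite -e QF. Qed.

Lemma homogfun_polyfun d F : homogfun d F -> polyfun F.
Proof. by case=> Q _ QF; exists Q. Qed.

Lemma polyfunC c : polyfun (fun _ : W => c).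
Proof. by exists c%:MP => v; rewrite mevalC. Qed.

Lemma polyfunD F G : polyfun F -> polyfun G -> polyfun (fun v => F v + G v).
Proof. by move=> [P PF] [Q QG]; exists (P + Q) => v; rewrite mevalD PF QG. Qed.

Lemma polyfunM F G : polyfun F -> polyfun G -> polyfun (fun v => F v * G v).
Proof. by move=> [P PF] [Q QG]; exists (P * Q) => v; rewrite mevalM PF QG. Qed.

Lemma polyfun_sum (I : Type) (r : seq I) (P : pred I) (F : I -> W -> K) :
  (forall i, polyfun (F i)) -> polyfun (fun v => \sum_(i <- r | P i) F i v).
Proof.
move=> pF; elim: r => [|i r IH].
  by apply: polyfun_ext (polyfunC 0) => v; rewrite big_nil.
case Pi: (P i); last by apply: polyfun_ext IH => v; rewrite big_cons Pi.
by apply: polyfun_ext (polyfunD (pF i) IH) => v; rewrite big_cons Pi.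
Qed.

Lemma polyfun_prod (I : Type) (r : seq I) (F : I -> W -> K) :
  (forall i, polyfun (F i)) -> polyfun (fun v => \prod_(i <- r) F i v).
Proof.
move=> pF; elim: r => [|i r IH].
  by apply: polyfun_ext (polyfunC 1) => v; rewrite big_nil.
by apply: polyfun_ext (polyfunM (pF i) IH) => v; rewrite big_cons.
Qed.

Lemma polyfunX F n : polyfun F -> polyfun (fun v => F v ^+ n).
Proof.
move=> pF; elim: n => [|n IH]; first by apply: polyfun_ext (polyfunC 1) => v.
by apply: polyfun_ext (polyfunM pF IH) => v; rewrite exprS.
Qed.

Lemma homogfun0 d : homogfun d (fun _ : W => 0).
Proof. by exists 0; [exact: dhomog0 | move=> v; rewrite meval0]. Qed.

Lemma homogfunC c : homogfun 0 (fun _ : W => c).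
Proof.
exists c%:MP; last by move=> v; rewrite mevalC.
by rewrite -[c%:MP]mulr1 mul_mpolyC; apply: dhomogZ; apply: dhomog1.
Qed.

Lemma homogfunD d F G : homogfun d F -> homogfun d G -> homogfun d (fun v => F v + G v).
Proof.
move=> [P hP PF] [Q hQ QG]; exists (P + Q); first exact: dhomogD.
by move=> v; rewrite mevalD PF QG.
Qed.

Lemma homogfunM d e F G :
  homogfun d F -> homogfun e G -> homogfun (d + e) (fun v => F v * G v).
Proof.
move=> [P hP PF] [Q hQ QG]; exists (P * Q); first exact: dhomogM.
by move=> v; rewrite mevalM PF QG.
Qed.

Lemma homogfunZ d c F : homogfun d F -> homogfun d (fun v => c * F v).
Proof. exact: (homogfunM (homogfunC c)). Qed.

Lemma homogfun_sum d (I : Type) (r : seq I) (P : pred I) (F : I -> W -> K) :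
  (forall i, homogfun d (F i)) -> homogfun d (fun v => \sum_(i <- r | P i) F i v).
Proof.
move=> pF; elim: r => [|i r IH].
  by apply: homogfun_ext (homogfun0 d) => v; rewrite big_nil.
case Pi: (P i); last by apply: homogfun_ext IH => v; rewrite big_cons Pi.
by apply: homogfun_ext (homogfunD (pF i) IH) => v; rewrite big_cons Pi.
Qed.

Lemma homogfun_linear (f : W -> K) :
  (forall a u v, f (a *: u + v) = a * f u + f v) -> homogfun 1 f.
Proof.
move=> flin; have f0 : f 0 = 0.
  by have := flin (-1) 0 0; rewrite scaler0 addr0 mulN1r addNr.
have fsum (r : seq 'I_(\dim {:W})) a : f (\sum_(i <- r) a i *: (vbasis {:W})`_i) =
    \sum_(i <- r) a i * f (vbasis {:W})`_i.
  by elim: r => [|i r IH]; rewrite ?big_nil ?f0 // !big_cons flin IH.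
exists (\sum_(i < \dim {:W}) f (vbasis {:W})`_i *: 'X_i).
  by apply: rpred_sum => i _; apply: dhomogZ; rewrite dhomogX; apply/eqP; exact: mdeg1.
move=> v; rewrite {1}(coord_vbasis (memvf v)) fsum raddf_sum /=.
by apply: eq_bigr => i _; rewrite mevalZ mevalXU mulrC.
Qed.

Lemma homogfun_scale d F c v : homogfun d F -> F (c *: v) = c ^+ d * F v.
Proof.
move=> [Q hQ QF]; rewrite !QF -(dhomog_eval_scale _ _ hQ).
by apply: meval_eq => i; rewrite linearZ.
Qed.

Definition pt_of (a : 'I_(\dim {:W}) -> K) : W := \sum_i a i *: (vbasis {:W})`_i.

Lemma coord_pt_of a : (cv (pt_of a)) =1 a.
Proof. by move=> i; rewrite coord_sum_free // (basis_free (vbasisP _)). Qed.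

Lemma polyfun_decomp F : polyfun F -> exists D (H : nat -> W -> K),
  [/\ forall k, homogfun k (H k), forall k v, (D <= k)%N -> H k v = 0
    & forall v, F v = \sum_(k < D) H k v].
Proof.
move=> [Q QF]; exists (msize Q), (fun k v => (pihomog mdeg k Q).@[cv v]); split.
- by move=> k; exists (pihomog mdeg k Q); first exact: pihomogP.
- move=> k v lek; rewrite pihomogE big1_seq ?meval0 // => m /andP [/eqP mk mQ].
  by have := msize_mdeg_lt mQ; rewrite mk ltnNge lek.
by move=> v; rewrite QF {1}(pihomog_partitionE (leqnn (msize Q))) raddf_sum.
Qed.
End PolyFun.

Lemma polyfun_comp (K : fieldType) (W W' : vectType K) (phi : W' -> W) (F : W -> K) :
  (forall i, polyfun (fun x => coord (vbasis {:W}) i (phi x))) -> polyfun F ->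
  polyfun (fun x => F (phi x)).
Proof.
move=> pphi [Q QF].
apply: (@polyfun_ext _ _ (fun x => \sum_(m <- msupp Q)
   Q@_m * \prod_i coord (vbasis {:W}) i (phi x) ^+ m i)).
  by move=> x; rewrite QF mevalE.
apply: polyfun_sum => m; apply: polyfunM; first exact: polyfunC.
by apply: polyfun_prod => i; apply: polyfunX.
Qed.

Section NumPolyFun.
Variables (K : numFieldType) (W : vectType K).
Implicit Types (F G : W -> K).

Lemma polyfun_idom F G : polyfun F -> polyfun G -> (exists v, G v != 0) ->
  (forall v, F v * G v = 0) -> forall v, F v = 0.
Proof.
move=> [P PF] [Q QG] [w nz] FG.
have PQ : P * Q = 0.
  apply: mpoly_eq0_eval => a; rewrite -(meval_eq _ (coord_pt_of a)) mevalM.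
  by rewrite -PF -QG FG.
have /eqP := PQ; rewrite mulf_eq0 => /orP [/eqP P0 v|/eqP Q0].
  by rewrite PF P0 meval0.
by case/eqP: nz; rewrite QG Q0 meval0.
Qed.
End NumPolyFun.

(** * The apolar pairing *)

Lemma mpoly_ind_var (R : comRingType) n (T : {mpoly R[n]} -> Prop) :
  (forall c, T c%:MP) -> (forall p q, T p -> T q -> T (p + q)) ->
  (forall i p, T p -> T ('X_i * p)) -> forall p, T p.
Proof.
move=> TC TD TX; elim/mpolyind => [|c m p _ _ Tp]; first by rewrite -mpolyC0.
apply: TD => //.
have [k] : exists k, mdeg m = k by exists (mdeg m).
elim: k m => [|k IH] m mk.
  by move/eqP: mk; rewrite mdeg_eq0 => /eqP ->; rewrite mpolyX0 alg_mpolyC.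
have [i mi] : exists i, (0 < m i)%N.
  apply: contrapT => none; move: mk; rewrite mdegE big1 // => i _.
  by apply/eqP; rewrite -leqn0 leqNgt; apply/negP => lt; apply: none; exists i.
have lem : (U_(i) <= m)%MM by rewrite lep1mP -lt0n.
have -> : c *: 'X_[m] = 'X_i * (c *: 'X_[m - U_(i)]) :> {mpoly R[n]}.
  by rewrite -scalerAr -mpolyXD addmC submK.
apply/TX/IH; have := congr1 mdeg (submK lem); rewrite mdegD mdeg1 mk; lia.
Qed.

Section Apolar.
Variables (K : numDomainType) (n : nat).
Implicit Types (P Q : {mpoly K[n]}) (m : 'X_{1..n}).

Definition mfact m : nat := \prod_i (m i)`!.

(** Monomials are orthogonal and X^m has square m!, the product of the
    factorials of the exponents. Multiplication by a variable is then adjoint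
    to the derivative ([apol_mulX]). *)
Definition apol P Q : K := \sum_(m <- msupp P) (mfact m)%:R * (P@_m * Q@_m).

Lemma apolC P Q : apol P Q = apol Q P.
Proof.
suff H P1 Q1 : apol P1 Q1 =
    \sum_(m <- [seq m <- msupp P1 | m \in msupp Q1]) (mfact m)%:R * (P1@_m * Q1@_m).
  rewrite H (H Q); set s := filter _ _; set t := filter _ _.
  have pst : perm_eq s t.
    apply: uniq_perm; rewrite ?filter_uniq ?msupp_uniq // => m.
    by rewrite !mem_filter andbC.
  by rewrite (perm_big _ pst); apply: eq_bigr => m _; rewrite [P@_m * _]mulrC.
rewrite /apol (bigID (fun m => m \in msupp Q1)) /= [X in _ + X]big1 ?addr0 ?big_filter //.
by move=> m /memN_msupp_eq0 ->; rewrite !mulr0.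
Qed.

Lemma apolDr P Q Q' : apol P (Q + Q') = apol P Q + apol P Q'.
Proof.
by rewrite /apol -big_split; apply: eq_bigr => m _; rewrite mcoeffD !mulrDr.
Qed.

Lemma apolZr P c Q : apol P (c *: Q) = c * apol P Q.
Proof.
rewrite /apol mulr_sumr; apply: eq_bigr => m _.
by rewrite mcoeffZ; ring.
Qed.

Lemma apolDl P P' Q : apol (P + P') Q = apol P Q + apol P' Q.
Proof. by rewrite ![apol _ Q]apolC apolDr. Qed.

Lemma apolZl c P Q : apol (c *: P) Q = c * apol P Q.
Proof. by rewrite ![apol _ Q]apolC apolZr. Qed.

Lemma apol0r P : apol P 0 = 0.
Proof. by rewrite -(scale0r 0) apolZr mul0r. Qed.

Lemma apol_sumr P (I : Type) (r : seq I) (F : I -> {mpoly K[n]}) :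
  apol P (\sum_(i <- r) F i) = \sum_(i <- r) apol P (F i).
Proof.
by elim: r => [|i r IH]; rewrite ?big_nil ?apol0r // !big_cons apolDr IH.
Qed.

Lemma apol_suml Q (I : Type) (r : seq I) (F : I -> {mpoly K[n]}) :
  apol (\sum_(i <- r) F i) Q = \sum_(i <- r) apol (F i) Q.
Proof. by rewrite apolC apol_sumr; apply: eq_bigr => i _; rewrite apolC. Qed.

Lemma apol_mX m Q : apol 'X_[m] Q = (mfact m)%:R * Q@_m.
Proof. by rewrite /apol msuppX big_seq1 mcoeffX eqxx mul1r. Qed.

Lemma mfactD1 i m : mfact (m + U_(i))%MM = (mfact m * (m i).+1)%N.
Proof.
rewrite /mfact (bigD1 i) //= [in RHS](bigD1 i) //= mnmDE mnm1E eqxx addn1 factS.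
rewrite [RHS]mulnC mulnA; congr (_ * _)%N; apply: eq_bigr => j nj.
by rewrite mnmDE mnm1E eq_sym (negPf nj) addn0.
Qed.

Lemma apol_mulX i P Q : apol ('X_i * P) Q = apol P Q^`M(i).
Proof.
elim/mpolyind: P => [|c m P _ _ IH].
  by rewrite mulr0 -(scale0r 0) !apolZl !mul0r.
rewrite mulrDr !apolDl {}IH; congr (_ + _).
rewrite -scalerAr !apolZl -mpolyXD addmC !apol_mX mcoeff_mderiv mfactD1.
by rewrite natrM -mulr_natr; ring.
Qed.

(** The polynomial v |-> P (M v). *)
Definition lsub (M : 'M[K]_n) P : {mpoly K[n]} :=
  P \mPo [tuple \sum_j M i j *: 'X_j | i < n].

Lemma lsubC M c : lsub M c%:MP = c%:MP.
Proof. exact: comp_mpolyC. Qed.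

Lemma lsubD M P Q : lsub M (P + Q) = lsub M P + lsub M Q.
Proof. exact: raddfD. Qed.

Lemma lsubM M P Q : lsub M (P * Q) = lsub M P * lsub M Q.
Proof. exact: rmorphM. Qed.

Lemma lsubX M i : lsub M 'X_i = \sum_j M i j *: 'X_j.
Proof.
by rewrite /lsub comp_mpolyXU -tnth_nth tnth_mktuple.
Qed.

Lemma lsub_eval M P v : (lsub M P).@[v] = P.@[fun i => \sum_j M i j * v j].
Proof.
rewrite /lsub comp_mpoly_meval; apply: meval_eq => i.
rewrite tnth_mktuple raddf_sum; apply: eq_bigr => j _.
by rewrite /= mevalZ mevalXU.
Qed.

Lemma mcoeff_zero_eval P : P@_0%MM = P.@[fun _ => 0].
Proof.
elim/mpoly_ind_var: P => [c|p q IHp IHq|i p _].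
- by rewrite mcoeffC eqxx mulr1 mevalC.
- by rewrite mcoeffD mevalD IHp IHq.
rewrite mevalM mevalXU mul0r mulrC.
apply: memN_msupp_eq0; rewrite (perm_mem (msuppMX _ _)).
apply/mapP => -[m _ /eqP]; rewrite eq_sym => /eqP/(congr1 (@mdeg n)).
by rewrite mdegD mdeg1 mdeg0.
Qed.

Lemma lsub_coeff0 M P : (lsub M P)@_0%MM = P@_0%MM.
Proof.
rewrite !mcoeff_zero_eval lsub_eval; apply: meval_eq => i.
by rewrite big1 // => j _; rewrite mulr0.
Qed.

Lemma mderiv_lsub M i P :
  (lsub M P)^`M(i) = \sum_j M j i *: lsub M P^`M(j).
Proof.
elim/mpoly_ind_var: P => [c|p q IHp IHq|k p IH].
- rewrite lsubC mderivC big1 // => j _.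
  by rewrite mderivC -mpolyC0 lsubC mpolyC0 scaler0.
- rewrite lsubD mderivD IHp IHq -big_split; apply: eq_bigr => j _.
  by rewrite mderivD lsubD scalerDr.
rewrite lsubM mderivM IH.
have -> : (lsub M 'X_k)^`M(i) = (M k i)%:MP.
  rewrite lsubX raddf_sum (bigD1 i) //= mderivZ mderivX mnm1E eqxx scale1r.
  rewrite (_ : (U_(i) - U_(i))%MM = 0%MM); last by apply/mnmP => j; rewrite mnmBE subnn mnm0E.
  rewrite mpolyX0 alg_mpolyC big1 ?addr0 // => j nj.
  by rewrite mderivZ mderivX mnm1E (negPf nj) scale0r scaler0.
have XkE j : ('X_k : {mpoly K[n]})^`M(j) = (k == j)%:R.
  rewrite mderivX mnm1E; case: eqP => [->|_]; last by rewrite scale0r.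
  rewrite (_ : (U_(j) - U_(j))%MM = 0%MM); last by apply/mnmP => l; rewrite mnmBE subnn mnm0E.
  by rewrite mpolyX0 scale1r.
rewrite [RHS](eq_bigr (fun j => M j i *: ((k == j)%:R * lsub M p) +
   lsub M 'X_k * (M j i *: lsub M p^`M(j)))); last first.
  move=> j _; rewrite mderivM XkE lsubD !lsubM scalerDr -scalerAr; congr (_ *: (_ * _) + _).
  by case: eqP => _; rewrite -?[1]/(1%:MP) -?[0]/(0%:MP) ?mpolyC_nat; rewrite -mpolyC_nat lsubC.
rewrite big_split /= -mulr_sumr; congr (_ + _).
rewrite (bigD1 k) //= eqxx mul1r big1 ?addr0 ?mul_mpolyC // => j nj.
by rewrite eq_sym (negPf nj) mul0r scaler0.
Qed.

(** Induction on P: multiplication by a variable on the left becomes a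
    derivative on the right, to which the chain rule [mderiv_lsub] applies. *)
Lemma apol_adjoint M P Q : apol P (lsub M Q) = apol (lsub M^T P) Q.
Proof.
elim/mpoly_ind_var: P Q => [c|p q IHp IHq|i p IH] Q.
- rewrite lsubC -alg_mpolyC !apolZl -mpolyX0 !apol_mX; congr (_ * (_ * _)).
  exact: lsub_coeff0.
- by rewrite lsubD !apolDl IHp IHq.
rewrite apol_mulX mderiv_lsub apol_sumr lsubM lsubX mulr_suml apol_suml.
apply: eq_bigr => j _; rewrite mxE -scalerAl apolZl apolZr IH apol_mulX.
by [].
Qed.

(** A sum of squares of integers with positive weights. *)
Lemma apol_int_gt0 (P0 : {mpoly int[n]}) (P := map_mpoly intr P0 : {mpoly K[n]}) :
  P != 0 -> 0 < apol P P.
Proof.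
move=> nz; rewrite /apol.
have sqE m : P@_m * P@_m = (P0@_m ^+ 2)%:~R by rewrite /P mcoeff_map_mpoly -intrM -expr2.
have mfact_gt0 m : (0 < mfact m)%N by apply: prodn_gt0 => i; apply: fact_gt0.
rewrite (bigD1_seq (mlead P)) ?msupp_uniq ?mlead_supp //= ltr_wpDr //.
  by apply: sumr_ge0 => m _; rewrite sqE mulr_ge0 ?ler0n // ler0z sqr_ge0.
rewrite mulr_gt0 ?ltr0n // sqE ltr0z exprn_even_gt0 //=.
have : P@_(mlead P) != 0 by rewrite mleadc_eq0.
by rewrite {1}/P mcoeff_map_mpoly intr_eq0.
Qed.
End Apolar.

(** * The Reynolds operator of SL(3) *)

Section Action.
Variables (K : fieldType) (p : nat).
Implicit Types (x y : pV K p) (g k : 'M[K]_3).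

Lemma pV_actE g x i : vsval (pV_act g x i) = g *m vsval (x i) *m g^T.
Proof. by rewrite ffunE sym_actE. Qed.

Lemma pV_ext x y : (forall i, vsval (x i) = vsval (y i)) -> x = y.
Proof. by move=> e; apply/ffunP => i; apply: val_inj; apply: e. Qed.

Lemma pV_scaleE (c : K) x i : vsval ((c *: x) i) = c *: vsval (x i).
Proof. by rewrite ffunE. Qed.

Lemma pV_addE x y i : vsval ((x + y) i) = vsval (x i) + vsval (y i).
Proof. by rewrite ffunE. Qed.

Lemma pV_actM g k x : pV_act (g *m k) x = pV_act g (pV_act k x).
Proof. by apply: pV_ext => i; rewrite !pV_actE trmx_mul !mulmxA. Qed.

Lemma pV_act1 x : pV_act 1%:M x = x.
Proof. by apply: pV_ext => i; rewrite pV_actE trmx1 mulmx1 mul1mx. Qed.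

Lemma pV_actZ (c : K) g x : pV_act (c *: g) x = c ^+ 2 *: pV_act g x.
Proof.
apply: pV_ext => i; rewrite pV_actE pV_scaleE pV_actE linearZ /= -!scalemxAl -scalemxAr.
by rewrite scalerA -expr2.
Qed.

Lemma pV_act_scale (c : K) g x : pV_act g (c *: x) = c *: pV_act g x.
Proof.
apply: pV_ext => i; rewrite pV_scaleE !pV_actE pV_scaleE.
by rewrite -scalemxAr -scalemxAl.
Qed.

Definition entry (j : 'I_p) (a b : 'I_3) x : K := vsval (x j) a b.

Lemma entry_linear j a b (c : K) x y : entry j a b (c *: x + y) = c * entry j a b x + entry j a b y.
Proof. by rewrite /entry pV_addE pV_scaleE !mxE. Qed.

Lemma homogfun_entry j a b : homogfun 1 (entry j a b).
Proof. by apply: homogfun_linear => c x y; apply: entry_linear. Qed.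

Lemma polyfun_entry j a b : polyfun (entry j a b).
Proof. exact: homogfun_polyfun (homogfun_entry j a b). Qed.

Lemma entry_sym j a b x : entry j a b x = entry j b a x.
Proof. by rewrite /entry -{1}(symspaceP _ (subvsP (x j))) mxE. Qed.

(** For r <> s the matrix [delta_mx r s] is not symmetric and vsproj maps it
    to an unspecified symmetric matrix; the decomposition [pV_decomp] only
    needs that vsproj is linear and fixes the symmetric matrices. *)
Definition unit_entry (j : 'I_p) (r s : 'I_3) : pV K p :=
  [ffun k => if k == j then vsproj (symspace K) (delta_mx r s) else 0].

Lemma pV_decomp x : x = \sum_j \sum_r \sum_s entry j r s x *: unit_entry j r s.
Proof.
apply/ffunP => k; rewrite sum_ffunE (bigD1 k) //= [X in _ + X]big1 ?addr0; last first.
  move=> j nj; rewrite sum_ffunE big1 // => r _; rewrite sum_ffunE big1 // => s _.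
  by rewrite !ffunE eq_sym (negPf nj) scaler0.
rewrite -[LHS]vsvalK {1}[vsval (x k)]matrix_sum_delta linear_sum sum_ffunE.
apply: eq_bigr => r _; rewrite linear_sum sum_ffunE; apply: eq_bigr => s _.
by rewrite linearZ !ffunE eqxx.
Qed.
End Action.

Section Reynolds.
Variables (C : numClosedFieldType) (p : nat).
Local Notation W := (pV C p).
Local Notation n := (\dim {:W}).
Local Notation S9 := {mpoly C[3 * 3]}.
Implicit Types (x y : W) (g k : 'M[C]_3).

(** The point at which the generic matrix [gX] specializes to g. *)
Definition mpt g : 'I_(3 * 3) -> C := fun i => mxvec g 0 i.

Lemma mpt_surj (v : 'I_(3 * 3) -> C) : exists g, v =1 mpt g.
Proof. by exists (vec_mx (\row_i v i)) => i; rewrite /mpt vec_mxK mxE. Qed.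

Lemma S9_ext (P Q : S9) : (forall g, P.@[mpt g] = Q.@[mpt g]) -> P = Q.
Proof.
move=> e; apply/eqP; rewrite -subr_eq0; apply/eqP; apply: mpoly_eq0_eval => v.
by have [g vg] := mpt_surj v; rewrite (meval_eq _ vg) mevalB e subrr.
Qed.

Definition gX : 'M[S9]_3 := \matrix_(r, a) 'X_(mxvec_index r a).

Lemma gX_eval g : map_mx (meval (mpt g)) gX = g.
Proof. by apply/matrixP => r a; rewrite !mxE mevalXU /mpt mxvecE. Qed.

Definition detX : S9 := \det gX.

Lemma detX_eval g : detX.@[mpt g] = \det g.
Proof. by rewrite /detX -det_map_mx gX_eval. Qed.

(** The coordinates of g x, as polynomials in the entries of a generic g. *)
Definition cact x (i : 'I_n) : S9 :=
  \sum_j \sum_r \sum_s (gX *m map_mx (@mpolyC (3 * 3) C) (vsval (x j)) *m gX^T) r s *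
     (coord (vbasis {:W}) i (unit_entry C j r s))%:MP.

Lemma cact_eval x g i : (cact x i).@[mpt g] = coord (vbasis {:W}) i (pV_act g x).
Proof.
rewrite [pV_act g x]pV_decomp linear_sum raddf_sum; apply: eq_bigr => j _ /=.
rewrite linear_sum raddf_sum; apply: eq_bigr => r _ /=.
rewrite linear_sum raddf_sum; apply: eq_bigr => s _ /=.
rewrite linearZ mevalM mevalC /=; congr (_ * _).
rewrite /entry pV_actE.
have <- : map_mx (meval (mpt g)) (gX *m map_mx (@mpolyC (3 * 3) C) (vsval (x j)) *m gX^T)
    = g *m vsval (x j) *m g^T.
  rewrite !map_mxM -map_trmx gX_eval -map_mx_comp; congr (_ *m _ *m _).
  by apply/matrixP => a b; rewrite !mxE /= mevalC.
by rewrite [RHS]mxE.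
Qed.

(** The polynomial g |-> Q (g x) in the entries of g. *)
Definition pact (Q : {mpoly C[n]}) x : S9 := Q \mPo [tuple cact x i | i < n].

Lemma pact_evalE Q x g :
  (pact Q x).@[mpt g] = Q.@[fun i => coord (vbasis {:W}) i (pV_act g x)].
Proof.
rewrite /pact comp_mpoly_meval; apply: meval_eq => i.
by rewrite tnth_mktuple cact_eval.
Qed.

Lemma pact_eval F Q x g : polyfun_of Q F -> (pact Q x).@[mpt g] = F (pV_act g x).
Proof. by move=> QF; rewrite QF pact_evalE. Qed.

Definition polymap (P : W -> S9) := forall m, polyfun (fun x => (P x)@_m).

Lemma polymapC P0 : polymap (fun=> P0).
Proof. by move=> m; apply: polyfunC. Qed.

Lemma polymapD P Q : polymap P -> polymap Q -> polymap (fun x => P x + Q x).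
Proof.
by move=> hP hQ m; apply: polyfun_ext (polyfunD (hP m) (hQ m)) => x; rewrite mcoeffD.
Qed.

Lemma polymapM P Q : polymap P -> polymap Q -> polymap (fun x => P x * Q x).
Proof.
move=> hP hQ m; apply: polyfun_ext; first by move=> x; rewrite mcoeffM.
by apply: polyfun_sum => k; apply: polyfunM; [apply: hP | apply: hQ].
Qed.

Lemma polymap_sum (I : Type) (r : seq I) (P : I -> W -> S9) :
  (forall i, polymap (P i)) -> polymap (fun x => \sum_(i <- r) P i x).
Proof.
move=> hP m; apply: polyfun_ext (polyfun_sum r xpredT (fun i => hP i m)) => x.
by rewrite raddf_sum.
Qed.

Lemma polymap_pact Q : polymap (pact Q).
Proof.
elim/mpoly_ind_var: Q => [c|P Q IHP IHQ|i Q IHQ].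
- move=> m; apply: polyfun_ext (polymapC c%:MP m) => x.
  by rewrite /pact comp_mpolyC.
- by move=> m; apply: polyfun_ext (polymapD IHP IHQ m) => x; rewrite /pact comp_mpolyD.
move=> m; apply: (@polyfun_ext _ _ (fun x => (cact x i * pact Q x)@_m)).
  by move=> x; rewrite /pact rmorphM /= comp_mpolyXU -tnth_nth tnth_mktuple.
apply: polymapM IHQ m; rewrite /cact.
apply: polymap_sum => j; apply: polymap_sum => r; apply: polymap_sum => s.
apply: polymapM; last exact: polymapC.
move=> m; apply: (@polyfun_ext _ _ (fun x => (\sum_b (\sum_a gX r a * (entry j a b x)%:MP) * gX^T b s)@_m)).
  move=> x; congr (_@_m); rewrite [RHS]mxE; apply: eq_bigr => b _; congr (_ * _).
  by rewrite [RHS]mxE; apply: eq_bigr => a _; congr (_ * _); rewrite [RHS]mxE.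
move: m; apply: polymap_sum => b; apply: polymapM; last exact: polymapC.
apply: polymap_sum => a; apply: polymapM; first exact: polymapC.
move=> m; apply: polyfun_ext; first by move=> x; rewrite mcoeffC.
by apply: polyfunM; [apply: polyfun_entry | apply: polyfunC].
Qed.

Lemma polyfun_apol P0 (Q : W -> S9) : polymap Q -> polyfun (fun x => apol P0 (Q x)).
Proof.
move=> hQ; apply: polyfun_sum => m; apply: polyfunM; first exact: polyfunC.
by apply: polyfunM; [apply: polyfunC | apply: hQ].
Qed.

(** The matrix of g |-> g k acting on the entries of g. *)
Definition rmulM k : 'M[C]_(3 * 3) := (lin_mulmxr k)^T.

Lemma rmulM_pt k g i : \sum_j rmulM k i j * mpt g j = mpt (g *m k) i.
Proof.
rewrite /mpt -[g *m k]/(mulmxr k g) -mul_vec_lin mxE.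
by apply: eq_bigr => j _; rewrite mxE mulrC.
Qed.

Lemma rmulM_tr k : (rmulM k)^T = rmulM k^T.
Proof.
have E k' r a s c : lin_mulmxr k' (mxvec_index r a) (mxvec_index s c) = (r == s)%:R * k' a c.
  have : row (mxvec_index r a) (lin_mulmxr k') = mxvec (delta_mx r a *m k').
    by rewrite rowE -mxvec_delta mul_vec_lin.
  move=> /rowP/(_ (mxvec_index s c)); rewrite mxE => ->; rewrite mxvecE mxE.
  rewrite (bigD1 a) //= big1 ?addr0 ?mxE; first by rewrite eqxx andbT eq_sym.
  by move=> b nb; rewrite mxE (negPf nb) andbF mul0r.
apply/matrixP => i j; case/mxvec_indexP: i => r a; case/mxvec_indexP: j => s c.
by rewrite /rmulM trmxK [RHS]mxE !E mxE eq_sym.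
Qed.

Lemma lsub_rmul k P g : (lsub (rmulM k) P).@[mpt g] = P.@[mpt (g *m k)].
Proof. by rewrite lsub_eval; apply: meval_eq => i; rewrite rmulM_pt. Qed.

(** The pairing of det(g)^r with det(g)^s Q(g x), as polynomials in g. *)
Definition reynolds r s Q x : C := apol (detX ^+ r) (detX ^+ s * pact Q x).

(** Replacing x by k x amounts to the substitution of g k for g. Its adjoint
    is the substitution of g k^T, which fixes the powers of det(g) when det k
    = 1. *)
Lemma reynolds_invariant r s Q : invariant_algebra (reynolds r s Q).
Proof.
split; first by apply: polyfun_apol; apply: polymapM; [apply: polymapC | apply: polymap_pact].
move=> k dk x; rewrite /reynolds.
have E : detX ^+ s * pact Q (pV_act k x) = lsub (rmulM k) (detX ^+ s * pact Q x).
  apply: S9_ext => g; rewrite lsub_rmul !mevalM !(rmorphXn (meval _)) /= !detX_eval.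
  by rewrite !pact_evalE det_mulmx dk mulr1 pV_actM.
apply: etrans (congr1 (apol _) E) _.
rewrite apol_adjoint rmulM_tr; congr (apol _ _).
apply: S9_ext => g; rewrite lsub_rmul !rmorphXn /= !detX_eval.
by rewrite det_mulmx det_tr dk mulr1.
Qed.

Lemma detX_neq0 r : detX ^+ r != 0.
Proof.
apply/eqP => /(congr1 (meval (mpt 1%:M))); rewrite rmorphXn /= detX_eval det1 expr1n meval0.
by apply/eqP; apply: oner_neq0.
Qed.

Lemma apol_detX_gt0 r : 0 < apol (detX ^+ r) (detX ^+ r).
Proof.
pose D0 : {mpoly int[3 * 3]} := \det (\matrix_(r, a) 'X_(mxvec_index r a)).
have DE : detX ^+ r = map_mpoly intr (D0 ^+ r).
  rewrite rmorphXn /D0 /= -det_map_mx; congr (\det _ ^+ r).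
  by apply/matrixP => i j; rewrite !mxE /= map_mpolyX.
by rewrite DE; apply: apol_int_gt0; rewrite -DE detX_neq0.
Qed.

Lemma cube_root_of_unity : exists w : C, [/\ w ^+ 3 = 1, w != 1 & w ^+ 2 != 1].
Proof.
have /closed_rootP [w] : size ('X^2 + 'X + 1 : {poly C}) != 1.
  by rewrite -addrA size_addl size_polyXn // size_addl ?size_polyX ?size_poly1.
rewrite /root !hornerE => /eqP w0.
have w3 : w ^+ 3 = 1.
  have : (w - 1) * (w * w + w + 1) = 0 by rewrite -expr2 w0 mulr0.
  move=> e; apply/eqP; rewrite -subr_eq0 -e; apply/eqP; ring.
have w1 : w != 1.
  apply/eqP => we; move: w0; rewrite we expr1n => /eqP.
  by rewrite -addrA -[1 + (1 + 1)]/(3%:R) pnatr_eq0.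
exists w; split=> //; apply: contra w1 => /eqP w2.
by rewrite -w3 exprS w2 mulr1.
Qed.

(** On invertible g, write g = s g' with s^3 = det g and g' in SL(3): then F(g
    x) = s^(2d) F(x). If F is nonzero, the scalar matrix of a primitive cube
    root of unity forces d = 3e, so that s^(2d) = det(g)^(2e); the identity of
    polynomials extends to all g. *)
Lemma homog_invariant_covariant d F Q : SL3_invariant F -> homogfun d F -> polyfun_of Q F ->
  exists e, (forall x, F x != 0 -> d = (3 * e)%N) /\ forall x, pact Q x = F x *: detX ^+ (2 * e).
Proof.
move=> Finv Fd QF.
have cov e : (forall x, F x != 0 -> d = (3 * e)%N) -> forall x, pact Q x = F x *: detX ^+ (2 * e).
  move=> de x; apply/eqP; rewrite -subr_eq0.
  have: (pact Q x - F x *: detX ^+ (2 * e)) * detX == 0.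
    apply/eqP; apply: S9_ext => g; rewrite mevalM mevalB mevalZ rmorphXn /= detX_eval meval0.
    rewrite (pact_eval _ _ QF); case: (eqVneq (\det g) 0) => [->|nzg]; first by rewrite mulr0.
    pose s := 3.-root (\det g); have s3 : s ^+ 3 = \det g by rewrite rootCK.
    have nzs : s != 0 by apply: contraNneq nzg => s0; rewrite -s3 s0 expr0n.
    have -> : g = s *: (s^-1 *: g) by rewrite scalerA mulfV // scale1r.
    rewrite pV_actZ (homogfun_scale _ _ Fd) Finv; last first.
      by rewrite detZ exprVn s3 mulVf.
    rewrite scalerA mulfV // scale1r -s3.
    case: (eqVneq (F x) 0) => [->|nzF]; first by rewrite !(mulr0, mul0r) subrr mul0r.
    rewrite (de x nzF) -!exprM; rewrite (_ : (2 * (3 * e) = 3 * (2 * e))%N); last by ring.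
    by rewrite [_ * F x]mulrC subrr mul0r.
  rewrite mulf_eq0 => /orP [//|]; by have := detX_neq0 1; rewrite expr1 => /negPf ->.
have [[x nzF]|F0] := EM (exists x, F x != 0); last first.
  have F0' x : F x = 0 by apply/eqP; apply/negP => /negP nz; apply: F0; exists x.
  have H : forall x, F x != 0 -> d = (3 * 0)%N by move=> x; rewrite F0' eqxx.
  by exists 0%N; split=> //; apply: cov.
have d3 : d = (3 * (d %/ 3))%N.
  have [w [w3 w1 w2]] := cube_root_of_unity.
  have dw : \det (w%:M : 'M[C]_3) = 1 by rewrite det_scalar w3.
  have := Finv _ dw x; rewrite -scalemx1 pV_actZ pV_act1 (homogfun_scale _ _ Fd).
  move=> /(canRL (mulfK nzF)); rewrite mulfV // -exprM => wd.
  rewrite {1}(divn_eq d 3) mulnC; move: wd; rewrite {1}(divn_eq d 3) mulnDr mulnA exprD mulnC exprM w3 expr1n mul1r.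
  have := ltn_pmod d (isT : (0 < 3)%N); case: (d %% 3)%N => [|[|[|]]] // _.
  - by rewrite addn0.
  - by move=> /eqP; rewrite (negPf w2).
  by move=> /eqP; rewrite (exprD w 3 1) w3 mul1r expr1 (negPf w1).
have H : forall x, F x != 0 -> d = (3 * (d %/ 3))%N by [].
by exists (d %/ 3)%N; split=> //; apply: cov.
Qed.

(** Expand F(g x) = sum_i F_i(g x) h_i(g x), where F and the F_i only
    contribute powers of det(g), and pair with det(g)^(2e). The left-hand side
    becomes a nonzero multiple of F(x) and each h_i is replaced by an
    invariant. *)
Theorem reynolds_combination (m : nat) d (F : W -> C) (di : 'I_m -> nat) (Fi hi : 'I_m -> W -> C) :
  SL3_invariant F -> homogfun d F ->
  (forall i, SL3_invariant (Fi i) /\ homogfun (di i) (Fi i)) ->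
  (forall i, polyfun (hi i)) -> (forall x, F x = \sum_i Fi i x * hi i x) ->
  exists ki : 'I_m -> W -> C, (forall i, invariant_algebra (ki i)) /\
    forall x, F x = \sum_i Fi i x * ki i x.
Proof.
move=> Finv Fd Fip hip FE.
have [Q QF] := homogfun_polyfun Fd.
have [e [_ covF]] := homog_invariant_covariant Finv Fd QF.
have /choice [Qi QFi] : forall i, exists Q, polyfun_of Q (Fi i).
  by move=> i; have [_ /homogfun_polyfun] := Fip i.
have /choice [Hi Hhi] : forall i, exists Q, polyfun_of Q (hi i) by [].
have /choice [ei covi] : forall i, exists e, forall x, pact (Qi i) x = Fi i x *: detX ^+ (2 * e).
  move=> i; have [inv hom] := Fip i.
  by have [e' [_ H]] := homog_invariant_covariant inv hom (QFi i); exists e'.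
pose c := apol (detX ^+ (2 * e)) (detX ^+ (2 * e)).
have nzc : c != 0 by rewrite gt_eqF // apol_detX_gt0.
exists (fun i x => c^-1 * reynolds (2 * e) (2 * ei i) (Hi i) x); split=> [i|x].
  have [pr ir] := reynolds_invariant (2 * e) (2 * ei i) (Hi i).
  by split; [apply: polyfunM => //; apply: polyfunC | move=> g dg x; rewrite ir].
apply: (mulfI nzc); rewrite [c * F x]mulrC -apolZr -covF.
have -> : pact Q x = \sum_i Fi i x *: (detX ^+ (2 * ei i) * pact (Hi i) x).
  apply: S9_ext => g; rewrite (pact_eval _ _ QF) FE raddf_sum; apply: eq_bigr => i _ /=.
  by rewrite scalerAl -covi mevalM (pact_eval _ _ (QFi i)) (pact_eval _ _ (Hhi i)).
rewrite apol_sumr mulr_sumr; apply: eq_bigr => i _.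
by rewrite apolZr mulrCA mulVKf.
Qed.

(** F(c x) is a polynomial in c whose coefficients are the homogeneous parts
    of F at x, and it does not change when x is replaced by g x. *)
Lemma invariant_decomp (F : W -> C) : invariant_algebra F -> exists D (H : nat -> W -> C),
  [/\ forall k : nat, homogfun k (H k) /\ SL3_invariant (H k), forall (k : nat) v, (D <= k)%N -> H k v = 0
    & forall v, F v = \sum_(k < D) H k v].
Proof.
move=> [/polyfun_decomp [D [H [Hh H0 HF]]] Finv]; exists D, H; split=> // k; split=> // g dg x.
have [ltkD|leDk] := ltnP k D; last by rewrite !H0.
pose P y : {poly C} := \poly_(k < D) H k y.
have PE y c : (P y).[c] = F (c *: y).
  rewrite horner_poly HF; apply: eq_bigr => i _.
  by rewrite (homogfun_scale _ _ (Hh i)) mulrC.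
have : P (pV_act g x) - P x = 0.
  apply: poly_eq0_eval => c; rewrite hornerD hornerN !PE.
  by rewrite -pV_act_scale Finv // subrr.
by move=> /polyP/(_ k); rewrite coefB !coef_poly ltkD coef0 => /eqP; rewrite subr_eq0 => /eqP.
Qed.

(** Compare the coefficients of c^d in F(c x) = sum_i F_i(c x) k_i(c x). *)
Theorem reynolds_graded (m : nat) d (F : W -> C) (di : 'I_m -> nat) (Fi hi : 'I_m -> W -> C) :
  SL3_invariant F -> homogfun d F ->
  (forall i, SL3_invariant (Fi i) /\ homogfun (di i) (Fi i)) ->
  (forall i, polyfun (hi i)) -> (forall x, F x = \sum_i Fi i x * hi i x) ->
  exists ki : 'I_m -> W -> C,
    (forall i, SL3_invariant (ki i) /\ homogfun (d - di i) (ki i)) /\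
    (forall i, (d < di i)%N -> forall x, ki i x = 0) /\
    forall x, F x = \sum_i Fi i x * ki i x.
Proof.
move=> Finv Fd Fip hip FE.
have [ki [kiinv kiE]] := reynolds_combination Finv Fd Fip hip FE.
have /choice [D HD] := fun i => invariant_decomp (kiinv i).
have /choice [H HP] := HD.
pose ci i x := if (di i <= d)%N then H i (d - di i)%N x else 0.
exists ci; split; last split.
- move=> i; rewrite /ci; case: leqP => _; first by have [/(_ (d - di i)%N) []] := HP i.
  by split=> // ; exact: homogfun0.
- by move=> i lt x; rewrite /ci leqNgt lt.
move=> x.
pose P : {poly C} := F x *: 'X^d - \sum_i \sum_(k < D i) (Fi i x * H i k x) *: 'X^(di i + k).
have : P = 0.
  apply: poly_eq0_eval => c; rewrite hornerD hornerN hornerZ hornerXn horner_sum.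
  rewrite mulrC -(homogfun_scale _ _ Fd) kiE; apply/eqP; rewrite subr_eq0; apply/eqP.
  apply: eq_bigr => i _; rewrite horner_sum; have [Hh _ ->] := HP i.
  rewrite mulr_sumr; apply: eq_bigr => k _.
  have [_ Fh] := Fip i; have [Hk _] := Hh k.
  rewrite hornerZ hornerXn (homogfun_scale _ _ Fh) (homogfun_scale _ _ Hk) exprD; ring.
move=> /polyP/(_ d); rewrite coefB coef0 coefZ coefXn eqxx mulr1 => /eqP.
rewrite subr_eq0 => /eqP ->; rewrite coef_sum; apply: eq_bigr => i _.
rewrite coef_sum /ci; have [_ H0 _] := HP i; case: leqP => [le|lt]; last first.
  rewrite mulr0 big1 // => k _; rewrite coefZ coefXn; case: eqP => [E|]; last by rewrite mulr0.
  by move: lt; rewrite E ltnNge leq_addr.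
have [ltk|gek] := ltnP (d - di i) (D i); last first.
  rewrite H0 // mulr0 big1 // => k _; rewrite coefZ coefXn; case: eqP => [E|]; last by rewrite mulr0.
  by have := ltn_ord k; rewrite ltnNge (leq_trans gek) // E addKn.
rewrite (bigD1 (Ordinal ltk)) //= coefZ coefXn subnKC // eqxx mulr1 big1 ?addr0 // => k nk.
rewrite coefZ coefXn; case: eqP => [E|]; last by rewrite mulr0.
by case/eqP: nk; apply: val_inj; rewrite /= E addKn.
Qed.
End Reynolds.

(** * Finiteness over invariants that cut out the nullcone *)

Definition mwt r (d : 'I_r -> nat) (m : 'X_{1..r}) : nat := (\sum_i m i * d i)%N.

Lemma mwt0 r (d : 'I_r -> nat) : mwt d 0%MM = 0%N.
Proof. by rewrite /mwt big1 // => i _; rewrite mnm0E. Qed.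

Lemma mwtD r (d : 'I_r -> nat) : {morph mwt d : m1 m2 / (m1 + m2)%MM >-> (m1 + m2)%N}.
Proof.
move=> m1 m2; rewrite /mwt -big_split; apply: eq_bigr => i _.
by rewrite mnmDE mulnDl.
Qed.

HB.instance Definition _ r (d : 'I_r -> nat) :=
  isMeasure.Build r (mwt d) (mwt0 d) (mwtD d).

Lemma mwt1 r (d : 'I_r -> nat) i : mwt d U_(i)%MM = d i.
Proof.
rewrite /mwt (bigD1 i) //= mnm1E eqxx mul1n big1 ?addn0 // => j nj.
by rewrite mnm1E eq_sym (negPf nj).
Qed.

Section Finiteness.
Variables (C : numClosedFieldType) (p : nat).
Local Notation W := (pV C p).
Local Notation n := (\dim {:W}).
Local Notation cv v := (fun i => coord (vbasis {:W}) i v).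

Lemma homogfun0_const (K : fieldType) (V : vectType K) (F : V -> K) :
  homogfun 0 F -> forall v, F v = F 0.
Proof. by move=> F0 v; rewrite -(scale0r v) (homogfun_scale _ _ F0) expr0 mul1r. Qed.

Lemma homogfun_monomial r (d : 'I_r -> nat) (G : 'I_r -> W -> C) (m : 'X_{1..r}) :
  (forall i, homogfun (d i) (G i)) -> homogfun (mwt d m) (fun x => \prod_i G i x ^+ m i).
Proof.
move=> hG; suff H (s : seq 'I_r) :
    homogfun (\sum_(i <- s) m i * d i)%N (fun x => \prod_(i <- s) G i x ^+ m i) by apply: H.
elim: s => [|i s IH].
  by rewrite big_nil; apply: homogfun_ext (homogfunC _ 1) => x; rewrite big_nil.
have Hi e : homogfun (e * d i) (fun x => G i x ^+ e).
  elim: e => [|e IHe]; first by apply: homogfun_ext (homogfunC _ 1) => x.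
  by rewrite mulSn; apply: homogfun_ext (homogfunM (hG i) IHe) => x; rewrite exprS.
by rewrite big_cons; apply: homogfun_ext (homogfunM (Hi (m i)) IH) => x; rewrite big_cons.
Qed.

(** Let the G_i generate the ideal of all homogeneous invariants of positive
    degree. An invariant F of positive degree is sum_i G_i k_i with invariant
    k_i of smaller degree, to which induction applies. *)
Lemma invariants_generated : exists r (G : 'I_r -> W -> C) (d : 'I_r -> nat),
  (forall i, [/\ SL3_invariant (G i), (0 < d i)%N & homogfun (d i) (G i)]) /\
  forall k F, SL3_invariant F -> homogfun k F ->
    exists2 R : {mpoly C[r]}, R \is k.-homog for (mwt d) & forall x, F x = R.@[G^~ x].
Proof.
pose P (q : {mpoly C[n]}) := exists d, [/\ (0 < d)%N, q \is d.-homog & SL3_invariant (fun x : W => q.@[cv x])].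
have [r [Fq [PF genF]]] := hilbert_basis P.
have /choice [d dP] := PF.
pose G i x := (Fq i).@[cv x].
have Gh i : homogfun (d i) (G i) by have [_ hq _] := dP i; exists (Fq i).
exists r, G, d; split; first by move=> i; have [d0 _ inv] := dP i.
elim/ltn_ind => k IH F Finv Fk.
case: (posnP k) => [k0|kpos].
  exists (F 0)%:MP; last by move=> x; rewrite mevalC; apply: homogfun0_const; rewrite -k0.
  by rewrite k0 -[_%:MP]mulr1 mul_mpolyC; apply: dhomogZ; apply: dhomog1.
have [Q Qk QF] := Fk.
have PQ : P Q by exists k; split=> // g dg x; rewrite -!QF Finv.
have [h hE] := genF Q PQ.
have [|||] := @reynolds_graded C p r k F d G (fun i x => (h i).@[cv x]) Finv Fk.
- by move=> i; have [_ _ inv] := dP i.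
- by move=> i; exists (h i).
- move=> x; rewrite QF hE raddf_sum; apply: eq_bigr => i _.
  by rewrite /= mevalM mulrC.
move=> ki [kiP [ki0 kiE]].
have /choice [Ri RiP] : forall i, exists R : {mpoly C[r]},
    (d i <= k)%N -> R \is (k - d i).-homog for (mwt d) /\ forall x, ki i x = R.@[G^~ x].
  move=> i; case: (leqP (d i) k) => [le|_]; last by exists 0.
  have [d0 _ _] := dP i; have [kinv kh] := kiP i.
  have lt : (k - d i < k)%N by rewrite ltn_subrL d0.
  by have [R hR RE] := IH _ lt _ kinv kh; exists R.
exists (\sum_(i | (d i <= k)%N) 'X_i * Ri i).
  apply: rpred_sum => i le; have [hR _] := RiP i le.
  by rewrite -(subnKC le); apply: dhomogM => //; rewrite dhomogX; apply/eqP; exact: mwt1.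
move=> x; rewrite kiE (bigID (fun i => (d i <= k)%N)) /= [X in _ + X]big1 ?addr0; last first.
  by move=> i; rewrite -ltnNge => lt; rewrite ki0 // mulr0.
rewrite raddf_sum; apply: eq_bigr => i le; have [_ RE] := RiP i le.
by rewrite /= mevalM mevalXU RE.
Qed.

(** Let the G_i generate A(p). By hypothesis and the Nullstellensatz, the N-th
    power of each G_i lies in the ideal generated by the theta_j, for some N.
    The monomials in the G_i with exponents below N generate A(p) as a module:
    any other monomial is a sum of theta_j k_j with invariant k_j of smaller
    degree. *)
Theorem finite_over_nullcone_parameters t (theta : 'I_t -> W -> C) (e : 'I_t -> nat) :
  (forall i, [/\ SL3_invariant (theta i), (0 < e i)%N & homogfun (e i) (theta i)]) ->
  (forall d F, (0 < d)%N -> SL3_invariant F -> homogfun d F ->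
     forall x, (forall i, theta i x = 0) -> F x = 0) ->
  module_finite_over (@invariant_algebra C p) theta.
Proof.
move=> thP nullP.
have [r [G [d [GP genG]]]] := invariants_generated.
have /choice [Gq GqE] : forall i, exists Q, polyfun_of Q (G i).
  by move=> i; have [_ _ /homogfun_polyfun] := GP i.
have /choice [tq tqE] : forall i, exists Q, polyfun_of Q (theta i).
  by move=> i; have [_ _ /homogfun_polyfun] := thP i.
pose I := gen_ideal (fun f => exists i, f = tq i).
have idI : is_ideal I by apply: gen_is_ideal.
have /choice [Ni NiP] : forall i, exists N, I (Gq i ^+ N).
  move=> i; apply: nullstellensatz => // v Iv.
  have := nullP (d i) (G i); have [inv d0 hG] := GP i.
  move=> /(_ d0 inv hG (pt_of v)); rewrite GqE (meval_eq _ (coord_pt_of v)); apply=> j.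
  by rewrite tqE (meval_eq _ (coord_pt_of v)); apply: Iv; apply: gen_in; exists j.
pose N := (\sum_i Ni i).+1.
have Ipow i e0 : (N <= e0)%N -> I (Gq i ^+ e0).
  move=> le; have leN : (Ni i <= e0)%N.
    by apply: leq_trans le; rewrite leqW // (bigD1 i) //= leq_addr.
  by rewrite -(subnK leN) exprD; apply: gen_mul; apply: NiP.
pose B : finType := {ffun 'I_r -> 'I_N}.
pose h (j : 'I_#|B|) (x : W) := \prod_i G i x ^+ (enum_val j i).
pose Md (F : W -> C) := exists Q : 'I_#|B| -> {mpoly C[t]},
  forall v, F v = \sum_j (Q j).@[theta^~ v] * h j v.
have Md0 F : (forall x, F x = 0) -> Md F.
  by move=> F0; exists (fun=> 0) => v; rewrite F0 big1 // => j _; rewrite meval0 mul0r.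
have Md_sum (T : Type) (s : seq T) (F : T -> W -> C) (cc : T -> {mpoly C[t]}) (PP : pred T) :
    (forall i, PP i -> Md (F i)) -> Md (fun x => \sum_(i <- s | PP i) (cc i).@[theta^~ x] * F i x).
  move=> MF; elim: s => [|i s [Q QE]]; first by apply: Md0 => x; rewrite big_nil.
  case Pi: (PP i); last by exists Q => v; rewrite big_cons Pi QE.
  have [Q' QE'] := MF i Pi.
  exists (fun j => cc i * Q' j + Q j) => v; rewrite big_cons Pi QE QE' mulr_sumr -big_split.
  by apply: eq_bigr => j _; rewrite /= mevalD mevalM mulrDl mulrA.
have Md_hom k F : SL3_invariant F -> homogfun k F -> Md F.
  elim/ltn_ind: k F => k IH F Finv Fk.
  have [R hR RE] := genG k F Finv Fk.
  have Mmon m : m \in msupp R -> Md (fun x => \prod_i G i x ^+ m i).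
    move=> mR; have wm : mwt d m = k by apply: (dhomog_mf hR).
    have [mN|nmN] := EM (forall i, (m i < N)%N).
      pose b : B := [ffun i => Ordinal (mN i)].
      exists (fun j => (j == enum_rank b)%:R%:MP) => v.
      rewrite (bigD1 (enum_rank b)) //= eqxx mevalC mul1r [X in _ = _ + X]big1 ?addr0.
        by rewrite /h; apply: eq_bigr => i _; rewrite enum_rankK ffunE.
      by move=> j /negPf ->; rewrite mevalC mul0r.
    have [i lei] : exists i, (N <= m i)%N.
      apply: contrapT => none; apply: nmN => i; rewrite ltnNge; apply/negP => le.
      by apply: none; exists i.
    have Im : I (\prod_i Gq i ^+ m i).
      by rewrite (bigD1 i) //= mulrC; apply: gen_mul; apply: Ipow.
    have [hh hhE] := gen_comb Im.
    have Minv : SL3_invariant (fun x : W => \prod_i G i x ^+ m i).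
      by move=> g dg x; apply: eq_bigr => j _; have [inv _ _] := GP j; rewrite inv.
    have Mh : homogfun k (fun x : W => \prod_i G i x ^+ m i).
      by rewrite -wm; apply: homogfun_monomial => j; have [] := GP j.
    have [|||] := @reynolds_graded C p t k _ e theta (fun j x => (hh j).@[cv x]) Minv Mh.
    - by move=> j; have [] := thP j.
    - by move=> j; exists (hh j).
    - move=> x; transitivity ((\prod_i Gq i ^+ m i).@[cv x]).
        by rewrite rmorph_prod; apply: eq_bigr => j _; rewrite rmorphXn /= GqE.
      rewrite hhE raddf_sum; apply: eq_bigr => j _.
      by rewrite /= mevalM mulrC tqE.
    move=> ki [kiP [ki0 kiE]].
    have [|Q QE] := @Md_sum _ (index_enum 'I_t) ki (fun j => 'X_j) xpredT; last first.
      by exists Q => v; rewrite kiE -QE; apply: eq_bigr => j _; rewrite mevalXU.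
    move=> j _; have [inv e0 _] := thP j; have [kinv kh] := kiP j.
    case: (leqP (e j) k) => [le|lt]; last by apply: Md0 => x; apply: ki0.
    by apply: (IH (k - e j)%N) => //; rewrite ltn_subrL e0 (leq_trans e0 le).
  have [//|Q QE] := @Md_sum _ (msupp R) (fun (m : 'X_{1..r}) x => \prod_i G i x ^+ m i)
       (fun m => (R@_m)%:MP) (fun m => m \in msupp R).
  exists Q => v; rewrite RE -QE mevalE big_seq; apply: eq_bigr => m _.
  by rewrite mevalC.
exists #|B|, h; split=> [j|F FA].
  split; last by move=> g dg x; apply: eq_bigr => i _; have [inv _ _] := GP i; rewrite inv.
  by apply: polyfun_prod => i; apply: polyfunX; have [_ _ /homogfun_polyfun] := GP i.
have [D [H [HP _ HE]]] := invariant_decomp FA.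
have [|Q QE] := @Md_sum _ (index_enum 'I_D) (fun k => H k) (fun=> 1) xpredT.
  by move=> k _; have [Hh Hi] := HP k; apply: Md_hom Hi Hh.
by exists Q => v; rewrite HE -QE; apply: eq_bigr => k _; rewrite meval1 mul1r.
Qed.
End Finiteness.

(** * The polarized determinant *)

Local Notation o0 := (@Ordinal 3 0 isT).
Local Notation o1 := (@Ordinal 3 1 isT).
Local Notation o2 := (@Ordinal 3 2 isT).

Lemma ord3P (i : 'I_3) : [\/ i = o0, i = o1 | i = o2].
Proof.
by case: i => [[|[|[|//]]]] lt; [apply: Or31|apply: Or32|apply: Or33]; apply: val_inj.
Qed.

Lemma sum3 (V : nmodType) (F : 'I_3 -> V) : \sum_i F i = F o0 + (F o1 + F o2).
Proof.
rewrite !big_ord_recl big_ord0 addr0.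
by congr (F _ + (F _ + F _)); apply: val_inj.
Qed.

Lemma det3 (R : comRingType) (A : 'M[R]_3) : \det A =
  A o0 o0 * (A o1 o1 * A o2 o2 - A o1 o2 * A o2 o1)
  - A o0 o1 * (A o1 o0 * A o2 o2 - A o1 o2 * A o2 o0)
  + A o0 o2 * (A o1 o0 * A o2 o1 - A o1 o1 * A o2 o0).
Proof.
have det2 (B : 'M[R]_2) : \det B = B ord0 ord0 * B ord_max ord_max - B ord0 ord_max * B ord_max ord0.
  rewrite (expand_det_row _ ord0) !big_ord_recl big_ord0 addr0 /cofactor !det_mx11 !mxE /=.
  rewrite expr0 mul1r add0n expr1 mulN1r mulrN.
  by congr (_ * B _ _ - B _ _ * B _ _); apply: val_inj.
rewrite (expand_det_row _ o0) sum3 /cofactor !det2 !mxE /=.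
rewrite !add0n expr0 expr1 sqrrN expr1n !mul1r.
have e1 : lift o0 ord0 = o1 by apply: val_inj.
have e2 : lift o0 ord_max = o2 by apply: val_inj.
have e3 : lift o1 ord0 = o0 by apply: val_inj.
have e4 : lift o1 ord_max = o2 by apply: val_inj.
have e5 : lift o2 ord0 = o0 by apply: val_inj.
have e6 : lift o2 ord_max = o1 by apply: val_inj.
rewrite !(e1, e2, e3, e4, e5, e6); ring.
Qed.

(** The determinant of the matrix whose rows are the first row of u, the
    second of v and the third of w. *)
Definition rowdet (R : comRingType) (u v w : 'M[R]_3) : R :=
  u o0 o0 * (v o1 o1 * w o2 o2 - v o1 o2 * w o2 o1)
  - u o0 o1 * (v o1 o0 * w o2 o2 - v o1 o2 * w o2 o0)
  + u o0 o2 * (v o1 o0 * w o2 o1 - v o1 o1 * w o2 o0).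

(** The coefficient of abc in det (a x + b y + c z), by multilinearity in the
    rows. *)
Definition polarM (R : comRingType) (x y z : 'M[R]_3) : R :=
  rowdet x y z + rowdet x z y + rowdet y x z + rowdet y z x + rowdet z x y + rowdet z y x.

Lemma coef_linear_product (R : comRingType) (c1 c2 c3 : 'I_3 -> R) :
  ((\sum_i c1 i *: 'X_i) * (\sum_i c2 i *: 'X_i) * (\sum_i c3 i *: 'X_i)
    : {mpoly R[3]})@_(U_(o0) + U_(o1) + U_(o2)) =
  c1 o0 * (c2 o1 * c3 o2 + c2 o2 * c3 o1) + c1 o1 * (c2 o0 * c3 o2 + c2 o2 * c3 o0)
  + c1 o2 * (c2 o0 * c3 o1 + c2 o1 * c3 o0).
Proof.
have mE (i j k : 'I_3) : (U_(i) + U_(j) + U_(k) == U_(o0) + U_(o1) + U_(o2) :> 'X_{1..3})%MM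
    = [&& i != j, j != k & i != k].
  have E3 (m1 m2 : 'X_{1..3}) : (m1 == m2) = [&& m1 o0 == m2 o0, m1 o1 == m2 o1 & m1 o2 == m2 o2].
    apply/eqP/and3P => [->//|[/eqP e0 /eqP e1 /eqP e2]].
    by apply/mnmP => t; have [->|->|->] := ord3P t.
  by rewrite E3 !mnmDE !mnm1E; have [->|->|->] := ord3P i; have [->|->|->] := ord3P j;
    have [->|->|->] := ord3P k.
transitivity (\sum_i \sum_j \sum_k c1 i * c2 j * c3 k * [&& i != j, j != k & i != k]%:R).
  rewrite mulr_suml mulr_suml raddf_sum; apply: eq_bigr => i _ /=.
  rewrite [c1 i *: _ * _]mulr_sumr mulr_suml raddf_sum; apply: eq_bigr => j _ /=.
  rewrite mulr_sumr raddf_sum; apply: eq_bigr => k _ /=.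
  rewrite -!scalerAl -!scalerAr -scalerAl !mcoeffZ -!mpolyXD mcoeffX mE.
  by ring.
rewrite !sum3 /= !(mulr0, mulr1, add0r, addr0); ring.
Qed.

Lemma polar_detE (K : fieldType) (x y z : Sym3 K) :
  polar_det x y z = polarM (vsval x) (vsval y) (vsval z).
Proof.
rewrite /polar_det /det_pencil.
have -> : (0 : 'I_3) = o0 by apply: val_inj.
have -> : (1 : 'I_3) = o1 by apply: val_inj.
have -> : (o1 *+ 2 : 'I_3) = o2 by apply: val_inj.
move: (vsval x) (vsval y) (vsval z) => {x y z} x y z.
pose l i j := \sum_(k < 3) (nth x [:: x; y; z] k) i j *: ('X_k : {mpoly K[3]}).
have lE i j : ('X_o0 *: map_mx (@mpolyC 3 K) x + 'X_o1 *: map_mx (@mpolyC 3 K) y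
        + 'X_o2 *: map_mx (@mpolyC 3 K) z) i j = l i j.
  rewrite /l sum3 !mxE /= addrA.
  by rewrite ![_ * _%:MP]mulrC !mul_mpolyC.
rewrite det3 !lE.
have -> : l o0 o0 * (l o1 o1 * l o2 o2 - l o1 o2 * l o2 o1)
  - l o0 o1 * (l o1 o0 * l o2 o2 - l o1 o2 * l o2 o0)
  + l o0 o2 * (l o1 o0 * l o2 o1 - l o1 o1 * l o2 o0) =
  l o0 o0 * l o1 o1 * l o2 o2 - l o0 o0 * l o1 o2 * l o2 o1
  - l o0 o1 * l o1 o0 * l o2 o2 + l o0 o1 * l o1 o2 * l o2 o0
  + l o0 o2 * l o1 o0 * l o2 o1 - l o0 o2 * l o1 o1 * l o2 o0 by ring.
rewrite !(mcoeffD, mcoeffN) /l !coef_linear_product /= /polarM /rowdet; ring.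
Qed.

Lemma polarM_linear (R : comRingType) (a : R) (x x' y z : 'M[R]_3) :
  polarM (a *: x + x') y z = a * polarM x y z + polarM x' y z.
Proof. by rewrite /polarM /rowdet !mxE; ring. Qed.

Lemma polarM_C12 (R : comRingType) (x y z : 'M[R]_3) : polarM x y z = polarM y x z.
Proof. by rewrite /polarM; ring. Qed.

Lemma polarM_C23 (R : comRingType) (x y z : 'M[R]_3) : polarM x y z = polarM x z y.
Proof. by rewrite /polarM; ring. Qed.

Lemma polarM_diag (R : comRingType) (x : 'M[R]_3) : polarM x x x = 6%:R * \det x.
Proof. by rewrite det3 /polarM /rowdet; ring. Qed.

Lemma polarM_polarization (R : comRingType) (x y z : 'M[R]_3) :
  polarM x y z = \det (x + y + z) - \det (x + y) - \det (x + z) - \det (y + z)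
    + \det x + \det y + \det z.
Proof. by rewrite !det3 /polarM /rowdet !mxE; ring. Qed.

Lemma polarM_congr (K : fieldType) (g x y z : 'M[K]_3) :
  polarM (g *m x *m g^T) (g *m y *m g^T) (g *m z *m g^T) = \det g ^+ 2 * polarM x y z.
Proof.
have detE u : \det (g *m u *m g^T) = \det g ^+ 2 * \det u.
  by rewrite !det_mulmx det_tr; ring.
by rewrite !polarM_polarization -!mulmxDl -!mulmxDr !detE; ring.
Qed.

Section PolarFunctions.
Variables (K : fieldType) (p : nat).
Local Notation W := (pV K p).

Definition polarf (i j k : 'I_p) (x : W) : K := polar_det (x i) (x j) (x k).

Lemma homogfun_polarf i j k : homogfun 3 (polarf i j k).
Proof.
have H (u v w : 'I_p) : homogfun 3 (fun x : W => rowdet (vsval (x u)) (vsval (x v)) (vsval (x w))).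
  have H2 (a b c d : 'I_3) : homogfun 2 (fun x : W => 
      vsval (x v) a b * vsval (x w) c d).
    rewrite -[2%N]/(1 + 1)%N.
    have H := homogfunM (homogfun_entry K v a b) (homogfun_entry K w c d).
    by apply: (homogfun_ext _ H) => x.
  have H2B (a b c d a' b' c' d' : 'I_3) : homogfun 2 (fun x : W => 
      vsval (x v) a b * vsval (x w) c d - vsval (x v) a' b' * vsval (x w) c' d').
    apply: homogfun_ext (homogfunD (H2 a b c d) (homogfunZ (-1) (H2 a' b' c' d'))) => x.
    by rewrite mulN1r.
  have H3 (r s a b c d a' b' c' d' : 'I_3) : homogfun 3 (fun x : W => 
      vsval (x u) r s * (vsval (x v) a b * vsval (x w) c d - vsval (x v) a' b' * vsval (x w) c' d')).
    rewrite -[3%N]/(1 + 2)%N.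
    have H := homogfunM (homogfun_entry K u r s) (H2B a b c d a' b' c' d').
    by apply: (homogfun_ext _ H) => x.
  apply: homogfun_ext (homogfunD (homogfunD (H3 o0 o0 o1 o1 o2 o2 o1 o2 o2 o1)
     (homogfunZ (-1) (H3 o0 o1 o1 o0 o2 o2 o1 o2 o2 o0))) (H3 o0 o2 o1 o0 o2 o1 o1 o1 o2 o0)) => x.
  by rewrite mulN1r.
apply: homogfun_ext (homogfunD (homogfunD (homogfunD (homogfunD (homogfunD
  (H i j k) (H i k j)) (H j i k)) (H j k i)) (H k i j)) (H k j i)) => x.
by rewrite /polarf polar_detE.
Qed.

Lemma polarf_invariant i j k : SL3_invariant (polarf i j k).
Proof.
move=> g dg x; rewrite /polarf !polar_detE !pV_actE.
by rewrite polarM_congr dg expr1n mul1r.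
Qed.
End PolarFunctions.

(** * Linear spaces of singular symmetric matrices *)

Definition mx33 (R : nmodType) (a b c d e f g h i : R) : 'M[R]_3 :=
  \matrix_(r, s) nth 0 (nth [::] [:: [:: a; b; c]; [:: d; e; f]; [:: g; h; i]] r) s.

Lemma mx33_ext (R : nmodType) (A B : 'M[R]_3) :
  A o0 o0 = B o0 o0 -> A o0 o1 = B o0 o1 -> A o0 o2 = B o0 o2 ->
  A o1 o0 = B o1 o0 -> A o1 o1 = B o1 o1 -> A o1 o2 = B o1 o2 ->
  A o2 o0 = B o2 o0 -> A o2 o1 = B o2 o1 -> A o2 o2 = B o2 o2 -> A = B.
Proof.
move=> *; apply/matrixP => i j.
by have [->|->|->] := ord3P i; have [->|->|->] := ord3P j.
Qed.

Lemma mx33_det (R : comRingType) (a b c d e f g h i : R) :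
  \det (mx33 a b c d e f g h i) = a * (e * i - f * h) - b * (d * i - f * g) + c * (d * h - e * g).
Proof. by rewrite det3 !mxE. Qed.

Lemma congr_block (R : comRingType) (h0 h1 k0 k1 a b c : R) :
  let h := mx33 h0 h1 0 k0 k1 0 0 0 1 in
  h *m mx33 a b 0 b c 0 0 0 0 *m h^T =
  mx33 (h0 ^+ 2 * a + 2%:R * h0 * h1 * b + h1 ^+ 2 * c)
       (h0 * k0 * a + (h0 * k1 + h1 * k0) * b + h1 * k1 * c) 0
       (h0 * k0 * a + (h0 * k1 + h1 * k0) * b + h1 * k1 * c)
       (k0 ^+ 2 * a + 2%:R * k0 * k1 * b + k1 ^+ 2 * c) 0 0 0 0.
Proof. by apply: mx33_ext; rewrite !mxE !sum3 !mxE !sum3 !mxE /=; ring. Qed.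

Lemma mx33_block (R : nmodType) (z : 'M[R]_3) :
  (forall i j, z i j = z j i) -> (forall j, z o2 j = 0) ->
  z = mx33 (z o0 o0) (z o0 o1) 0 (z o0 o1) (z o1 o1) 0 0 0 0.
Proof.
move=> zs z2; apply: mx33_ext; rewrite [RHS]mxE //=.
- by rewrite zs z2.
- by rewrite zs z2.
Qed.

Definition diag33 (R : nmodType) (a b c : R) : 'M[R]_3 := mx33 a 0 0 0 b 0 0 0 c.

Lemma diag33_congr (R : comRingType) (a b c : R) (x : 'M[R]_3) :
  diag33 a b c *m x *m (diag33 a b c)^T =
  mx33 (a * a * x o0 o0) (a * b * x o0 o1) (a * c * x o0 o2)
       (b * a * x o1 o0) (b * b * x o1 o1) (b * c * x o1 o2)
       (c * a * x o2 o0) (c * b * x o2 o1) (c * c * x o2 o2).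
Proof. by apply: mx33_ext; rewrite !mxE !sum3 !mxE !sum3 !mxE /=; ring. Qed.

Section SymmetricForms.
Variable C : numClosedFieldType.
Implicit Types (x y z g h : 'M[C]_3).

Definition E00 : 'M[C]_3 := mx33 1 0 0 0 0 0 0 0 0.
Definition hyperbolic : 'M[C]_3 := mx33 0 1 0 1 0 0 0 0 0.

(** The binary form a X^2 + 2b XY + c Y^2 is 0, a square, or a product of two
    independent linear forms. In the last case the new basis consists of the
    two isotropic vectors, scaled. *)
Lemma binary_normal_form (a b c : C) : exists h0 h1 k0 k1 : C, h0 * k1 - h1 * k0 != 0 /\
  let h := mx33 h0 h1 0 k0 k1 0 0 0 1 in
  let z := h *m mx33 a b 0 b c 0 0 0 0 *m h^T in [\/ z = 0, z = E00 | z = hyperbolic].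
Proof.
have mx0 : mx33 0 0 0 0 0 0 0 0 0 = 0 :> 'M[C]_3 by apply: mx33_ext; rewrite !mxE.
have two0 : 2%:R != 0 :> C by rewrite pnatr_eq0.
case: (eqVneq (b ^+ 2) (a * c)) => [disc0|disc].
  case: (eqVneq a 0) => [a0|nza].
    move: disc0; rewrite a0 mul0r => /eqP; rewrite expf_eq0 /= => /eqP ->.
    case: (eqVneq c 0) => [->|nzc].
      exists 1, 0, 0, 1; split; first by rewrite mulr1 mulr0 subr0 oner_neq0.
      by apply: Or31; rewrite congr_block -mx0; congr mx33; ring.
    pose s := sqrtC c; have cE : c = s ^+ 2 by rewrite sqrtCK.
    have nzs : s != 0 by rewrite sqrtC_eq0.
    exists 0, (s^-1), 1, 0; split; first by rewrite mulr1 mulr0 sub0r oppr_eq0 invr_eq0.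
    by apply: Or32; rewrite congr_block /E00 cE; congr mx33; field.
  pose s := sqrtC a; have aE : a = s ^+ 2 by rewrite sqrtCK.
  have nzs : s != 0 by rewrite sqrtC_eq0.
  have cE : c = b ^+ 2 / s ^+ 2 by rewrite disc0 -aE mulrC mulKf.
  exists (s^-1), 0, (- b), a; split; first by rewrite mul0r subr0 mulf_neq0 ?invr_eq0.
  by apply: Or32; rewrite congr_block /E00 cE aE; congr mx33; field.
case: (eqVneq a 0) => [a0|nza].
  have nzb : b != 0 by apply: contraNneq disc => ->; rewrite a0 mul0r expr0n.
  exists (b^-1), 0, (- c / (2%:R * b)), 1; split; first by rewrite mulr1 mul0r subr0 invr_eq0.
  by apply: Or33; rewrite congr_block /hyperbolic a0; congr mx33; field; rewrite ?nzb ?two0.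
pose d := sqrtC (b ^+ 2 - a * c); have dE : d ^+ 2 = b ^+ 2 - a * c by rewrite sqrtCK.
have nzd : d != 0 by rewrite sqrtC_eq0 subr_eq0.
have cE : c = (b ^+ 2 - d ^+ 2) / a by rewrite dE opprB addrC subrK mulrC mulKf.
pose k := - (2%:R * a * d ^+ 2).
have nzk : k != 0 by rewrite oppr_eq0 !mulf_neq0 // expf_eq0.
exists ((- b + d) / k), (a / k), (- b - d), a; split.
  rewrite (_ : (- b + d) / k * a - a / k * (- b - d) = 2%:R * a * d / k); last by field.
  by rewrite !mulf_neq0 ?invr_eq0.
apply: Or33; rewrite congr_block /hyperbolic cE; congr mx33; rewrite /k; field;
  by rewrite ?nza ?nzd ?two0.
Qed.

(** Take a vector of the kernel as last basis vector and put the remaining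
    binary form in normal form. *)
Lemma singular_normal_form y : y^T = y -> \det y = 0 ->
  exists2 g, \det g != 0 & [\/ g *m y *m g^T = 0, g *m y *m g^T = E00 | g *m y *m g^T = hyperbolic].
Proof.
move=> ys dy.
have symE i j : y i j = y j i by rewrite -{1}ys mxE.
have /det0P [v nzv vy] : \det y == 0 by rewrite dy.
have vyE j : v 0 o0 * y o0 j + (v 0 o1 * y o1 j + v 0 o2 * y o2 j) = 0.
  by have /rowP/(_ j) := vy; rewrite mxE sum3 mxE.
have [P dP Prow] : exists2 P : 'M[C]_3, \det P != 0 & forall j, P o2 j = v 0 j.
  have nzi : [|| v 0 o0 != 0, v 0 o1 != 0 | v 0 o2 != 0].
    apply: contraNT nzv; rewrite !negb_or !negbK => /and3P [/eqP v0 /eqP v1 /eqP v2].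
    by apply/eqP/rowP => j; rewrite mxE; have [->|->|->] := ord3P j.
  case/or3P: nzi => nz.
  - exists (mx33 0 1 0 0 0 1 (v 0 o0) (v 0 o1) (v 0 o2)).
      by rewrite mx33_det (_ : _ + _ = v 0 o0) //; ring.
    by move=> j; rewrite mxE; have [->|->|->] := ord3P j.
  - exists (mx33 1 0 0 0 0 1 (v 0 o0) (v 0 o1) (v 0 o2)).
      by rewrite mx33_det (_ : _ + _ = - v 0 o1) ?oppr_eq0 //; ring.
    by move=> j; rewrite mxE; have [->|->|->] := ord3P j.
  - exists (mx33 1 0 0 0 1 0 (v 0 o0) (v 0 o1) (v 0 o2)).
      by rewrite mx33_det (_ : _ + _ = v 0 o2) //; ring.
    by move=> j; rewrite mxE; have [->|->|->] := ord3P j.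
pose z := P *m y *m P^T.
have zs i j : z i j = z j i.
  suff zT : z^T = z by rewrite -{1}zT mxE.
  by rewrite /z !trmx_mul trmxK ys mulmxA.
have z2 j : z o2 j = 0.
  rewrite /z mxE big1 // => k _.
  by rewrite [(P *m y) _ _]mxE sum3 !Prow vyE mul0r.
have zE := mx33_block zs z2.
have [h0 [h1 [k0 [k1 [nzh /= H]]]]] := binary_normal_form (z o0 o0) (z o0 o1) (z o1 o1).
move: H; rewrite -zE; set h := mx33 h0 _ _ _ _ _ _ _ _ => H.
exists (h *m P).
  rewrite det_mulmx mulf_neq0 // mx33_det (_ : _ + _ = h0 * k1 - h1 * k0) //; ring.
have -> : h *m P *m y *m (h *m P)^T = h *m z *m h^T by rewrite trmx_mul /z !mulmxA.
by [].
Qed.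

(** Both cases say that y has rank at most one. *)
Lemma rank_one_minors y g h : \det h != 0 -> (h *m y *m h^T = 0 \/ h *m y *m h^T = E00) ->
  forall i j k l, let z := g *m y *m g^T in z i j * z k l = z i l * z k j.
Proof.
move=> nzh H i j k l z.
have uh : h \in unitmx by rewrite unitmxE unitfE.
have [q zE] : exists q, z = q *m (h *m y *m h^T) *m q^T.
  exists (g *m invmx h).
  rewrite /z trmx_mul !mulmxA mulmxKV // -!mulmxA; congr (_ *m (_ *m _)).
  by rewrite mulmxA -trmx_mul mulVmx // trmx1 mul1mx.
have [w wE] : exists w : 'I_3 -> C, forall i j, z i j = w i * w j.
  case: H => H.
    by exists (fun=> 0) => i' j'; rewrite zE H mulmx0 mul0mx mxE mul0r.
  exists (fun i => q i o0) => i' j'; rewrite zE H !mxE sum3 !mxE !sum3 !mxE /=; ring.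
by rewrite !wE; ring.
Qed.

(** The coefficients of t^2, t and 1 in det (z + t N), for N the hyperbolic
    matrix, obtained from three values of t. *)
Lemma hyperbolic_pencil_singular z : z^T = z ->
  \det z = 0 -> \det (z + hyperbolic) = 0 -> \det (z - hyperbolic) = 0 ->
  [/\ z o2 o2 = 0, z o0 o2 * z o1 o2 = 0 & z o0 o0 * z o1 o2 ^+ 2 + z o1 o1 * z o0 o2 ^+ 2 = 0].
Proof.
move=> zs; rewrite !det3 !mxE /=.
have zT i j : z i j = z j i by rewrite -{1}zs mxE.
rewrite [z o1 o0]zT [z o2 o0]zT [z o2 o1]zT.
move: (z o0 o0) (z o0 o1) (z o0 o2) (z o1 o1) (z o1 o2) (z o2 o2) => a b u c w e d0 d1 d2.
pose D t := a * (c * e - w * w) - (b + t) * ((b + t) * e - w * u) + u * ((b + t) * w - c * u).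
have D0 : D 0 = 0 by apply: etrans d0; rewrite /D; ring.
have D1 : D 1 = 0 by apply: etrans d1; rewrite /D; ring.
have D2 : D (-1) = 0 by apply: etrans d2; rewrite /D; ring.
have two0 : 2%:R != 0 :> C by rewrite pnatr_eq0.
have four0 : 4%:R != 0 :> C by rewrite pnatr_eq0.
have e0 : e = 0.
  apply: (mulfI two0); rewrite mulr0.
  transitivity (2%:R * D 0 - D 1 - D (-1)); first by rewrite /D; ring.
  by rewrite D0 D1 D2; ring.
have uw : u * w = 0.
  apply: (mulfI four0); rewrite mulr0.
  transitivity (D 1 - D (-1) + 4%:R * b * e); first by rewrite /D; ring.
  by rewrite D1 D2 e0; ring.
split=> //; transitivity (2%:R * b * (u * w) - D 0); first by rewrite /D e0; ring.
by rewrite uw D0; ring.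
Qed.

Variable X : 'M[C]_3 -> Prop.
Hypothesis X_lin : forall a x y, X x -> X y -> X (a *: x + y).
Hypothesis X_sym : forall x, X x -> x^T = x.
Hypothesis X_sing : forall x, X x -> \det x = 0.

(** In terms of conics: the last basis vector is a common vertex. *)
Definition vertex_form g := forall x, X x -> forall i, (g *m x *m g^T) i o2 = 0.

(** In terms of conics: the line spanned by the last two basis vectors is
    common to all of them. *)
Definition isotropic_form g := forall x, X x ->
  [/\ (g *m x *m g^T) o1 o1 = 0, (g *m x *m g^T) o1 o2 = 0 & (g *m x *m g^T) o2 o2 = 0].

Lemma congr_lin g a x y :
  g *m (a *: x + y) *m g^T = a *: (g *m x *m g^T) + g *m y *m g^T.
Proof. by rewrite mulmxDr mulmxDl -scalemxAr -scalemxAl. Qed.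

Lemma congr_sym g x : X x -> forall i j, (g *m x *m g^T) i j = (g *m x *m g^T) j i.
Proof.
move=> /X_sym xs i j; suff zT : (g *m x *m g^T)^T = g *m x *m g^T by rewrite -{1}zT mxE.
by rewrite !trmx_mul trmxK xs mulmxA.
Qed.

(** With y in normal form, each z = g x g^T of the space satisfies z_22 = 0,
    z_02 z_12 = 0 and z_00 z_12^2 + z_11 z_02^2 = 0. Since the entries are
    linear functions on the space, one of z_02, z_12 vanishes identically; if
    the other does not, the last relation forces z_11 = 0, respectively z_00 =
    0. *)
Lemma hyperbolic_case y g : X y -> \det g != 0 -> g *m y *m g^T = hyperbolic ->
  exists2 g, \det g != 0 & vertex_form g \/ isotropic_form g.
Proof.
move=> Xy dg gy.
pose f x := g *m x *m g^T.
have XF x : X x -> [/\ f x o2 o2 = 0, f x o0 o2 * f x o1 o2 = 0 &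
    f x o0 o0 * f x o1 o2 ^+ 2 + f x o1 o1 * f x o0 o2 ^+ 2 = 0].
  move=> Xx; apply: hyperbolic_pencil_singular.
  - by rewrite /f !trmx_mul trmxK (X_sym Xx) mulmxA.
  - by rewrite /f !det_mulmx (X_sing Xx) mulr0 mul0r.
  - have := X_sing (X_lin 1 Xx Xy); rewrite scale1r => e.
    by rewrite -gy -mulmxDl -mulmxDr !det_mulmx e mulr0 mul0r.
  have := X_sing (X_lin (-1) Xy Xx); rewrite scaleN1r addrC => e.
  by rewrite -gy -mulmxBl -mulmxBr !det_mulmx e mulr0 mul0r.
have fD x1 x2 i j : f (1 *: x1 + x2) i j = f x1 i j + f x2 i j.
  by rewrite /f congr_lin scale1r mxE.
(* If the entry (r, 2) is nonzero at x0, evaluating the relations at x, x0 and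
   x0 + x makes the entries (s, 2) and (s, s) vanish on the whole space. *)
have key (r s : 'I_3) x0 : X x0 -> f x0 r o2 != 0 ->
    (forall x, X x -> f x r o2 * f x s o2 = 0 /\ 
        f x r r * f x s o2 ^+ 2 + f x s s * f x r o2 ^+ 2 = 0) ->
    forall x, X x -> f x s o2 = 0 /\ f x s s = 0.
  move=> X0 nz0 H.
  have s0 x : X x -> f x s o2 = 0.
    move=> Xx; have [h1 _] := H _ Xx; have [h2 _] := H _ X0.
    have [h3 _] := H _ (X_lin 1 X0 Xx); move: h3; rewrite !fD.
    have s00 : f x0 s o2 = 0 by move/eqP: h2; rewrite mulf_eq0 (negPf nz0) /= => /eqP.
    rewrite s00 add0r mulrDl h1 addr0 => /eqP.
    by rewrite mulf_eq0 (negPf nz0) /= => /eqP.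
  have ss x : X x -> f x r o2 != 0 -> f x s s = 0.
    move=> Xx nz; have [_] := H _ Xx; rewrite s0 // expr0n mulr0 add0r => /eqP.
    by rewrite mulf_eq0 expf_eq0 /= (negPf nz) orbF => /eqP.
  move=> x Xx; split; first exact: s0.
  case: (eqVneq (f x r o2) 0) => [z|nz]; last exact: ss.
  have := ss _ (X_lin 1 X0 Xx); rewrite !fD z addr0 (ss _ X0 nz0) add0r.
  by apply=> //; apply: X_lin.
have [[x0 [X0 nz]]|none0] := EM (exists x0, X x0 /\ f x0 o0 o2 != 0).
  exists g => //; right => x Xx.
  have [|h1 h2] := key o0 o1 x0 X0 nz _ x Xx; first by move=> x' /XF [].
  by have [h3 _ _] := XF _ Xx; split.
have [[x0 [X0 nz]]|none1] := EM (exists x0, X x0 /\ f x0 o1 o2 != 0).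
  pose s : 'M[C]_3 := mx33 0 1 0 1 0 0 0 0 1.
  exists (s *m g); first by rewrite det_mulmx mulf_neq0 // mx33_det (_ : _ + _ = -1) ?oppr_eq0 ?oner_neq0 //; ring.
  right => x Xx.
  have [|h1 h2] := key o1 o0 x0 X0 nz _ x Xx.
    by move=> x' /XF [_ h1 h2]; rewrite mulrC h1 addrC h2.
  have [h3 _ _] := XF _ Xx.
  have -> : (s *m g) *m x *m (s *m g)^T = s *m f x *m s^T by rewrite /f trmx_mul !mulmxA.
  move: (f x) h1 h2 h3 => z h1 h2 h3.
  by split; rewrite !mxE !sum3 !mxE !sum3 !mxE /= ?h1 ?h2 ?h3; ring.
exists g => //; left => x Xx i; rewrite -/(f x).
have [->|->|->] := ord3P i; last by have [] := XF _ Xx.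
  by apply/eqP/negP => /negP nz; apply: none0; exists x.
by apply/eqP/negP => /negP nz; apply: none1; exists x.
Qed.

(** If some element has rank two, it has the hyperbolic normal form and
    [hyperbolic_case] applies. Otherwise all elements have rank at most one;
    adding to x an element in the normal form [E00] shows that x is a multiple
    of it. *)
Theorem singular_space_form : exists2 g, \det g != 0 & vertex_form g \/ isotropic_form g.
Proof.
have [[y [g [Xy dg gy]]]|noH] :=
  EM (exists y g, [/\ X y, \det g != 0 & g *m y *m g^T = hyperbolic]).
  exact: hyperbolic_case Xy dg gy.
have Xn x : X x -> exists2 h, \det h != 0 & (h *m x *m h^T = 0 \/ h *m x *m h^T = E00).
  move=> Xx; have [h dh [] H] := singular_normal_form (X_sym Xx) (X_sing Xx).
  - by exists h => //; left.
  - by exists h => //; right.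
  by case: noH; exists x, h.
have [[y [Xy nzy]]|all0] := EM (exists y, X y /\ y != 0); last first.
  exists 1%:M; first by rewrite det1 oner_neq0.
  left => x Xx i; have -> : x = 0 by apply/eqP/negP => /negP nz; apply: all0; exists x.
  by rewrite mulmx0 mul0mx mxE.
have [g dg [gy|gy]] := Xn _ Xy.
  case/eqP: nzy; have ug : g \in unitmx by rewrite unitmxE unitfE.
  by rewrite -[y](mulKmx ug) -[g *m y](mulmxK (_ : g^T \in unitmx)) ?unitmx_tr // gy mul0mx mulmx0.
exists g => //; left => x Xx.
have [h dh H] := Xn _ Xx; have mn := rank_one_minors g dh H.
have [h' dh' H'] := Xn _ (X_lin 1 Xy Xx); have mn' := rank_one_minors g dh' H'.
move: mn mn'; rewrite /= congr_lin scale1r gy.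
have zs := congr_sym g Xx; move: (g *m x *m g^T) zs => z zs mn mn'.
have zkl (k l : 'I_3) : k != o0 -> l != o0 -> z k l = 0.
  move=> k0 l0; have := mn' o0 o0 k l; have := mn o0 o0 k l; rewrite !mxE.
  have -> : nth 0 (nth [::] [:: [:: 1; 0; 0]; [:: 0; 0; 0]; [:: 0; 0; 0]] k) l = 0 :> C.
    by move: k0 l0; have [->|->|->] := ord3P k; have [->|->|->] := ord3P l.
  have -> : nth 0 (nth [::] [:: [:: 1; 0; 0]; [:: 0; 0; 0]; [:: 0; 0; 0]] k) o0 = 0 :> C.
    by move: k0; have [->|->|->] := ord3P k.
  have -> : nth 0 (nth [::] [:: [:: 1; 0; 0]; [:: 0; 0; 0]; [:: 0; 0; 0]] o0) l = 0 :> C.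
    by move: l0; have [->|->|->] := ord3P l.
  by rewrite /= !add0r mulrDl mul1r => -> /eqP; rewrite -subr_eq0 addrK => /eqP.
move=> i; have [->|->|->] := ord3P i; try exact: zkl.
have := mn o0 o2 o2 o0; rewrite [z o2 o2]zkl // mulr0 [z o2 o0]zs => /eqP.
by rewrite mulf_eq0 orbb => /eqP.
Qed.
End SymmetricForms.

(** * The nullcone *)

Lemma polyfun_curve (K : fieldType) (W : vectType K) (F : W -> K) (u v : W) a b :
  polyfun F -> exists q : {poly K}, forall t, q.[t] = F (t ^+ a *: u + t ^+ b *: v).
Proof.
move=> [Q QF]; pose c (i : 'I_(\dim {:W})) : {poly K} :=
  coord (vbasis {:W}) i u *: 'X^a + coord (vbasis {:W}) i v *: 'X^b.
exists (\sum_(m <- msupp Q) Q@_m *: \prod_i c i ^+ m i) => t.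
rewrite QF mevalE horner_sum; apply: eq_bigr => m _.
rewrite hornerZ horner_prod; congr (_ * _); apply: eq_bigr => i _.
rewrite horner_exp /c !hornerE linearD !linearZ /=.
by congr (_ ^+ _); rewrite ![_ * t ^+ _]mulrC.
Qed.

Section Nullcone.
Variables (C : numClosedFieldType) (p : nat).
Local Notation W := (pV C p).

(** F (t^a u + t^b v) is a polynomial in t, constant outside 0, hence
    constant. *)
Lemma contracted_invariant (F : W -> C) (y u v : W) a b :
  polyfun F -> (0 < a)%N -> (0 < b)%N ->
  (forall t, t != 0 -> F (t ^+ a *: u + t ^+ b *: v) = F y) -> F y = F 0.
Proof.
move=> pF a0 b0 H; have [q qE] := polyfun_curve u v a b pF.
have q0 : (q - (F y)%:P) * 'X = 0.
  apply: poly_eq0_eval => t; rewrite hornerM hornerX hornerD hornerN hornerC qE.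
  case: (eqVneq t 0) => [->|nz]; first by rewrite mulr0.
  by rewrite H // subrr mul0r.
have : q.[0] = F y.
  move/eqP: q0; rewrite mulf_eq0 polyX_eq0 orbF subr_eq0 => /eqP ->.
  by rewrite hornerC.
by rewrite qE !expr0n !gtn_eqF // !scale0r addr0.
Qed.

(** The subgroup diag (t, t, t^-2) multiplies y by t^2. *)
Lemma vertex_contracted (F : W -> C) (y : W) : polyfun F -> SL3_invariant F ->
  (forall i r, vsval (y i) r o2 = 0) -> F y = F 0.
Proof.
move=> pF Finv y2; apply: (@contracted_invariant F y y 0 2 1) => // t nz.
rewrite scaler0 addr0 -[RHS](Finv (diag33 t t (t ^- 2))); last first.
  by rewrite mx33_det !(mulr0, mul0r, subr0, addr0); field.
congr (F _); apply: pV_ext => i; rewrite pV_actE diag33_congr pV_scaleE.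
have ys r : vsval (y i) o2 r = 0 by have := entry_sym i r o2 y; rewrite /entry y2.
move: (vsval (y i)) (y2 i) ys => z z2 z2'.
by apply: mx33_ext; rewrite !mxE /= ?z2 ?z2' ?mulr0 // -expr2.
Qed.

(** The subgroup diag (t^2, t^-1, t^-1) multiplies the entry (0, 0) by t^4 and
    the entries (0, 1) and (0, 2) by t; the others vanish. *)
Lemma isotropic_contracted (F : W -> C) (y : W) : polyfun F -> SL3_invariant F ->
  (forall i, [/\ vsval (y i) o1 o1 = 0, vsval (y i) o1 o2 = 0 & vsval (y i) o2 o2 = 0]) ->
  F y = F 0.
Proof.
move=> pF Finv y2.
pose u : W := [ffun i => vsproj (symspace C) (mx33 (vsval (y i) o0 o0) 0 0 0 0 0 0 0 0)].
have uE i : vsval (u i) = mx33 (vsval (y i) o0 o0) 0 0 0 0 0 0 0 0.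
  rewrite ffunE vsprojK //; apply/symspaceP.
  by apply: mx33_ext; rewrite !mxE.
apply: (@contracted_invariant F y u (y - u) 4 1) => // t nz.
rewrite -[RHS](Finv (diag33 (t ^+ 2) (t^-1) (t^-1))); last first.
  by rewrite mx33_det !(mulr0, mul0r, subr0, addr0); field.
congr (F _); apply: pV_ext => i; rewrite pV_actE diag33_congr pV_addE !pV_scaleE pV_addE.
have -> : vsval ((- u) i) = - vsval (u i) by rewrite ffunE.
rewrite uE; have [y11 y12 y22] := y2 i.
have ys r s : vsval (y i) r s = vsval (y i) s r := entry_sym i r s y.
move: (vsval (y i)) y11 y12 y22 ys => z y11 y12 y22 zs.
have y21 : z o2 o1 = 0 by rewrite zs.
apply: mx33_ext; rewrite [LHS]mxE [in RHS]mxE ![(_ *: _ : 'M_3) _ _]mxE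
  ?[(_ - _ : 'M_3) _ _]mxE ?[(- _ : 'M_3) _ _]mxE ?[mx33 _ _ _ _ _ _ _ _ _ _ _]mxE /=
  ?y11 ?y12 ?y21 ?y22 ?(mulr0, subr0, addr0, add0r, subrr) //; try by field.
Qed.

(** The determinant vanishes on the span of the x_i, because det is f / 6 on
    the diagonal and f is trilinear. The matrix g given by
    [singular_space_form] need not have determinant 1, but homogeneous
    functions only see it up to scale. *)
Theorem nullcone_cut_out (x : W) : (forall i j k, polarf i j k x = 0) ->
  forall d F, (0 < d)%N -> SL3_invariant F -> homogfun d F -> F x = 0.
Proof.
move=> x0 d F d0 Finv Fd.
pose X (y : 'M[C]_3) := exists c : 'I_p -> C, y = \sum_i c i *: vsval (x i).
have polar_sum (c : 'I_p -> C) (y z : 'M[C]_3) :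
    polarM (\sum_i c i *: vsval (x i)) y z = \sum_i c i * polarM (vsval (x i)) y z.
  have p0 : polarM 0 y z = 0 by rewrite /polarM /rowdet !mxE; ring.
  elim: (index_enum _) => [|i r IH]; first by rewrite !big_nil.
  by rewrite !big_cons polarM_linear IH.
have [|||g dg H] := @singular_space_form C X.
- move=> a _ _ [c ->] [c' ->]; exists (fun i => a * c i + c' i).
  rewrite scaler_sumr -big_split; apply: eq_bigr => i _.
  by rewrite /= scalerA -scalerDl.
- move=> _ [c ->]; rewrite linear_sum; apply: eq_bigr => i _.
  by rewrite linearZ /= (symspaceP _ (subvsP (x i))).
- move=> y [c yE]; have six0 : 6%:R != 0 :> C by rewrite pnatr_eq0.
  apply: (mulfI six0); rewrite mulr0 -polarM_diag {1}yE polar_sum big1 // => i _.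
  rewrite polarM_C12 {1}yE polar_sum big1 ?mulr0 // => j _.
  rewrite polarM_C23 polarM_C12 {1}yE polar_sum big1 ?mulr0 // => k _.
  by rewrite -polar_detE -/(polarf k j i x) x0 mulr0.
have Xx i : X (vsval (x i)).
  exists (fun j => (j == i)%:R); rewrite (bigD1 i) //= eqxx scale1r big1 ?addr0 // => j /negPf ->.
  by rewrite scale0r.
have pF := homogfun_polyfun Fd.
have F0 : F 0 = 0.
  by rewrite -(scale0r 0) (homogfun_scale _ _ Fd) expr0n gtn_eqF // mul0r.
have Fgx : F (pV_act g x) = 0.
  rewrite -F0; case: H => H.
    by apply: vertex_contracted => // i r; rewrite pV_actE; apply: H.
  by apply: isotropic_contracted => // i; rewrite pV_actE; apply: H.
pose s := 3.-root (\det g); have s3 : s ^+ 3 = \det g by rewrite rootCK.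
have nzs : s != 0 by apply: contraNneq dg => s0; rewrite -s3 s0 expr0n.
move: Fgx; have -> : g = s *: (s^-1 *: g) by rewrite scalerA mulfV // scale1r.
rewrite pV_actZ (homogfun_scale _ _ Fd) Finv; last by rewrite detZ exprVn s3 mulVf.
by move=> /eqP; rewrite mulf_eq0 !expf_eq0 (negPf nzs) !andbF /= => /eqP.
Qed.
End Nullcone.

(** * Simultaneous diagonalization of a pencil *)

(** The discriminant of the binary cubic a X^3 + b X^2 Y + c X Y^2 + d Y^3. *)
Definition cdisc (R : comRingType) (a b c d : R) : R :=
  b ^+ 2 * c ^+ 2 - 4%:R * a * c ^+ 3 - 4%:R * b ^+ 3 * d
  + 18%:R * a * b * c * d - 27%:R * a ^+ 2 * d ^+ 2.

Lemma cdisc_roots (R : comRingType) (a x y z : R) :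
  cdisc a (a * (x + y + z)) (a * (x * y + y * z + z * x)) (a * (x * y * z)) =
  a ^+ 4 * ((x - y) * (y - z) * (z - x)) ^+ 2.
Proof. by rewrite /cdisc; ring. Qed.

Lemma cubic_roots (K : closedFieldType) (a b c d : K) : a != 0 ->
  exists x y z, [/\ b = a * (x + y + z), c = a * (x * y + y * z + z * x) & d = a * (x * y * z)].
Proof.
move=> nza; pose P : {poly K} := a *: 'X^3 - b *: 'X^2 + c *: 'X - d%:P.
have PE : P = Poly [:: - d; c; - b; a].
  rewrite /P /= !cons_poly_def polyCN mul0r add0r -!mul_polyC polyCN; ring.
have szP : size P = 4%N by rewrite PE (PolyK (c := 0)).
have lP : lead_coef P = a by rewrite lead_coefE szP PE (PolyK (c := 0)).
have [r rE] := closed_field_poly_normal P.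
have szr : size r = 3%N.
  by move: szP; rewrite rE lP size_scale // size_prod_XsubC => -[].
case: r szr rE => [|x [|y [|z []]]] // _; rewrite lP !big_cons big_nil mulr1 => rE.
exists x, y, z.
have E : P = a *: 'X^3 - (a * (x + y + z)) *: 'X^2 + (a * (x * y + y * z + z * x)) *: 'X
     - (a * (x * y * z))%:P.
  by rewrite rE -!mul_polyC !(polyCM, polyCD); ring.
have co k : P`_k = [:: - d; c; - b; a]`_k by rewrite PE coef_Poly.
have co' k : P`_k = [:: - (a * (x * y * z)); a * (x * y + y * z + z * x); - (a * (x + y + z)); a]`_k.
  have -> : P = Poly [:: - (a * (x * y * z)); a * (x * y + y * z + z * x); - (a * (x + y + z)); a].
    rewrite E /= !cons_poly_def !polyCN mul0r add0r -!mul_polyC; ring.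
  by rewrite coef_Poly.
split.
- by apply: oppr_inj; have := co 2%N; rewrite co' /= => ->.
- by have := co 1%N; rewrite co' /= => ->.
- by apply: oppr_inj; have := co 0%N; rewrite co' /= => ->.
Qed.

Section PencilDiagonalization.
Variable C : numClosedFieldType.
Implicit Types (x y g : 'M[C]_3).

Definition row33 (v : 'I_3 -> 'rV[C]_3) : 'M[C]_3 := \matrix_(i, j) v i 0 j.

Lemma distinct3 (a b c : C) : (a - b) * (b - c) * (c - a) != 0 ->
  forall l : 'I_3 -> C, l o0 = a -> l o1 = b -> l o2 = c -> forall i j, i != j -> l i != l j.
Proof.
rewrite !mulf_eq0 !negb_or !subr_eq0 => /andP [/andP [ab bc] ca] l l0 l1 l2 i j.
by have [->|->|->] := ord3P i; have [->|->|->] := ord3P j;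
  rewrite ?eqxx // ?l0 ?l1 ?l2 => _ //; rewrite eq_sym.
Qed.

(** The hypothesis says that the binary cubic det (X x + Y y) has three
    distinct roots. The vectors v_i with v_i y = l_i v_i x are then linearly
    independent, and orthogonal for both forms since l_i (v_i x v_j^T) = l_j
    (v_i x v_j^T). Scaling them makes x the identity, and a last scaling makes
    the determinant 1. *)
Lemma pencil_diagonalization x y : x^T = x -> y^T = y -> \det x != 0 ->
  cdisc (\det x) (polarM x x y / 2%:R) (polarM x y y / 2%:R) (\det y) != 0 ->
  exists g t a b c, [/\ \det g = 1, g *m x *m g^T = diag33 t t t & g *m y *m g^T = diag33 a b c].
Proof.
move=> xs ys dx.
have [l0 [l1 [l2 [E1 E2 E3]]]] := cubic_roots (polarM x x y / 2%:R) (polarM x y y / 2%:R) (\det y) dx.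
rewrite E1 E2 E3 cdisc_roots mulf_eq0 negb_or expf_eq0 /= => /andP [_]; rewrite expf_eq0 /= => dist.
pose l (i : 'I_3) := [:: l0; l1; l2]`_i.
have lne : forall i j, i != j -> l i != l j by apply: (distinct3 dist).
have two0 : 2%:R != 0 :> C by rewrite pnatr_eq0.
have detl i : \det (y - l i *: x) = 0.
  have -> : \det (y - l i *: x) = \det y - l i * (polarM x y y / 2%:R) +
      l i ^+ 2 * (polarM x x y / 2%:R) - l i ^+ 3 * \det x.
    by rewrite !det3 /polarM /rowdet !mxE; field.
  rewrite E1 E2 E3 /l; have [->|->|->] := ord3P i; rewrite /=; ring.
have /choice [v vP] : forall i, exists v : 'rV[C]_3, v != 0 /\ v *m y = l i *: (v *m x).
  move=> i; have /det0P [v nzv vE] : \det (y - l i *: x) == 0 by rewrite detl.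
  exists v; split=> //; apply/eqP; rewrite -subr_eq0 -vE mulmxBr.
  by rewrite -scalemxAr.
pose P := row33 v.
have Pm z i j : (P *m z) i j = (v i *m z) 0 j.
  by rewrite !mxE; apply: eq_bigr => k _; rewrite mxE.
have PyE i j : (P *m y) i j = l i * (P *m x) i j.
  by have [_ e] := vP i; rewrite !Pm e mxE.
pose B := P *m x *m P^T.
have PyP i j : (P *m y *m P^T) i j = l i * B i j.
  rewrite [LHS]mxE [B i j]mxE mulr_sumr; apply: eq_bigr => k _.
  by rewrite PyE mulrA.
have symP z : z^T = z -> forall i j, (P *m z *m P^T) i j = (P *m z *m P^T) j i.
  move=> zs i j; suff zT : (P *m z *m P^T)^T = P *m z *m P^T by rewrite -{1}zT mxE.
  by rewrite !trmx_mul trmxK zs mulmxA.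
have B0 i j : i != j -> B i j = 0.
  move=> /lne nl; have := symP y ys i j; rewrite !PyP [B j i](symP x xs) => /eqP.
  by rewrite -subr_eq0 -mulrBl mulf_eq0 subr_eq0 (negPf nl) /= => /eqP.
have ux : x \in unitmx by rewrite unitmxE unitfE.
have dP : \det P != 0.
  apply/negP => /det0P [c nzc cP].
  have step (e : 'rV[C]_3) : e *m P = 0 -> (\row_i (e 0 i * l i)) *m P = 0.
    move=> eP; have eLPx : (\row_i (e 0 i * l i)) *m P *m x = e *m P *m y.
      rewrite -!mulmxA; apply/rowP => j; rewrite mxE [RHS]mxE; apply: eq_bigr => i _.
      by rewrite mxE PyE mulrA.
    by rewrite -[LHS](mulmxK ux) eLPx eP mul0mx mul0mx.
  have cP1 := step _ cP; have cP2 := step _ cP1.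
  case/eqP: nzc; apply/rowP => i; rewrite [RHS]mxE.
  have [nzv _] := vP i.
  have [k nzk] : exists k, v i 0 k != 0.
    apply: contrapT => none; case/eqP: nzv; apply/rowP => k; rewrite mxE.
    by apply/eqP/negP => /negP nz; apply: none; exists k.
  have e0 : c 0 o0 * v o0 0 k + (c 0 o1 * v o1 0 k + c 0 o2 * v o2 0 k) = 0.
    by have /rowP/(_ k) := cP; rewrite mxE sum3 !mxE.
  have e1 : c 0 o0 * l o0 * v o0 0 k + (c 0 o1 * l o1 * v o1 0 k + c 0 o2 * l o2 * v o2 0 k) = 0.
    by have /rowP/(_ k) := cP1; rewrite mxE sum3 !mxE.
  have e2 : c 0 o0 * l o0 * l o0 * v o0 0 k + (c 0 o1 * l o1 * l o1 * v o1 0 k + c 0 o2 * l o2 * l o2 * v o2 0 k) = 0.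
    by have /rowP/(_ k) := cP2; rewrite mxE sum3 !mxE.
  (* Apply the product of the M - l_j, j <> i, to the relation, where M is the
     operator with eigenvectors v_j and eigenvalues l_j. *)
  have lag (i1 i2 i3 : 'I_3) : i1 != i2 -> i1 != i3 ->
      (c 0 i1 * v i1 0 k) * ((l i1 - l i2) * (l i1 - l i3)) = 0 -> c 0 i1 * v i1 0 k = 0.
    move=> /lne n12 /lne n13 /eqP; rewrite !mulf_eq0 !subr_eq0 (negPf n12) (negPf n13) !orbF.
    by rewrite -mulf_eq0 => /eqP.
  have cv : c 0 i * v i 0 k = 0.
    have [ii|ii|ii] := ord3P i; rewrite ii.
    - apply: (lag o0 o1 o2) => //.
      transitivity ((c 0 o0 * l o0 * l o0 * v o0 0 k + (c 0 o1 * l o1 * l o1 * v o1 0 k + c 0 o2 * l o2 * l o2 * v o2 0 k))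
        - (l o1 + l o2) * (c 0 o0 * l o0 * v o0 0 k + (c 0 o1 * l o1 * v o1 0 k + c 0 o2 * l o2 * v o2 0 k))
        + l o1 * l o2 * (c 0 o0 * v o0 0 k + (c 0 o1 * v o1 0 k + c 0 o2 * v o2 0 k))); first by ring.
      by rewrite e0 e1 e2 !mulr0 subr0 addr0.
    - apply: (lag o1 o0 o2) => //.
      transitivity ((c 0 o0 * l o0 * l o0 * v o0 0 k + (c 0 o1 * l o1 * l o1 * v o1 0 k + c 0 o2 * l o2 * l o2 * v o2 0 k))
        - (l o0 + l o2) * (c 0 o0 * l o0 * v o0 0 k + (c 0 o1 * l o1 * v o1 0 k + c 0 o2 * l o2 * v o2 0 k))
        + l o0 * l o2 * (c 0 o0 * v o0 0 k + (c 0 o1 * v o1 0 k + c 0 o2 * v o2 0 k))); first by ring.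
      by rewrite e0 e1 e2 !mulr0 subr0 addr0.
    - apply: (lag o2 o0 o1) => //.
      transitivity ((c 0 o0 * l o0 * l o0 * v o0 0 k + (c 0 o1 * l o1 * l o1 * v o1 0 k + c 0 o2 * l o2 * l o2 * v o2 0 k))
        - (l o0 + l o1) * (c 0 o0 * l o0 * v o0 0 k + (c 0 o1 * l o1 * v o1 0 k + c 0 o2 * l o2 * v o2 0 k))
        + l o0 * l o1 * (c 0 o0 * v o0 0 k + (c 0 o1 * v o1 0 k + c 0 o2 * v o2 0 k))); first by ring.
      by rewrite e0 e1 e2 !mulr0 subr0 addr0.
  by move/eqP: cv; rewrite mulf_eq0 (negPf nzk) orbF => /eqP.
have nzB i : B i i != 0.
  have : \det B != 0 by rewrite /B !det_mulmx det_tr !mulf_neq0.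
  rewrite det3 [B o0 o1]B0 // [B o0 o2]B0 // [B o1 o2]B0 // [B o2 o1]B0 //.
  rewrite !(mul0r, mulr0, subr0, addr0) !mulf_eq0 !negb_or => /andP [n0 /andP [n1 n2]].
  by have [->|->|->] := ord3P i.
pose r i := (sqrtC (B i i))^-1.
have nzr i : r i != 0 by rewrite invr_eq0 sqrtC_eq0.
have rB i : r i * r i * B i i = 1.
  by rewrite -expr2 exprVn sqrtCK mulVf.
pose Q := diag33 (r o0) (r o1) (r o2) *m P.
have QE z : Q *m z *m Q^T = diag33 (r o0) (r o1) (r o2) *m (P *m z *m P^T) *m (diag33 (r o0) (r o1) (r o2))^T.
  by rewrite /Q trmx_mul !mulmxA.
have dQ : \det Q != 0.
  rewrite /Q det_mulmx mulf_neq0 // mx33_det !(mul0r, mulr0, subr0, addr0).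
  by rewrite !mulf_neq0.
have Qx : Q *m x *m Q^T = diag33 1 1 1.
  rewrite QE diag33_congr -/B !rB /diag33.
  by congr mx33; rewrite B0 // mulr0.
have Qy : Q *m y *m Q^T = diag33 (l o0) (l o1) (l o2).
  rewrite QE diag33_congr !PyP /diag33.
  by congr mx33; rewrite ?mulrA ?[_ * l _]mulrC -?mulrA ?[r _ * (r _ * _)]mulrA ?rB ?mulr1 // B0 // !mulr0.
pose s := 3.-root (\det Q); have s3 : s ^+ 3 = \det Q by rewrite rootCK.
have nzs : s != 0 by apply: contraNneq dQ => s0; rewrite -s3 s0 expr0n.
exists (s^-1 *: Q), (s^-1 ^+ 2), (s^-1 ^+ 2 * l o0), (s^-1 ^+ 2 * l o1), (s^-1 ^+ 2 * l o2).
have sE z : (s^-1 *: Q) *m z *m (s^-1 *: Q)^T = s^-1 ^+ 2 *: (Q *m z *m Q^T).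
  by rewrite linearZ /= -!scalemxAl -scalemxAr scalerA -expr2.
split.
- by rewrite detZ exprVn s3 mulVf.
- by rewrite sE Qx; apply: mx33_ext; rewrite !mxE /= ?mulr1 ?mulr0.
- by rewrite sE Qy; apply: mx33_ext; rewrite !mxE /= ?mulr0.
Qed.
End PencilDiagonalization.

(** * Prescribing values of the polarized determinant *)

Definition sym33 (R : nmodType) (d1 d2 d3 u v w : R) : 'M[R]_3 := mx33 d1 w v w d2 u v u d3.

Lemma sym33_tr (R : nmodType) (d1 d2 d3 u v w : R) : (sym33 d1 d2 d3 u v w)^T = sym33 d1 d2 d3 u v w.
Proof. by apply: mx33_ext; rewrite !mxE. Qed.

Lemma diag33_tr (R : nmodType) (a b c : R) : (diag33 a b c)^T = diag33 a b c.
Proof. by apply: mx33_ext; rewrite !mxE. Qed.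

Section SolveBlock.
Variable C : numClosedFieldType.

(** The first two equations determine (u^2, v^2, w^2) up to the line directed
    by (b - e, e - a, a - b). On this line the compatibility 4 u^2 v^2 w^2 =
    (2uvw)^2 with the third equation is a cubic equation, with leading
    coefficient 4 (b - e)(e - a)(a - b). The last unknown w is then given by
    the third equation if u v is nonzero, and is any square root otherwise. *)
Lemma solve_offdiagonal (a b e d1 d2 d3 al be ga : C) : (a - b) * (b - e) * (e - a) != 0 ->
  exists u v w, [/\ u ^+ 2 + v ^+ 2 + w ^+ 2 = al,
    a * u ^+ 2 + b * v ^+ 2 + e * w ^+ 2 = be
    & 2%:R * u * v * w - d1 * u ^+ 2 - d2 * v ^+ 2 - d3 * w ^+ 2 = ga].
Proof.
move=> dist; have := dist; rewrite !mulf_eq0 !negb_or => /andP [/andP [nab nbe] nea].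
have four0 : 4%:R != 0 :> C by rewrite pnatr_eq0.
have two0 : 2%:R != 0 :> C by rewrite pnatr_eq0.
pose U0 := (be - b * al) / (a - b); pose V0 := (a * al - be) / (a - b).
pose p := b - e; pose q := e - a; pose r := a - b.
pose G := ga + d1 * U0 + d2 * V0; pose H := d1 * p + d2 * q + d3 * r.
have nzA : 4%:R * (p * q * r) != 0.
  by rewrite !mulf_neq0.
have [s [y [z [E1 E2 E3]]]] := cubic_roots (- (4%:R * r * (U0 * q + V0 * p) - H ^+ 2))
  (4%:R * r * U0 * V0 - 2%:R * G * H) (G ^+ 2) nzA.
pose U := U0 + s * p; pose V := V0 + s * q; pose W := s * r.
have UVW : 4%:R * U * V * W = (G + s * H) ^+ 2.
  apply/eqP; rewrite -subr_eq0; apply/eqP.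
  transitivity (4%:R * (p * q * r) * s ^+ 3
    - (- (4%:R * r * (U0 * q + V0 * p) - H ^+ 2)) * s ^+ 2
    + (4%:R * r * U0 * V0 - 2%:R * G * H) * s - G ^+ 2); first by rewrite /U /V /W; ring.
  by rewrite E1 E2 E3; ring.
have GH : G + s * H = ga + d1 * U + d2 * V + d3 * W by rewrite /G /H /U /V /W; ring.
have sum1 : U + V + W = al by rewrite /U /V /W /U0 /V0 /p /q /r; field.
have sum2 : a * U + b * V + e * W = be by rewrite /U /V /W /U0 /V0 /p /q /r; field.
suff [w [w2 uvw]] : exists w, w ^+ 2 = W /\ 2%:R * sqrtC U * sqrtC V * w = G + s * H.
  exists (sqrtC U), (sqrtC V), w; rewrite !sqrtCK w2; split=> //.
  by rewrite uvw GH; ring.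
case: (eqVneq (sqrtC U * sqrtC V) 0) => [uv0|uv].
  exists (sqrtC W); rewrite sqrtCK; split=> //.
  have UV0 : U * V = 0 by rewrite -[U]sqrtCK -[V]sqrtCK -exprMn uv0 expr0n.
  rewrite -[2%:R * _ * _]mulrA uv0 mulr0 mul0r.
  apply/esym/eqP; rewrite -[_ == _](expf_eq0 _ 2) -UVW.
  by rewrite -[4%:R * _ * _]mulrA UV0 mulr0 mul0r.
move: uv; rewrite mulf_eq0 negb_or => /andP [nzu nzv].
exists ((G + s * H) / (2%:R * sqrtC U * sqrtC V)); split; last by field; rewrite ?nzu ?nzv ?two0.
have nzU : U != 0 by rewrite -sqrtC_eq0.
have nzV : V != 0 by rewrite -sqrtC_eq0.
rewrite expr_div_n -UVW !exprMn !sqrtCK.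
by field; rewrite ?nzU ?nzV ?two0.
Qed.

(** Lagrange interpolation: the equations prescribe the polynomial d1 (X +
    b)(X + e) + d2 (X + a)(X + e) + d3 (X + a)(X + b). *)
Lemma solve_diagonal (a b e s1 s2 s3 : C) : (a - b) * (b - e) * (e - a) != 0 ->
  exists d1 d2 d3, [/\ d1 + d2 + d3 = s1, (b + e) * d1 + (a + e) * d2 + (a + b) * d3 = s2
    & b * e * d1 + a * e * d2 + a * b * d3 = s3].
Proof.
rewrite !mulf_eq0 !negb_or => /andP [/andP [nab nbe] nea].
pose h x := s1 * x ^+ 2 - s2 * x + s3.
exists (h a / ((a - b) * (a - e))), (h b / ((b - a) * (b - e))), (h e / ((e - a) * (e - b))).
have nba : b - a != 0 by rewrite -opprB oppr_eq0.
have neb : e - b != 0 by rewrite -opprB oppr_eq0.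
have nae : a - e != 0 by rewrite -opprB oppr_eq0.
by split; rewrite /h; field; rewrite ?nab ?nbe ?nea ?nba ?neb ?nae.
Qed.

(** With S of diagonal d and off-diagonal entries u, v, w, the first three
    values only involve d, linearly; the last three then prescribe the
    left-hand sides of [solve_offdiagonal]. *)
Lemma solve_block (t a b e c0 c1 c2 c3 c4 c5 : C) : t != 0 -> (a - b) * (b - e) * (e - a) != 0 ->
  let T := diag33 t t t in let D := diag33 a b e in
  exists d1 d2 d3 u v w, let S := sym33 d1 d2 d3 u v w in
  (polarM T T S = c0 /\ polarM T D S = c1 /\ polarM D D S = c2) /\
  (polarM T S S = c3 /\ polarM D S S = c4 /\ polarM S S S = c5).
Proof.
move=> nzt dist /=.
have six0 : 6%:R != 0 :> C by rewrite pnatr_eq0.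
have two0 : 2%:R != 0 :> C by rewrite pnatr_eq0.
have [d1 [d2 [d3 [e1 e2 e3]]]] := solve_diagonal (c0 / (2%:R * t ^+ 2)) (c1 / t) (c2 / 2%:R) dist.
have [u [v [w [f1 f2 f3]]]] := solve_offdiagonal d1 d2 d3
  (d1 * d2 + d2 * d3 + d3 * d1 - c3 / (2%:R * t))
  (a * d2 * d3 + b * d1 * d3 + e * d1 * d2 - c4 / 2%:R) (c5 / 6%:R - d1 * d2 * d3) dist.
exists d1, d2, d3, u, v, w; split; split; last split; try split.
- transitivity (2%:R * t ^+ 2 * (d1 + d2 + d3)); first by rewrite /polarM /rowdet !mxE /=; ring.
  by rewrite e1; field; rewrite ?nzt ?two0.
- transitivity (t * ((b + e) * d1 + (a + e) * d2 + (a + b) * d3)); first by rewrite /polarM /rowdet !mxE /=; ring.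
  by rewrite e2; field.
- transitivity (2%:R * (b * e * d1 + a * e * d2 + a * b * d3)); first by rewrite /polarM /rowdet !mxE /=; ring.
  by rewrite e3; field.
- transitivity (2%:R * t * (d1 * d2 + d2 * d3 + d3 * d1 - (u ^+ 2 + v ^+ 2 + w ^+ 2))); first by rewrite /polarM /rowdet !mxE /=; ring.
  by rewrite f1; field; rewrite ?nzt ?two0.
- transitivity (2%:R * (a * d2 * d3 + b * d1 * d3 + e * d1 * d2 - (a * u ^+ 2 + b * v ^+ 2 + e * w ^+ 2))); first by rewrite /polarM /rowdet !mxE /=; ring.
  by rewrite f2; field.
transitivity (6%:R * (d1 * d2 * d3 + (2%:R * u * v * w - d1 * u ^+ 2 - d2 * v ^+ 2 - d3 * w ^+ 2))); first by rewrite /polarM /rowdet !mxE /=; ring.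
by rewrite f3; field.
Qed.

(** The four values are, up to constants, the coefficients of det (X T + Y D),
    a product of three linear forms. *)
Lemma solve_pencil (c0 c1 c2 c3 : C) : c0 != 0 ->
  cdisc (c0 / 6%:R) (c1 / 2%:R) (c2 / 2%:R) (c3 / 6%:R) != 0 ->
  exists t a b e, [/\ t != 0, (a - b) * (b - e) * (e - a) != 0 &
    let T := diag33 t t t in let D := diag33 a b e in
    (polarM T T T = c0 /\ polarM T T D = c1) /\ (polarM T D D = c2 /\ polarM D D D = c3)].
Proof.
move=> nz0.
have six0 : 6%:R != 0 :> C by rewrite pnatr_eq0.
have two0 : 2%:R != 0 :> C by rewrite pnatr_eq0.
pose t := 3.-root (c0 / 6%:R); have t3 : c0 / 6%:R = t ^+ 3 by rewrite rootCK.
have nzc : c0 / 6%:R != 0 by rewrite mulf_neq0 ?invr_eq0.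
have nzt : t != 0 by apply: contraNneq nzc; rewrite t3 => ->; rewrite expr0n.
have [x [y [z [E1 E2 E3]]]] := cubic_roots (c1 / 2%:R) (c2 / 2%:R) (c3 / 6%:R) nzc.
rewrite E1 E2 E3 cdisc_roots mulf_eq0 negb_or => /andP [_]; rewrite expf_eq0 /= => dist.
exists t, (t * x), (t * y), (t * z); split=> //.
  rewrite (_ : (t * x - t * y) * (t * y - t * z) * (t * z - t * x) = t ^+ 3 * ((x - y) * (y - z) * (z - x))); last by ring.
  by rewrite mulf_neq0 // -t3.
have F0 : c0 = 6%:R * t ^+ 3 by rewrite -t3; field.
have F1 : c1 = 2%:R * (t ^+ 3 * (x + y + z)) by rewrite -t3 -E1; field.
have F2 : c2 = 2%:R * (t ^+ 3 * (x * y + y * z + z * x)) by rewrite -t3 -E2; field.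
have F3 : c3 = 6%:R * (t ^+ 3 * (x * y * z)) by rewrite -t3 -E3; field.
by split; split; rewrite ?F0 ?F1 ?F2 ?F3 /polarM /rowdet !mxE /=; ring.
Qed.
End SolveBlock.

(** * A slice, and the transcendence degree of the invariants *)

Lemma polyfun_meval (K : fieldType) (W : vectType K) m (z : 'I_m -> W -> K) (P : {mpoly K[m]}) :
  (forall i, polyfun (z i)) -> polyfun (fun x => P.@[z^~ x]).
Proof.
move=> pz; apply: (@polyfun_ext _ _ (fun x => \sum_(e <- msupp P) P@_e * \prod_i z i x ^+ e i)).
  by move=> x; rewrite mevalE.
apply: polyfun_sum => e; apply: polyfunM; first exact: polyfunC.
by apply: polyfun_prod => i; apply: polyfunX.
Qed.

Lemma rmorph_cdisc (R S : comRingType) (f : {rmorphism R -> S}) a b c d :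
  f (cdisc a b c d) = cdisc (f a) (f b) (f c) (f d).
Proof. by rewrite /cdisc !(rmorph_nat, rmorphXn, rmorphD, rmorphN, rmorphM). Qed.

Section Indices.
Variable q : nat.
Local Notation N := (4 + q * 6)%N.

Definition idx0 : 'I_q.+2 := ord0.
Definition idx1 : 'I_q.+2 := lift ord0 ord0.
Definition idxS (j : 'I_q) : 'I_q.+2 := lift ord0 (lift ord0 j).

Lemma idxP (i : 'I_q.+2) : [\/ i = idx0, i = idx1 | exists j, i = idxS j].
Proof.
case: (unliftP ord0 i) => [i' ->|->]; last exact: Or31.
by case: (unliftP ord0 i') => [j ->|->]; [apply: Or33; exists j | apply: Or32].
Qed.

(** The N = 4 + 6q coordinates, where p = q + 2: four for the first two
    matrices, and six for each of the q others. *)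
Definition hd (k : 'I_4) : 'I_N := lshift (q * 6) k.
Definition bk (j : 'I_q) (r : 'I_6) : 'I_N := rshift 4 (mxvec_index j r).

Lemma coordP (l : 'I_N) : (exists k, l = hd k) \/ (exists j r, l = bk j r).
Proof.
case: (splitP l) => [k e|m e]; first by left; exists k; apply: val_inj.
right; case/mxvec_indexP: m e => j r e; exists j, r; exact: val_inj.
Qed.

Definition glue (T : Type) (h : 'I_4 -> T) (B : 'I_q -> 'I_6 -> T) (l : 'I_N) : T :=
  match split l with inl k => h k | inr m => mxvec (\matrix_(j, r) B j r) 0 m end.

Lemma glue_hd T h B k : @glue T h B (hd k) = h k.
Proof.
rewrite /glue; case: splitP => [k' e|m e]; first by congr h; apply: val_inj.
by have := ltn_ord k; rewrite [nat_of_ord k]e ltnNge leq_addr.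
Qed.

Lemma glue_bk T h B j r : @glue T h B (bk j r) = B j r.
Proof.
rewrite /glue; case: splitP => [k' e|m e].
  by have := ltn_ord k'; rewrite -e ltnNge leq_addr.
by rewrite (_ : m = mxvec_index j r) ?mxvecE ?mxE //; apply: val_inj; apply: (@addnI 4).
Qed.
End Indices.

Local Notation k0 := (@Ordinal 4 0 isT).
Local Notation k1 := (@Ordinal 4 1 isT).
Local Notation k2 := (@Ordinal 4 2 isT).
Local Notation k3 := (@Ordinal 4 3 isT).
Local Notation r0 := (@Ordinal 6 0 isT).
Local Notation r1 := (@Ordinal 6 1 isT).
Local Notation r2 := (@Ordinal 6 2 isT).
Local Notation r3 := (@Ordinal 6 3 isT).
Local Notation r4 := (@Ordinal 6 4 isT).
Local Notation r5 := (@Ordinal 6 5 isT).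

Lemma ord4P (k : 'I_4) : [\/ k = k0, k = k1, k = k2 | k = k3].
Proof.
by case: k => [[|[|[|[|//]]]] lt]; [apply: Or41|apply: Or42|apply: Or43|apply: Or44]; apply: val_inj.
Qed.

Lemma ord6P (r : 'I_6) : [\/ r = r0, r = r1 | r = r2] \/ [\/ r = r3, r = r4 | r = r5].
Proof.
by case: r => [[|[|[|[|[|[|//]]]]]] lt]; [left; apply: Or31|left; apply: Or32|left; apply: Or33
  |right; apply: Or31|right; apply: Or32|right; apply: Or33]; apply: val_inj.
Qed.

Section Slice.
Variables (C : numClosedFieldType) (q : nat).
Local Notation W := (pV C q.+2).
Local Notation N := (4 + q * 6)%N.

Definition tuple_of (T D : 'M[C]_3) (S : 'I_q -> 'M[C]_3) : W :=
  [ffun i => vsproj (symspace C) (if unlift ord0 i is Some i' then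
     if unlift ord0 i' is Some j then S j else D else T)].

Section TupleOf.
Variables (T D : 'M[C]_3) (S : 'I_q -> 'M[C]_3).
Hypotheses (sT : T^T = T) (sD : D^T = D) (sS : forall j, (S j)^T = S j).

Lemma tuple_of0 : vsval (tuple_of T D S (idx0 q)) = T.
Proof. by rewrite ffunE unlift_none vsprojK //; apply/symspaceP. Qed.

Lemma tuple_of1 : vsval (tuple_of T D S (idx1 q)) = D.
Proof. by rewrite ffunE liftK unlift_none vsprojK //; apply/symspaceP. Qed.

Lemma tuple_ofS j : vsval (tuple_of T D S (idxS j)) = S j.
Proof. by rewrite ffunE !liftK vsprojK //; apply/symspaceP. Qed.
End TupleOf.

(** Those f_ijk in which at most one index lies outside the first two,
    possibly repeated. *)
Definition basic_polar : 'I_N -> W -> C :=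
  glue (fun k => nth (fun=> 0) [:: polarf (idx0 q) (idx0 q) (idx0 q); polarf (idx0 q) (idx0 q) (idx1 q);
           polarf (idx0 q) (idx1 q) (idx1 q); polarf (idx1 q) (idx1 q) (idx1 q)] k)
       (fun j r => nth (fun=> 0) [:: polarf (idx0 q) (idx0 q) (idxS j); polarf (idx0 q) (idx1 q) (idxS j);
           polarf (idx1 q) (idx1 q) (idxS j); polarf (idx0 q) (idxS j) (idxS j);
           polarf (idx1 q) (idxS j) (idxS j); polarf (idxS j) (idxS j) (idxS j)] r).

Lemma basic_polarE l : exists i j k, basic_polar l = polarf i j k.
Proof.
pose z0 := idx0 q; pose z1 := idx1 q.
have [[k ->]|[j [r ->]]] := coordP l.
  rewrite /basic_polar glue_hd; have [->|->|->|->] := ord4P k.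
  - by exists z0, z0, z0.
  - by exists z0, z0, z1.
  - by exists z0, z1, z1.
  - by exists z1, z1, z1.
rewrite /basic_polar glue_bk; pose y := idxS j.
have [[->|->|->]|[->|->|->]] := ord6P r.
- by exists z0, z0, y.
- by exists z0, z1, y.
- by exists z1, z1, y.
- by exists z0, y, y.
- by exists z1, y, y.
- by exists y, y, y.
Qed.

Lemma basic_polar_invariant l : invariant_algebra (basic_polar l).
Proof.
have [i [j [k ->]]] := basic_polarE l; split; last exact: polarf_invariant.
apply: homogfun_polyfun; apply: homogfun_polarf.
Qed.

(** The product of det x_1, up to a constant, and the discriminant of det (X
    x_1 + Y x_2), as a polynomial in the values of [basic_polar]. *)
Definition generic_poly : {mpoly C[N]} :=
  'X_(hd q k0) * cdisc ((6%:R^-1)%:MP * 'X_(hd q k0)) ((2%:R^-1)%:MP * 'X_(hd q k1))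
    ((2%:R^-1)%:MP * 'X_(hd q k2)) ((6%:R^-1)%:MP * 'X_(hd q k3)).

Lemma generic_polyE v : generic_poly.@[v] =
  v (hd q k0) * cdisc (v (hd q k0) / 6%:R) (v (hd q k1) / 2%:R) (v (hd q k2) / 2%:R) (v (hd q k3) / 6%:R).
Proof.
rewrite /generic_poly mevalM mevalXU (rmorph_cdisc (meval v)) /= !mevalM !mevalC !mevalXU.
by rewrite ![_^-1 * _]mulrC.
Qed.

Lemma generic_poly_neq0 : generic_poly != 0.
Proof.
(* the values at x_1 = 1, x_2 = diag (0, 1, -1) *)
pose v := @glue q C (fun k => [:: 6%:R; 0; -2%:R; 0]`_k) (fun _ _ => 0).
apply/eqP => /(congr1 (meval v)); rewrite meval0 generic_polyE /v !glue_hd /=.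
apply/eqP; rewrite (_ : _ * _ = 24%:R) ?pnatr_eq0 //.
by rewrite /cdisc; field.
Qed.

(** Every point at which [generic_poly] does not vanish is a value of
    [basic_polar], so a polynomial P with P(basic_polar) = 0 vanishes where
    [generic_poly] does not, hence is 0. *)
Theorem basic_polar_independent : alg_indep basic_polar.
Proof.
move=> P P0; apply/eqP; apply: contraT => nzP.
have [v] : exists v, (P * generic_poly).@[v] != 0.
  by apply: mpoly_neq0_eval; rewrite mulf_neq0 ?generic_poly_neq0.
rewrite mevalM generic_polyE !mulf_eq0 !negb_or => /andP [nzPv /andP [nz0 nzd]].
have [t [a [b [e [nzt dist [[E0 E1] [E2 E3]]]]]]] := solve_pencil nz0 nzd.
have /choice [S SP] : forall j, exists S : 'M[C]_3, S^T = S /\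
  (polarM (diag33 t t t) (diag33 t t t) S = v (bk j r0) /\
   polarM (diag33 t t t) (diag33 a b e) S = v (bk j r1) /\
   polarM (diag33 a b e) (diag33 a b e) S = v (bk j r2)) /\
  (polarM (diag33 t t t) S S = v (bk j r3) /\ polarM (diag33 a b e) S S = v (bk j r4) /\
   polarM S S S = v (bk j r5)).
  move=> j; have [d1 [d2 [d3 [u [w [w' H]]]]]] := solve_block (v (bk j r0)) (v (bk j r1))
    (v (bk j r2)) (v (bk j r3)) (v (bk j r4)) (v (bk j r5)) nzt dist.
  by exists (sym33 d1 d2 d3 u w w'); split; [exact: sym33_tr | exact: H].
pose x := tuple_of (diag33 t t t) (diag33 a b e) S.
have x0 : vsval (x (idx0 q)) = diag33 t t t by rewrite tuple_of0 // diag33_tr.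
have x1 : vsval (x (idx1 q)) = diag33 a b e by rewrite tuple_of1 // diag33_tr.
have xS j : vsval (x (idxS j)) = S j by rewrite tuple_ofS // => j'; have [] := SP j'.
have xv : basic_polar^~ x =1 v.
  move=> l; have [[k ->]|[j [r ->]]] := coordP l; rewrite /basic_polar ?glue_hd ?glue_bk.
    by have [->|->|->|->] := ord4P k; rewrite /= /polarf polar_detE ?x0 ?x1.
  have [_ [[S0 [S1 S2]] [S3 [S4 S5]]]] := SP j.
  by have [[->|->|->]|[->|->|->]] := ord6P r; rewrite /= /polarf polar_detE ?x0 ?x1 xS.
by case/eqP: nzPv; rewrite -(P0 x); apply: meval_eq => l; rewrite xv.
Qed.

(** The linear subspace of the x with x_1 scalar and x_2 diagonal. *)
Definition slice (s : 'rV[C]_N) : W :=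
  tuple_of (diag33 (s 0 (hd q k0)) (s 0 (hd q k0)) (s 0 (hd q k0)))
    (diag33 (s 0 (hd q k1)) (s 0 (hd q k2)) (s 0 (hd q k3)))
    (fun j => sym33 (s 0 (bk j r0)) (s 0 (bk j r1)) (s 0 (bk j r2))
                    (s 0 (bk j r3)) (s 0 (bk j r4)) (s 0 (bk j r5))).

Lemma slice0 s : vsval (slice s (idx0 q)) = diag33 (s 0 (hd q k0)) (s 0 (hd q k0)) (s 0 (hd q k0)).
Proof. by rewrite tuple_of0 // diag33_tr. Qed.

Lemma slice1 s : vsval (slice s (idx1 q)) = diag33 (s 0 (hd q k1)) (s 0 (hd q k2)) (s 0 (hd q k3)).
Proof. by rewrite tuple_of1 // diag33_tr. Qed.

Lemma sliceS s j : vsval (slice s (idxS j)) = sym33 (s 0 (bk j r0)) (s 0 (bk j r1)) (s 0 (bk j r2))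
                    (s 0 (bk j r3)) (s 0 (bk j r4)) (s 0 (bk j r5)).
Proof. by rewrite tuple_ofS // => j'; rewrite sym33_tr. Qed.

Lemma polyfun_slice (F : W -> C) : polyfun F -> polyfun (fun s => F (slice s)).
Proof.
apply: polyfun_comp => i.
have pl l : polyfun (fun s : 'rV[C]_N => s 0 l).
  by apply: homogfun_polyfun; apply: homogfun_linear => c u v; rewrite !mxE.
have p33 (f1 f2 f3 f4 f5 f6 f7 f8 f9 : 'rV[C]_N -> C) r s :
    polyfun f1 -> polyfun f2 -> polyfun f3 -> polyfun f4 -> polyfun f5 -> polyfun f6 ->
    polyfun f7 -> polyfun f8 -> polyfun f9 ->
    polyfun (fun x => mx33 (f1 x) (f2 x) (f3 x) (f4 x) (f5 x) (f6 x) (f7 x) (f8 x) (f9 x) r s).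
  move=> h1 h2 h3 h4 h5 h6 h7 h8 h9.
  have [->|->|->] := ord3P r; have [->|->|->] := ord3P s.
  - by apply: polyfun_ext h1 => x; rewrite mxE.
  - by apply: polyfun_ext h2 => x; rewrite mxE.
  - by apply: polyfun_ext h3 => x; rewrite mxE.
  - by apply: polyfun_ext h4 => x; rewrite mxE.
  - by apply: polyfun_ext h5 => x; rewrite mxE.
  - by apply: polyfun_ext h6 => x; rewrite mxE.
  - by apply: polyfun_ext h7 => x; rewrite mxE.
  - by apply: polyfun_ext h8 => x; rewrite mxE.
  - by apply: polyfun_ext h9 => x; rewrite mxE.
apply: (@polyfun_ext _ _ (fun s => \sum_j \sum_r \sum_t
    entry j r t (slice s) * coord (vbasis {:W}) i (unit_entry C j r t))).
  move=> s; rewrite [slice s in RHS]pV_decomp linear_sum; apply: eq_bigr => j _.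
  rewrite linear_sum; apply: eq_bigr => r _.
  by rewrite linear_sum; apply: eq_bigr => t _; rewrite linearZ.
apply: polyfun_sum => j; apply: polyfun_sum => r; apply: polyfun_sum => t.
apply: polyfunM; last exact: polyfunC.
have [->|->|[j' ->]] := idxP j.
- apply: (@polyfun_ext _ _ (fun s : 'rV[C]_N => diag33 (s 0 (hd q k0)) (s 0 (hd q k0)) (s 0 (hd q k0)) r t)).
    by move=> s; rewrite /entry slice0.
  by apply: p33 => //; apply: polyfunC.
- apply: (@polyfun_ext _ _ (fun s : 'rV[C]_N => diag33 (s 0 (hd q k1)) (s 0 (hd q k2)) (s 0 (hd q k3)) r t)).
    by move=> s; rewrite /entry slice1.
  by apply: p33 => //; apply: polyfunC.
apply: (@polyfun_ext _ _ (fun s : 'rV[C]_N => sym33 (s 0 (bk j' r0)) (s 0 (bk j' r1)) (s 0 (bk j' r2))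
                    (s 0 (bk j' r3)) (s 0 (bk j' r4)) (s 0 (bk j' r5)) r t)).
  by move=> s; rewrite /entry sliceS.
exact: p33.
Qed.

Lemma generic_meets_slice (x : W) : generic_poly.@[basic_polar^~ x] != 0 ->
  exists g s, \det g = 1 /\ pV_act g x = slice s.
Proof.
rewrite generic_polyE /basic_polar !glue_hd /= /polarf !polar_detE.
rewrite !polarM_diag => nz.
have six0 : 6%:R != 0 :> C by rewrite pnatr_eq0.
move: nz; rewrite ![6%:R * _ / _]mulrAC mulfV // !mul1r !mulf_eq0 !negb_or => /andP [/andP [_ nzd] nzc].
have sx i : (vsval (x i))^T = vsval (x i) by apply/symspaceP/subvsP.
have [g [t [a [b [c [dg gT gD]]]]]] := pencil_diagonalization (sx _) (sx _) nzd nzc.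
pose f j r s := vsval (pV_act g x (idxS j)) r s.
pose s : 'rV[C]_N := \row_l glue (fun k => [:: t; a; b; c]`_k)
   (fun j r => [:: f j o0 o0; f j o1 o1; f j o2 o2; f j o1 o2; f j o0 o2; f j o0 o1]`_r) l.
exists g, s; split=> //; apply: pV_ext => i; have [->|->|[j ->]] := idxP i.
- by rewrite slice0 pV_actE gT !mxE !glue_hd.
- by rewrite slice1 pV_actE gD !mxE !glue_hd.
rewrite sliceS !mxE !glue_bk /= /f.
have zs r r' : vsval (pV_act g x (idxS j)) r r' = vsval (pV_act g x (idxS j)) r' r
  := entry_sym (idxS j) r r' (pV_act g x).
move: (vsval _) zs => z zs.
by apply: mx33_ext; rewrite [RHS]mxE //= zs.
Qed.

(** The restrictions to the slice are polynomials in N variables, hence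
    dependent. The relation P(z) = 0 found there is an identity between
    invariants, so it holds at every x that can be moved into the slice, that
    is, wherever [generic_poly] does not vanish. *)
Theorem invariants_dependent m (z : 'I_m -> W -> C) : (N < m)%N ->
  (forall i, invariant_algebra (z i)) ->
  exists2 P : {mpoly C[m]}, P != 0 & forall x, P.@[z^~ x] = 0.
Proof.
move=> ltNm zA.
have dimN : \dim {:'rV[C]_N} = N by rewrite dimvf /dim /= mul1n.
have [|||P nzP PE] := @counting_dependence C 'rV[C]_N (\dim {:'rV[C]_N}) m 1
  (fun k s => coord (vbasis {:'rV[C]_N}) k s) (fun _ _ => 1) (fun i s => z i (slice s)).
- by rewrite dimN.
- by exists (fun=> 1) => s; rewrite big_ord1 meval1 mulr1.
- move=> i j; have [pz _] := zA i; have [Q QE] := polyfun_slice pz.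
  by exists (fun=> Q) => s; rewrite big_ord1 !mulr1 QE.
exists P => //; apply: (@polyfun_idom _ _ _ (fun x => generic_poly.@[basic_polar^~ x])).
- by apply: polyfun_meval => i; have [] := zA i.
- by apply: polyfun_meval => i; have [] := basic_polar_invariant i.
- apply: contrapT => none; have := generic_poly_neq0; case/negP; apply/eqP.
  apply: basic_polar_independent => x; apply/eqP/negP => /negP nz.
  by apply: none; exists x.
move=> x; case: (eqVneq (generic_poly.@[basic_polar^~ x]) 0) => [->|nz]; first by rewrite mulr0.
have [g [s [dg gx]]] := generic_meets_slice nz.
have -> : P.@[z^~ x] = P.@[z^~ (slice s)].
  by apply: meval_eq => i; rewrite -gx; have [_ ->] := zA i.
by rewrite PE mul0r.
Qed.
End Slice.

(** * The system of parameters *)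

Section PolarCombinations.
Variables (C : numClosedFieldType) (p : nat).
Local Notation W := (pV C p).

Definition polar_comb (F : W -> C) : Prop :=
  exists c : 'I_p -> 'I_p -> 'I_p -> C, forall x,
    F x = \sum_i \sum_j \sum_k c i j k * polar_det (x i) (x j) (x k).

Lemma polar_comb_polarf i j k : polar_comb (polarf i j k).
Proof.
exists (fun i' j' k' => ((i' == i) && (j' == j) && (k' == k))%:R) => x.
rewrite /polarf; move: (@polar_det C) => f.
rewrite (bigD1 i) //= (bigD1 j) //= (bigD1 k) //= !eqxx mul1r.
rewrite [X in _ + X + _ + _]big1 => [|k' /negPf ->]; last by rewrite andbF mul0r.
rewrite [X in _ + X + _]big1 => [|j' /negPf ->]; last first.
  by rewrite big1 // => k' _; rewrite andbF mul0r.
rewrite [X in _ + X]big1 => [|i' /negPf ->]; last first.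
  by rewrite big1 // => j' _; rewrite big1 // => k' _; rewrite mul0r.
by rewrite !addr0.
Qed.

Lemma polar_comb_lin (a b : C) F G : polar_comb F -> polar_comb G ->
  polar_comb (fun x => a * F x - b * G x).
Proof.
move=> [c cE] [d dE]; exists (fun i j k => a * c i j k - b * d i j k) => x.
rewrite cE dE !mulr_sumr -sumrB; apply: eq_bigr => i _.
rewrite !mulr_sumr -sumrB; apply: eq_bigr => j _.
rewrite !mulr_sumr -sumrB; apply: eq_bigr => k _.
by rewrite mulrBl !mulrA.
Qed.

Lemma polar_comb_homog F : polar_comb F -> homogfun 3 F.
Proof.
move=> [c cE]; apply: (@homogfun_ext _ _ _ (fun x : W => \sum_i \sum_j \sum_k c i j k * polarf i j k x)).
  by move=> x; rewrite cE.
apply: homogfun_sum => i; apply: homogfun_sum => j; apply: homogfun_sum => k.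
by apply: homogfunZ; apply: homogfun_polarf.
Qed.

Lemma polar_comb_invariant F : polar_comb F -> SL3_invariant F.
Proof.
move=> [c cE] g dg x; rewrite !cE; apply: eq_bigr => i _; apply: eq_bigr => j _.
apply: eq_bigr => k _; have := polarf_invariant i j k dg x.
by rewrite /polarf; move: (@polar_det C) => f ->.
Qed.

Definition cuts_nullcone m (y : 'I_m -> W -> C) : Prop :=
  (forall l, polar_comb (y l)) /\
  forall x, (forall l, y l x = 0) -> forall i j k, polarf i j k x = 0.

Lemma cuts_nullcone_finite m (y : 'I_m -> W -> C) :
  cuts_nullcone y -> module_finite_over (@invariant_algebra C p) y.
Proof.
move=> [yc yz]; apply: (@finite_over_nullcone_parameters C p m y (fun=> 3%N)).
  by move=> l; split=> //; [apply: polar_comb_invariant | apply: polar_comb_homog].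
move=> d F d0 Finv Fd x yx; apply: (nullcone_cut_out _ d0 Finv Fd).
exact: yz.
Qed.

(** If P(y) = 0 and P(a) is nonzero, replace the y_l by the linear forms in y
    that vanish at a. At a common zero y(x) = s a; for s nonzero, the point mu
    x with mu^3 = 1/s would satisfy y(mu x) = a. *)
Lemma cuts_nullcone_drop m (y : 'I_m.+1 -> W -> C) : cuts_nullcone y ->
  (exists2 P : {mpoly C[m.+1]}, P != 0 & forall x, P.@[y^~ x] = 0) ->
  exists y' : 'I_m -> W -> C, cuts_nullcone y'.
Proof.
move=> [yc yz] [P nzP Py].
have [a nzPa] := mpoly_neq0_eval nzP.
have yscale l c x : y l (c *: x) = c ^+ 3 * y l x.
  exact: (homogfun_scale _ _ (polar_comb_homog (yc l))).
have [j nzj] : exists j, a j != 0.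
  apply: contrapT => none; case/eqP: nzPa; rewrite -(Py 0); apply: meval_eq => l.
  rewrite -(scale0r 0) yscale expr0n mul0r.
  by apply/eqP/negP => /negP nz; apply: none; exists l.
(* linear forms in y with common zeros the multiples of a *)
exists (fun i x => a j * y (lift j i) x - a (lift j i) * y j x); split.
  by move=> i; apply: polar_comb_lin.
move=> x y'0; pose s := y j x / a j.
have ys l : y l x = s * a l.
  case: (unliftP j l) => [i ->|->]; last by rewrite /s mulfVK.
  have /eqP := y'0 i; rewrite subr_eq0 => /eqP e.
  by apply: (mulfI nzj); rewrite e /s; field.
apply: yz => l; case: (eqVneq s 0) => [s0|nzs]; first by rewrite ys s0 mul0r.
case/eqP: nzPa; pose mu := 3.-root (s^-1).
rewrite -(Py (mu *: x)); apply: meval_eq => l'.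
by rewrite yscale rootCK // ys mulKf.
Qed.

Lemma cuts_nullcone_all : exists y : 'I_#|{: 'I_p * 'I_p * 'I_p}| -> W -> C, cuts_nullcone y.
Proof.
exists (fun l => polarf (enum_val l).1.1 (enum_val l).1.2 (enum_val l).2); split.
  by move=> l; apply: polar_comb_polarf.
by move=> x y0 i j k; have := y0 (enum_rank (i, j, k)); rewrite enum_rankK.
Qed.
End PolarCombinations.

Section SystemOfParameters.
Variables (C : numClosedFieldType) (q : nat).
Local Notation W := (pV C q.+2).
Local Notation N := (4 + q * 6)%N.

(** The counting argument, applied to the action of the z_i on A(p). *)
Lemma module_finite_dependent d m (y : 'I_d -> W -> C) (z : 'I_m -> W -> C) : (d < m)%N ->
  module_finite_over (@invariant_algebra C q.+2) y ->
  (forall i, invariant_algebra (z i)) ->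
  exists2 P : {mpoly C[m]}, P != 0 & forall x, P.@[z^~ x] = 0.
Proof.
move=> ltdm [r [h [hA gen]]] zA.
apply: (counting_dependence (h := h) ltdm).
  apply: (gen (fun=> 1)); split; first exact: polyfunC.
  by [].
move=> i j; have [pz iz] := zA i; have [ph ih] := hA j.
apply: (gen (fun x => z i x * h j x)); split; first exact: polyfunM.
by move=> g dg x; rewrite iz // ih.
Qed.

Theorem polar_parameters : exists y : 'I_N -> W -> C, cuts_nullcone y /\ alg_indep y.
Proof.
have reduce m : (exists y : 'I_m -> W -> C, cuts_nullcone y) -> (N <= m)%N ->
    exists y : 'I_N -> W -> C, cuts_nullcone y.
  elim: m => [|m IH] [y yc]; first by [].
  rewrite leq_eqVlt => /orP [/eqP ->|ltNm]; first by exists y.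
  apply: IH => //; apply: (cuts_nullcone_drop yc).
  apply: invariants_dependent => // l; have [pc _] := yc.
  split; last exact: polar_comb_invariant.
  exact: homogfun_polyfun (polar_comb_homog (pc l)).
have [|y yc] := reduce _ (cuts_nullcone_all C q.+2).
  by rewrite !card_prod !card_ord; nia.
exists y; split=> // Q Q0; apply/eqP; apply: contraT => nzQ.
have [|y' y'c] := @cuts_nullcone_drop C q.+2 (3 + q * 6) y yc; first by exists Q.
have [P nzP P0] := module_finite_dependent (z := @basic_polar C q) (ltnSn _)
  (cuts_nullcone_finite y'c) (@basic_polar_invariant C q).
by case/eqP: nzP; apply: basic_polar_independent.
Qed.
End SystemOfParameters.

Theorem polar_hsop (C : numClosedFieldType) (p n : nat) : (2 <= p)%N -> n = (6 * p - 8)%N ->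
  exists theta : 'I_n -> pV C p -> C,
    [/\ is_hsop (@invariant_algebra C p) theta, forall l, homogfun 3 (theta l)
      & forall l, polar_comb (theta l)].
Proof.
case: p => [|[|q]] // _ ->; rewrite (_ : (6 * q.+2 - 8 = 4 + q * 6)%N); last by lia.
have [y [yc yi]] := polar_parameters C q; exists y; have [pc _] := yc.
have yh l : homogfun 3 (y l) by apply: polar_comb_homog.
split=> //; split=> // [l|l|]; last exact: cuts_nullcone_finite.
  split; last exact: polar_comb_invariant.
  exact: homogfun_polyfun (yh l).
by exists 3%N.
Qed.

Local Open Scope complex_scope.
Theorem mainTheorem5 (R : realType) (p : nat) (hp : (2 <= p)%N) :
  exists theta : 'I_(6 * p - 8) -> pV R[i] p -> R[i],
    [/\ is_hsop (@invariant_algebra R[i] p) theta,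
        forall l, homogfun 3 (theta l)
      & forall l, exists c : 'I_p -> 'I_p -> 'I_p -> R[i],
          forall x : pV R[i] p,
            theta l x = \sum_(i < p) \sum_(j < p) \sum_(k < p)
                          c i j k * polar_det (x i) (x j) (x k)].
Proof. exact: (@polar_hsop (R[i] : numClosedFieldType) p _ hp erefl). Qed.
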